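(* Let $k$ be an algebraically closed field of characteristic $0$. Let $\widetilde V$ be a finite-dimensional $k$-vector space with its standard grading, $G$ a finite subgroup of $GL(\widetilde V)$ containing no reflection, and $Z=\widetilde V/G$. Let $V$ be a graded finite-dimensional $k$-vector space, $W$ a finite reflection group on $V$ (commuting with the grading), and $L$ a homogeneous affine subspace of $V/W$ such that there is an isomorphism $Z\xrightarrow{\sim}L\times_{V/W}V$ compatible with the action of $k^\times$. Then there is a unique reflection group $\widetilde W$ on $\widetilde V$ containing $G$ as a normal subgroup and such that $\widetilde W/G=W$ (as groups acting on $Z$). Moreover, $G$ is a good normal subgroup of $\widetilde W$, and $W$ acts trivially on the quotient of $V$ by the tangent space to $Z$ at $0$.
   Context: A grading on a finite-dimensional $k$-vector space is an algebraic action of $k^\times$ with strictly positive weights; it is standard if all weights are $1$. A reflection is an automorphism $g$ of finite order with $\ker(g-1)$ a hyperplane; a finite linear group is a reflection group if generated by its reflections. $k[V]$ is the symmetric algebra of $V^*$ and $V/W=\operatorname{Spec}k[V]^W$, which is an affine space with $k^\times$-action since $W$ is a reflection group (so $k[V]^W$ is a polynomial algebra). A homogeneous affine subspace $L$ of $V/W$ is a $k^\times$-stable closed subscheme which is an affine space, i.e. which is defined by the vanishing of part of some system of algebraically independent homogeneous generators of $k[V]^W$. The group $W$ acts on $Z$ through the isomorphism $Z\simeq L\times_{V/W}V$ and its action on $V$; $Z$ is a closed subscheme of $V$ and its tangent space at $0$ is viewed as a subspace of $V$. Good: let $\widetilde W$ be a reflection group on $\widetilde V$ with normal subgroup $G$.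 Put $B=k[\widetilde V]$, $E=(B^G_+/(B^G_+)^2)^*$ the tangent space at $0$ of $\widetilde V/G=\operatorname{Spec}B^G$ ($B^G_+$ the ideal of positive-degree elements). A graded splitting $E^*\to B^G_+$, equivariant under the normalizer of $G$ in $GL(\widetilde V)$, induces a surjection $A=k[E]\to B^G$ with kernel $I$; $A_+$ is the ideal of positive-degree elements of $A$. $G$ is good in $\widetilde W$ if the minimal number of generators of $I$ is $\dim E-\dim\widetilde V$ and $\widetilde W/G$ acts trivially on $I/A_+I$. *)

(* Defs.v *)
From HB Require Import structures.
From mathcomp Require Import all_boot all_order all_algebra.
From mathcomp Require Import finmap mpoly.

Set Implicit Arguments.
Unset Strict Implicit.
Unset Printing Implicit Defensive.

Import GRing.Theory.
Local Open Scope ring_scope.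

(* Conventions.  A vector space of dimension n is 'rV[k]_n; GL_n acts on it on
   the right, v |-> v *m g, hence on the left on k['rV_n] = {mpoly k[n]}.  A
   morphism of affine schemes is given by the k-algebra morphism between the
   coordinate rings. *)

Section LinearGroups.
Variables (k : fieldType) (n : nat).

Definition finite_linear_group (G : {fset 'M[k]_n}) : Prop :=
  [/\ 1%:M \in G,
      forall g h, g \in G -> h \in G -> g *m h \in G,
      forall g, g \in G -> invmx g \in G
    & forall g, g \in G -> g \in unitmx].

Definition reflection (g : 'M[k]_n) : Prop :=
  [/\ g \in unitmx,
      exists2 e : nat, (0 < e)%N & g ^+ e = 1
    & (\rank (kermx (g - 1%:M))).+1 = n].

(* As W is finite, the subgroup generated by its reflections consists of the
   products of reflections of W. *)
Definition reflection_group (W : {fset 'M[k]_n}) : Prop :=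
  finite_linear_group W /\
  forall g, g \in W ->
    exists2 s : seq 'M[k]_n,
      forall r, r \in s -> r \in W /\ reflection r & g = \prod_(r <- s) r.

Definition normalizes (G : {fset 'M[k]_n}) (g : 'M[k]_n) : Prop :=
  g \in unitmx /\ forall h, (invmx g *m h *m g \in G) = (h \in G).

Definition normal_in (G H : {fset 'M[k]_n}) : Prop :=
  (forall g, g \in G -> g \in H) /\ (forall h, h \in H -> normalizes G h).

(* (act g f)(v) = f (v *m g) *)
Definition act (g : 'M[k]_n) (f : {mpoly k[n]}) : {mpoly k[n]} :=
  f \mPo [tuple \sum_(i < n) g i j *: 'X_i | j < n].

Definition invariant (G : {fset 'M[k]_n}) (f : {mpoly k[n]}) : Prop :=
  forall g, g \in G -> act g f = f.

(* The grading with weights d, as the action of t in k^* on 'rV_n. *)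
Definition grading_mx (d : 'I_n -> nat) (t : k) : 'M[k]_n :=
  diag_mx (\row_i t ^+ d i).

Definition homogeneous (d : 'I_n -> nat) (f : {mpoly k[n]}) : Prop :=
  exists e : nat,
    forall t : k, t != 0 -> act (grading_mx d t) f = t ^+ e *: f.

End LinearGroups.

Definition std_grading (n : nat) : 'I_n -> nat := fun=> 1%N.
Arguments std_grading : clear implicits.

Section Ideals.
Variable R : comNzRingType.

Definition ideal_span (s : seq R) (f : R) : Prop :=
  exists c : 'I_(size s) -> R, f = \sum_(i < size s) c i * s`_i.

Definition ideal_mul (I J : R -> Prop) (f : R) : Prop :=
  exists2 s : seq (R * R),
    forall x, x \in s -> I x.1 /\ J x.2 & f = \sum_(x <- s) x.1 * x.2.

Definition generates_ideal (s : seq R) (I : R -> Prop) : Prop :=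
  forall f, I f <-> ideal_span s f.

Definition min_number_of_generators (I : R -> Prop) (q : nat) : Prop :=
  (exists2 s : seq R, size s = q & generates_ideal s I) /\
  (forall s : seq R, generates_ideal s I -> (q <= size s)%N).

End Ideals.

Section Invariants.
Variable k : fieldType.

Definition homogeneous_generators (m : nat) (d : 'I_m -> nat)
    (W : {fset 'M[k]_m}) (r : nat) (F : r.-tuple {mpoly k[m]}) : Prop :=
  [/\ forall i, homogeneous d (tnth F i),
      forall p : {mpoly k[r]}, p \mPo F = 0 -> p = 0
    & forall f, invariant W f <-> exists p : {mpoly k[r]}, f = p \mPo F].

(* The homogeneous affine subspace L of V/W is given by the vanishing of the
   F_i, i in J, where F is as in homogeneous_generators.  The closed subscheme
   L x_{V/W} V of V is then defined by the ideal that they generate in k[V], and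
   phi is the comorphism of
     V~/G --iso--> L x_{V/W} V --closed immersion--> V. *)
Definition fibre_product_iso (n m : nat) (G : {fset 'M[k]_n})
    (d : 'I_m -> nat) (r : nat) (F : r.-tuple {mpoly k[m]}) (J : {set 'I_r})
    (phi : {lrmorphism {mpoly k[m]} -> {mpoly k[n]}}) : Prop :=
  [/\ forall h, invariant G h <-> exists f, phi f = h,
      forall f, phi f = 0 <-> ideal_span [seq tnth F i | i <- enum J] f
    & forall t f, t != 0 ->
        phi (act (grading_mx d t) f)
        = act (grading_mx (std_grading n) t) (phi f)].

(* pi induces a group isomorphism Wt/G -> W compatible with the actions of Wt/G
   on k[V~]^G and of W on the quotient k[V] / ker phi. *)
Definition quotient_is (n m : nat) (G Wt : {fset 'M[k]_n})
    (W : {fset 'M[k]_m}) (phi : {mpoly k[m]} -> {mpoly k[n]}) : Prop :=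
  exists pi : 'M[k]_n -> 'M[k]_m,
    [/\ forall g, g \in Wt -> pi g \in W,
        forall g h, g \in Wt -> h \in Wt -> pi (g *m h) = pi g *m pi h,
        forall w, w \in W -> exists2 g, g \in Wt & pi g = w,
        forall g, g \in Wt -> (pi g == 1%:M) = (g \in G)
      & forall g f, g \in Wt -> phi (act (pi g) f) = act g (phi f)].

(* v is tangent at 0 to the closed subscheme of 'rV_m with ideal I. *)
Definition tangent0 (m : nat) (I : {mpoly k[m]} -> Prop) (v : 'rV[k]_m) : Prop :=
  forall f, I f -> \sum_(i < m) v 0 i * (f^`M(i)).@[fun=> 0] = 0.

(* Positive-degree elements; the same for all systems of positive weights. *)
Definition mplus (e : nat) (p : {mpoly k[e]}) : Prop := p@_0%MM = 0.

Definition inv_plus (n : nat) (G : {fset 'M[k]_n}) (f : {mpoly k[n]}) : Prop :=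
  invariant G f /\ mplus f.

(* A graded N(G)-equivariant splitting of B^G_+ -> E^* = B^G_+ / (B^G_+)^2,
   given by the images u_i in B^G_+ of a homogeneous basis of E^*.  The linear
   section is N(G)-equivariant iff its image, the span of the u_i, is stable. *)
Definition equivariant_splitting (n : nat) (G : {fset 'M[k]_n}) (e : nat)
    (u : e.-tuple {mpoly k[n]}) : Prop :=
  [/\ forall i, inv_plus G (tnth u i) /\
        homogeneous (std_grading n) (tnth u i),
      forall f, inv_plus G f -> exists c : 'I_e -> k,
        ideal_mul (inv_plus G) (inv_plus G)
          (f - \sum_(i < e) c i *: tnth u i),
      forall c : 'I_e -> k,
        ideal_mul (inv_plus G) (inv_plus G) (\sum_(i < e) c i *: tnth u i) ->
        forall i, c i = 0
    & forall g, normalizes G g -> exists c : 'M[k]_e, forall j,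
        act g (tnth u j) = \sum_(i < e) c i j *: tnth u i].

(* The kernel I of A = k[E] -> B^G, 'X_i |-> u_i. *)
Definition splitting_ker (n e : nat) (u : e.-tuple {mpoly k[n]})
    (p : {mpoly k[e]}) : Prop := p \mPo u = 0.

(* In the second clause c is the matrix of the action of g on E^*. *)
Definition good_for (n : nat) (G Wt : {fset 'M[k]_n}) (e : nat)
    (u : e.-tuple {mpoly k[n]}) : Prop :=
  (exists2 q : nat, min_number_of_generators (splitting_ker u) q
                  & (q + n = e)%N) /\
  (forall g (c : 'M[k]_e), g \in Wt ->
     (forall j, act g (tnth u j) = \sum_(i < e) c i j *: tnth u i) ->
     forall p, splitting_ker u p ->
       ideal_mul (@mplus e) (splitting_ker u) (act c p - p)).

(* Goodness does not depend on the splitting, so it is required of all of them;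
   the first clause makes sure that there is one. *)
Definition good (n : nat) (G Wt : {fset 'M[k]_n}) : Prop :=
  (exists e (u : e.-tuple {mpoly k[n]}), equivariant_splitting G u) /\
  (forall e (u : e.-tuple {mpoly k[n]}),
     equivariant_splitting G u -> good_for G Wt u).

End Invariants.

(* Main.v *)
Require Import Defs.
From HB Require Import structures.
From mathcomp Require Import all_boot all_order all_algebra.
From mathcomp Require Import finmap mpoly.
From mathcomp Require Import ring.
From mathcomp Require boolp.
Import Defs.

(** The normalization of the graph of an automorphism of [Z = V~/G] is unramified
   in codimension 1 because [G] contains no reflection; concretely, if [y] is the
   tuple of the restrictions to [Z] of the [F_i], [i \notin J], the matrix
   [Jac y (v) (Jac y (q))^-1] takes finitely many values on the pairs [(v, q)] such
   that [q] lies over the image of the orbit of [v], and one of these values is a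
   linear lift.  The lifts of the elements of [W] form [W~], whose invariants are
   [k[y]]; the derivatives [d f / d y_l] of an invariant [f] of the subgroup [H]
   generated by the reflections are polynomial, so [f] lies in [k[y]] by induction
   on the degree, whence [H = W~].

   The linear part of an element of the ideal of [Z] is a combination of linear
   parts of the invariants [F_j], hence is [W]-invariant.  Let [A -> B^G] be the
   surjection attached to a splitting, [I] its kernel.  Modulo [A_+ I], the value
   of a polynomial without linear part at a tuple depends only on the tuple modulo
   [I]; hence [I / A_+ I] is the space of the combinations of the [F_j], [j \in J],
   without linear part, and [W~] acts trivially on it.

   A splitting is given by the kernel of the operator
   [f |-> \sum_g (f (x + x g) - f x - f (x g))], which commutes with the normalizer
   of [G], has its image in [(B^G_+)^2], and is injective there by positivity of
   rational matrices. *)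

Set Implicit Arguments.
Unset Strict Implicit.
Unset Printing Implicit Defensive.

Import GRing.Theory.
Local Open Scope ring_scope.

(** If a linear lift g of an automorphism fixing [y] exists, differentiating y(v g) = y(v) gives Jac
    y(v) = g Jac y(v g); as [y] is also G-invariant, Jac y(v) (Jac y(q))^-1 = g h whenever q = v g h
    with h in G. The matrix can thus be written down before any lift is known, and what has to be
    shown is that it is locally constant. The characteristic polynomials of its entries have
    coefficients that are rational in q, with poles at most along jac y = 0. Near a point with
    trivial stabilizer, [y] can be replaced by n invariants with invertible Jacobian, which removes
    the pole; the other points have codimension at least 2. The coefficients are then polynomials of
    degree 0, that is constants. This is why a divisibility criterion outside codimension 2 comes
    early; it serves again for the reflection subgroup. As for the splitting, the normalizer of G is
    infinite in general, so that it cannot be averaged over; the kernel of an operator commuting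
    with it provides the complement instead. *)

Local Notation ev v f := (meval (fun i => (v : 'rV__) 0 i) f).

HB.instance Definition _ (k : fieldType) (n : nat) (g : 'M[k]_n) :=
  GRing.LRMorphism.copy (act g)
    (comp_mpoly [tuple \sum_(i < n) g i j *: 'X_i | j < n]).

(** * Polynomials, substitutions and values *)

Section Polynomials.
Variables (R : comNzRingType).

Lemma mpoly_ring_ind (n : nat) (P : {mpoly R[n]} -> Prop) :
  (forall c, P c%:MP) -> (forall i, P 'X_i) ->
  (forall p q, P p -> P q -> P (p + q)) ->
  (forall p q, P p -> P q -> P (p * q)) -> forall p, P p.
Proof.
move=> PC PX PD PM p; rewrite {1}(mpolyE p).
have P0 : P 0 by rewrite -mpolyC0.
have P1 : P 1 by rewrite -mpolyC1.
apply: (big_ind P) => // m _; rewrite -mul_mpolyC; apply: (PM) => //.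
rewrite mpolyXE_id; apply: (big_ind P) => [||i _]; [exact: P1|exact: PM|].
by elim: (m i) => [|e IH]; rewrite ?expr0 ?exprS //; apply: (PM).
Qed.

Lemma eq_mpoly_morph (n : nat) (S : pzRingType) (f g : {rmorphism {mpoly R[n]} -> S}) :
  (forall c, f c%:MP = g c%:MP) -> (forall i, f 'X_i = g 'X_i) -> f =1 g.
Proof.
move=> fgC fgX p; elim/mpoly_ring_ind: p => // p q pE qE.
  by rewrite !rmorphD pE qE.
by rewrite !rmorphM pE qE.
Qed.

Lemma comp_mpolyU (n p : nat) (t : n.-tuple {mpoly R[p]}) i :
  'X_i \mPo t = tnth t i.
Proof. by rewrite comp_mpolyXU (tnth_nth 0). Qed.

Lemma mpoly_morphE (m n : nat) (phi : {lrmorphism {mpoly R[m]} -> {mpoly R[n]}}) f :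
  phi f = f \mPo [tuple phi 'X_i | i < m].
Proof.
apply: eq_mpoly_morph => [c|i] /=; last by rewrite comp_mpolyU tnth_mktuple.
by rewrite comp_mpolyC -alg_mpolyC linearZ /= rmorph1 alg_mpolyC.
Qed.

Lemma comp_mpolyA (n p q : nat) (t : n.-tuple {mpoly R[p]})
    (s : p.-tuple {mpoly R[q]}) f :
  (f \mPo t) \mPo s = f \mPo [tuple tnth t i \mPo s | i < n].
Proof.
elim/mpoly_ring_ind: f => [c|i|f g fE gE|f g fE gE].
- by rewrite !comp_mpolyC.
- by rewrite !comp_mpolyU tnth_mktuple.
- by rewrite !comp_mpolyD fE gE.
by rewrite !rmorphM /= fE gE.
Qed.

Lemma mderiv_comp (n p : nat) (t : n.-tuple {mpoly R[p]}) f l :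
  (f \mPo t)^`M(l) = \sum_(i < n) (f^`M(i) \mPo t) * (tnth t i)^`M(l).
Proof.
elim/mpoly_ring_ind: f => [c|i|f g fE gE|f g fE gE].
- rewrite comp_mpolyC mderivC big1 // => i _.
  by rewrite mderivC comp_mpoly0 mul0r.
- rewrite comp_mpolyU (bigD1 i) //= big1 ?addr0 => [|j jNi].
    by rewrite mderivX mnm1E eqxx scale1r -{1}(add0m U_(i)%MM) addmK mpolyX0
               comp_mpoly1 mul1r.
  by rewrite mderivX mnm1E eq_sym (negPf jNi) scale0r comp_mpoly0 mul0r.
- rewrite comp_mpolyD mderivD fE gE -big_split /=.
  by apply: eq_bigr => i _; rewrite mderivD comp_mpolyD mulrDl.
rewrite rmorphM mderivM fE gE big_distrl big_distrr -big_split /=.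
apply: eq_bigr => i _; rewrite mderivM comp_mpolyD !rmorphM /=.
by ring.
Qed.

Lemma mderivXU (n : nat) (i j : 'I_n) :
  ('X_j : {mpoly R[n]})^`M(i) = (i == j)%:R.
Proof.
rewrite mderivX mnm1E eq_sym; case: eqP => [->|_]; last by rewrite scale0r.
by rewrite scale1r -{1}(add0m U_(j)%MM) addmK mpolyX0.
Qed.

End Polynomials.

Section Points.
Variables (k : fieldType) (char0 : [pchar k] =i pred0).

Lemma natr_neq0 j : (j.+1%:R : k) != 0.
Proof. by have /pcharf0P -> := char0. Qed.

Lemma natr_inj : injective (fun j => j%:R : k).
Proof.
move=> i j ij.
wlog lij : i j ij / (i <= j)%N.
  by move=> H; case/orP: (leq_total i j) => l; [|apply/esym]; apply: H.
move/eqP: ij; rewrite eq_sym -subr_eq0 -natrB //.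
have /pcharf0P -> := char0; rewrite subn_eq0 => l.
by apply/eqP; rewrite eqn_leq lij l.
Qed.

Lemma poly_infty (p : {poly k}) : (forall z, z != 0 -> p.[z] = 0) -> p = 0.
Proof.
move=> p0; apply/eqP; case: eqVneq => // pN0.
pose s := [seq (i.+1)%:R : k | i <- iota 0 (size p)].
have: all (root p) s.
  by apply/allP => _ /mapP[i _ ->]; rewrite rootE p0 ?natr_neq0.
move/(max_poly_roots pN0).
rewrite map_inj_in_uniq ?iota_uniq => [/(_ isT)|]; first by rewrite size_map size_iota ltnn.
by move=> i j _ _ /natr_inj [].
Qed.

(** Every coefficient of f can be read off from [muni f], which makes [muni] injective; this is what
    the induction on the number of variables in [ev_ext] needs. *)
Lemma muni_coef (n : nat) (f : {mpoly k[n.+1]}) (m : 'X_{1..n.+1}) :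
  ((muni f)`_(m ord_max))@_[multinom m (widen_ord (leqnSn n) i) | i < n] = f@_m.
Proof.
rewrite muniE coef_sum raddf_sum /=.
case: (boolP (m \in msupp f)) => [mf|/[dup] mf /memN_msupp_eq0 ->]; last first.
  rewrite big_seq big1 // => m' m'f.
  rewrite coefZ coefXn -scalerAl mcoeffZ.
  case: eqP => [E|]; last by rewrite mulr0 mcoeff0 mulr0.
  rewrite mulr1 mcoeffX; case: eqP; last by rewrite mulr0.
  move=> E2; move: mf; rewrite -(_ : m' = m) ?m'f //.
  apply/mnmP => i; case: (unliftP ord_max i) => [j ->|->] //.
  move/mnmP/(_ j): E2; rewrite !mnmE.
  by congr (_ = _); congr (_ _); apply/val_inj; rewrite /= /bump leqNgt ltn_ord.
rewrite (bigD1_seq m) ?msupp_uniq //= big1 ?addr0; last first.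
  move=> m' m'm.
  rewrite coefZ coefXn -scalerAl mcoeffZ.
  case: eqP => [E|]; last by rewrite mulr0 mcoeff0 mulr0.
  rewrite mulr1 mcoeffX; case: eqP; last by rewrite mulr0.
  move=> E2; case/eqP: m'm.
  apply/mnmP => i; case: (unliftP ord_max i) => [j ->|->] //.
  move/mnmP/(_ j): E2; rewrite !mnmE.
  by congr (_ = _); congr (_ _); apply/val_inj; rewrite /= /bump leqNgt ltn_ord.
by rewrite coefZ coefXn eqxx mulr1 mcoeffZ mcoeffX eqxx mulr1.
Qed.

Lemma ev_ext (n : nat) (f : {mpoly k[n]}) : (forall v, ev v f = 0) -> f = 0.
Proof.
elim: n f => [|n IH] f f0.
  have := f0 0; rewrite (nvar0_mpolyC f) mevalC => ->.
  by rewrite mpolyC0.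
suff u0: muni f = 0.
  by apply/mpolyP => m; rewrite -muni_coef u0 coef0 !mcoeff0.
apply/polyP => i; rewrite coef0; apply: IH => v.
rewrite -(coef_map (meval (fun i => v 0 i))).
suff -> : map_poly (meval (fun i => v 0 i)) (muni f) = 0 by rewrite coef0.
apply: poly_infty => z _.
(* The point (v, z), its coordinates being read off from [muni] of the variables so that no case
   split on the last index is needed. *)
pose u := \row_j (map_poly (meval (fun i => v 0 i)) (muni ('X_j : {mpoly k[n.+1]}))).[z].
rewrite -(f0 u).
elim/mpoly_ring_ind: f {f0} => [c|j|p q pE qE|p q pE qE].
- by rewrite muniC map_polyC /= hornerC !mevalC.
- by rewrite mevalXU mxE.
- by rewrite muniD mevalD -pE -qE rmorphD hornerD.
by rewrite muniM mevalM -pE -qE rmorphM hornerM.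
Qed.

Lemma ev_inj (n : nat) (f g : {mpoly k[n]}) :
  (forall v, ev v f = ev v g) -> f = g.
Proof.
by move=> fg; apply/subr0_eq/ev_ext => v; rewrite mevalB fg subrr.
Qed.

Lemma ev_neq0 (n : nat) (f : {mpoly k[n]}) : f != 0 -> exists v, ev v f != 0.
Proof.
move=> fN0; apply: boolp.contrapT => H; case/eqP: fN0; apply: ev_ext => v.
by apply/eqP; apply: boolp.contrapT => /negP vf; apply: H; exists v.
Qed.

Lemma ev_sum (n : nat) (v : 'rV[k]_n) (I : Type) (r : seq I) (P : pred I)
    (F : I -> {mpoly k[n]}) :
  ev v (\sum_(i <- r | P i) F i) = \sum_(i <- r | P i) ev v (F i).
Proof. exact: raddf_sum. Qed.

Lemma ev_act (n : nat) (g : 'M[k]_n) v f : ev v (act g f) = ev (v *m g) f.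
Proof.
rewrite /act comp_mpoly_meval; apply: meval_eq => j.
rewrite tnth_mktuple raddf_sum mxE; apply: eq_bigr => i _.
by rewrite /= mevalZ mevalXU mulrC.
Qed.

Lemma act_comp (n : nat) (g h : 'M[k]_n) f : act (g *m h) f = act g (act h f).
Proof. by apply: ev_inj => v; rewrite !ev_act mulmxA. Qed.

Lemma act1 (n : nat) (f : {mpoly k[n]}) : act 1%:M f = f.
Proof. by apply: ev_inj => v; rewrite ev_act mulmx1. Qed.

Lemma actX (n : nat) (g : 'M[k]_n) j : act g 'X_j = \sum_i g i j *: 'X_i.
Proof. by rewrite /act comp_mpolyU tnth_mktuple. Qed.

Lemma actC (n : nat) (g : 'M[k]_n) c : act g c%:MP = c%:MP.
Proof. by rewrite /act comp_mpolyC. Qed.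

Lemma act_sum (n : nat) (g : 'M[k]_n) (I : Type) (r : seq I) (P : pred I) F :
  act g (\sum_(i <- r | P i) F i) = \sum_(i <- r | P i) act g (F i).
Proof. exact: raddf_sum. Qed.

Lemma actZ (n : nat) (g : 'M[k]_n) c f : act g (c *: f) = c *: act g f.
Proof. exact: linearZ. Qed.

Lemma mderiv_sum (n : nat) i (I : Type) (r : seq I) (P : pred I)
    (F : I -> {mpoly k[n]}) :
  (\sum_(l <- r | P l) F l)^`M(i) = \sum_(l <- r | P l) (F l)^`M(i).
Proof. exact: raddf_sum. Qed.

Lemma mderiv_act (n : nat) (g : 'M[k]_n) f i :
  (act g f)^`M(i) = \sum_j g i j *: act g f^`M(j).
Proof.
rewrite /act mderiv_comp; apply: eq_bigr => j _.
rewrite tnth_mktuple mulrC -mul_mpolyC; congr (_ * _).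
rewrite raddf_sum /= (bigD1 i) //= big1 => [|l lNi].
  by rewrite mderivZ mderivXU eqxx addr0 -mul_mpolyC mulr1.
by rewrite mderivZ mderivXU eq_sym (negPf lNi) scaler0.
Qed.

(** The chain rule in the convention used throughout: points are rows and gradients are columns, so
    a linear substitution multiplies gradients on the left. *)
Lemma grad_act (n : nat) (g : 'M[k]_n) f v :
  \col_i ev v (act g f)^`M(i) = g *m \col_i ev (v *m g) f^`M(i).
Proof.
apply/matrixP => i j; rewrite mxE mderiv_act raddf_sum mxE.
by apply: eq_bigr => l _; rewrite /= mevalZ ev_act mxE.
Qed.

End Points.

(** * Orders of vanishing and restriction to lines *)

Section LocalAnalysis.
Variables (k : fieldType) (char0 : [pchar k] =i pred0).

Definition pt (m n : nat) (t : m.-tuple {mpoly k[n]}) (v : 'rV[k]_n) : 'rV[k]_m :=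
  \row_i ev v (tnth t i).

Lemma ev_comp (m n : nat) (t : m.-tuple {mpoly k[n]}) v f :
  ev v (f \mPo t) = ev (pt t v) f.
Proof. by rewrite comp_mpoly_meval; apply: meval_eq => i; rewrite mxE. Qed.

(* The order of vanishing of [f] at [v] is at least [M]. *)
Fixpoint vanish (n M : nat) (v : 'rV[k]_n) (f : {mpoly k[n]}) : Prop :=
  if M is M'.+1 then ev v f = 0 /\ forall j, vanish M' v f^`M(j) else True.

Section Vanish.
Variable n : nat.
Implicit Types (v w : 'rV[k]_n) (f g : {mpoly k[n]}).

Lemma vanishP M v f : vanish M v f -> forall j, vanish M.-1 v f^`M(j).
Proof. by case: M => // M []. Qed.

Lemma vanish0 M v : vanish M v 0.
Proof.
by elim: M => //= M IH; split=> [|j]; rewrite ?meval0 ?mderiv0.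
Qed.

Lemma vanishD M v f g : vanish M v f -> vanish M v g -> vanish M v (f + g).
Proof.
elim: M f g => //= M IH f g [f0 fd] [g0 gd]; split; first by rewrite mevalD f0 g0 addr0.
by move=> j; rewrite mderivD; apply: IH.
Qed.

Lemma vanishZ M v c f : vanish M v f -> vanish M v (c *: f).
Proof.
elim: M f => //= M IH f [f0 fd]; split; first by rewrite mevalZ f0 mulr0.
by move=> j; rewrite mderivZ; apply: IH.
Qed.

Lemma vanishN M v f : vanish M v f -> vanish M v (- f).
Proof. by rewrite -scaleN1r; apply: vanishZ. Qed.

Lemma vanish_sum M v (I : eqType) (r : seq I) (P : pred I) (F : I -> {mpoly k[n]}) :
  (forall i, i \in r -> P i -> vanish M v (F i)) -> vanish M v (\sum_(i <- r | P i) F i).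
Proof.
move=> H; rewrite big_seq_cond; apply: (big_ind (vanish M v)) => [||i /andP[]].
- exact: vanish0.
- exact: vanishD.
exact: H.
Qed.

(** The bound s is separate from a + b so that the induction, in which a derivative lowers only one
    of the two orders, passes through truncated predecessors. *)
Lemma vanish_mul s a b v f g : (s <= a + b)%N ->
  vanish a v f -> vanish b v g -> vanish s v (f * g).
Proof.
elim: s a b f g => //= s IH a b f g sab vf vg; split=> [|j].
  rewrite mevalM.
  case: a vf sab => [_|a [-> _] _]; last by rewrite mul0r.
  by case: b vg => // b [-> _] _; rewrite mulr0.
rewrite mderivM; apply: vanishD.
  apply: (IH a.-1 b) => //; last exact: vanishP.
  by case: a {vf} sab => [/ltnW|].
apply: (IH a b.-1) => //; last exact: vanishP.
case: b {vg} sab => [|b]; last by rewrite addnS.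
by rewrite /= !addn0 => /ltnW.
Qed.

Lemma vanish_mulr M v f g : vanish M v f -> vanish M v (f * g).
Proof. by move=> vf; apply: (@vanish_mul _ M 0) => //; rewrite addn0. Qed.

Lemma vanish_exp M v f : ev v f = 0 -> vanish M v (f ^+ M).
Proof.
move=> f0; elim: M => // M IH; rewrite exprS.
by apply: (@vanish_mul _ 1 M) => //; split.
Qed.

Lemma vanish_act M v (g : 'M[k]_n) f : vanish M (v *m g) f -> vanish M v (act g f).
Proof.
elim: M f => //= M IH f [f0 fd]; split=> [|j]; first by rewrite ev_act.
rewrite mderiv_act; apply: vanish_sum => i _ _.
by apply/vanishZ/IH/fd.
Qed.

End Vanish.

Definition line (n : nat) (c w : 'rV[k]_n) (f : {mpoly k[n]}) : {poly k} :=
  mmap (@polyC k) (fun i => (c 0 i)%:P + (w 0 i) *: 'X) f.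

HB.instance Definition _ n c w :=
  GRing.RMorphism.copy (@line n c w) (mmap (@polyC k) (fun i => (c 0 i)%:P + (w 0 i) *: 'X)).

Section Line.
Variable n : nat.
Implicit Types (c v w : 'rV[k]_n) (f g : {mpoly k[n]}).

Lemma lineC c w a : line c w a%:MP = a%:P.
Proof. by rewrite /line mmapC. Qed.

Lemma lineXU c w i : line c w 'X_i = (c 0 i)%:P + (w 0 i) *: 'X.
Proof. by rewrite /line mmapX mmap1U. Qed.

Lemma lineD c w : {morph line c w : f g / f + g}.
Proof. exact: rmorphD. Qed.

Lemma lineM c w : {morph line c w : f g / f * g}.
Proof. exact: rmorphM. Qed.

Lemma horner_line c w f z : (line c w f).[z] = ev (c + z *: w) f.
Proof.
elim/mpoly_ring_ind: f => [a|i|p q pE qE|p q pE qE].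
- by rewrite lineC hornerC mevalC.
- by rewrite lineXU mevalXU !mxE !hornerE mulrC.
- by rewrite lineD hornerD mevalD; congr (_ + _).
by rewrite lineM hornerM mevalM; congr (_ * _).
Qed.

Lemma deriv_line c w f :
  (line c w f)^`() = \sum_j (w 0 j)%:P * line c w f^`M(j).
Proof.
elim/mpoly_ring_ind: f => [a|i|p q pE qE|p q pE qE].
- rewrite lineC derivC big1 // => j _; by rewrite mderivC rmorph0 mulr0.
- rewrite lineXU derivD derivC derivZ derivX add0r (bigD1 i) //= big1 => [|j ji].
    by rewrite mderivXU eqxx rmorph1 addr0 mulr1 alg_polyC.
  by rewrite mderivXU (negPf ji) rmorph0 mulr0.
- rewrite rmorphD derivD pE qE -big_split; apply: eq_bigr => j _ /=.
  by rewrite mderivD rmorphD mulrDr.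
rewrite rmorphM derivM pE qE big_distrl big_distrr -big_split; apply: eq_bigr => j _ /=.
by rewrite mderivM rmorphD !rmorphM /=; ring.
Qed.

(** Let m be the multiplicity of z in p = q (X - z)^m. If m were at most M, then (X - z)^m would
    divide p', forcing m q(z) = 0, which is impossible in characteristic 0. *)
Lemma dvdp_deriv z M (p : {poly k}) : p.[z] = 0 ->
  ('X - z%:P) ^+ M %| p^`() -> ('X - z%:P) ^+ M.+1 %| p.
Proof.
case: (eqVneq p 0) => [->|pN0 pz]; first by rewrite dvdp0.
have [m [q]] := multiplicity_XsubC p z; rewrite pN0 /= => qz pE.
case: (ltnP M m) => [Mm _|mM]; first by rewrite pE dvdp_mull // dvdp_exp2l.
move=> /(dvdp_trans (dvdp_exp2l ('X - z%:P) mM)).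
case: m mM pE => [|m] mM pE.
  by move: pz; rewrite pE mulr1 => /eqP pz _; case/negP: qz.
rewrite pE derivM dvdp_addr; last exact: dvdp_mull.
rewrite deriv_exp derivXsubC mul1r exprS mulrnAr -mulrnAl dvdp_mul2r; last first.
  by rewrite expf_neq0 // polyXsubC_eq0.
rewrite dvdp_XsubCl rootE hornerMn.
by rewrite -mulr_natr mulf_eq0 (negPf (natr_neq0 char0 m)) orbF => qz0; case/negP: qz.
Qed.

Lemma vanish_line M c w z f : vanish M (c + z *: w) f ->
  ('X - z%:P) ^+ M %| line c w f.
Proof.
elim: M f => [|M IH] f; first by rewrite expr0 dvd1p.
case=> f0 fd; apply: dvdp_deriv; first by rewrite horner_line.
rewrite deriv_line; apply: (big_ind (fun p => ('X - z%:P) ^+ M %| p)) => [||j _].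
- exact: dvdp0.
- by move=> p q; apply: dvdp_add.
by apply/dvdp_mull/IH/fd.
Qed.

End Line.
End LocalAnalysis.

(** * Divisibility checked outside codimension two *)

Section Divisibility.
Variables (k : closedFieldType) (char0 : [pchar k] =i pred0).

(** The hypothesis is divisibility in the completed local ring at each z. The case M = 1 makes each
    root of g a root of f; cancelling the common factor X - z keeps the hypothesis at the price of
    one order at z, and lowers the degree of g. *)
Lemma dvdp_local (f g : {poly k}) : g != 0 ->
  (forall z M, exists d c, d.[z] != 0 /\ ('X - z%:P) ^+ M %| d * f - g * c) ->
  g %| f.
Proof.
have [s] := ubnP (size g); elim: s f g => // s IH f g sg gN0 loc.
case: (boolP (size g == 1)) => [/eqP|g1].
  by move=> /eqP sg1; apply: (@dvdp_trans _ 1); rewrite ?dvd1p // dvdp1.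
have /closed_rootP[z gz] := g1.
have [g2 gE] := factor_theorem _ _ gz.
have fz: root f z.
  have [d [c [dz]]] := loc z 1%N; rewrite expr1 dvdp_XsubCl rootE.
  rewrite hornerD hornerN !hornerM (eqP gz) mul0r subr0 mulf_eq0 (negPf dz) /=.
  by rewrite rootE.
have [f2 fE] := factor_theorem _ _ fz.
have g2N0 : g2 != 0 by apply: contraNneq gN0 => g20; rewrite gE g20 mul0r.
rewrite gE fE dvdp_mul2r ?polyXsubC_eq0 //; apply: IH => //.
  by move: sg; rewrite gE size_mul ?polyXsubC_eq0 // size_XsubC addn2.
move=> a M; have [d [c [da]]] := loc a M.+1.
rewrite fE gE mulrA -(mulrA g2) (mulrC _ c) (mulrA g2) -mulrBl => H.
exists d, c; split => //; case: (eqVneq a z) => [az|aNz].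
  by move: H; rewrite az exprSr dvdp_mul2r ?polyXsubC_eq0.
move: H; rewrite Gauss_dvdpl; first by apply/dvdp_trans/dvdp_exp2l/leqnSn.
by rewrite coprimep_expl // coprimep_XsubC root_XsubC eq_sym.
Qed.

Section Top.
Variables (A : comNzRingType).
Implicit Types p q : {poly A}.

(** The coefficient c may vanish: unlike [lead_coef], this notion is multiplicative over any
    coefficient ring. *)
Definition top d p c := (size p <= d.+1)%N /\ p`_d = c.

Lemma top_mul a b p q x y : top a p x -> top b q y -> top (a + b) (p * q) (x * y).
Proof.
move=> [sp px] [sq qy].
have p0 i : (a < i)%N -> p`_i = 0 by move=> ai; rewrite nth_default // (leq_trans sp).
have q0 i : (b < i)%N -> q`_i = 0 by move=> bi; rewrite nth_default // (leq_trans sq).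
split.
  apply/leq_sizeP => j abj; rewrite coefM big1 // => i _.
  case: (ltnP a i) => [/p0 ->|ia]; first by rewrite mul0r.
  rewrite (q0 (j - i)%N) ?mulr0 // ltn_subRL; apply: leq_trans abj.
  by rewrite ltnS leq_add2r.
have a_ord : (a < (a + b).+1)%N by rewrite ltnS leq_addr.
rewrite coefM (bigD1 (Ordinal a_ord)) //= big1 => [|i iNa].
  by rewrite addr0 addKn px qy.
case: (ltnP a i) => [/p0 ->|ia]; first by rewrite mul0r.
rewrite (q0 (a + b - i)%N) ?mulr0 // ltn_subRL ltn_add2r ltn_neqAle ia andbT.
exact: iNa.
Qed.

Lemma top1 : top 0 (1 : {poly A}) 1.
Proof. by split; rewrite ?size_poly1 ?coef1. Qed.

Lemma top_exp d p x e : top d p x -> top (d * e) (p ^+ e) (x ^+ e).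
Proof.
move=> px; elim: e => [|e IH]; first by rewrite muln0 !expr0; apply: top1.
by rewrite mulnS !exprS; apply: top_mul.
Qed.

Lemma top_prod (I : Type) (r : seq I) (F : I -> {poly A}) (e : I -> nat) x :
  (forall i, top (e i) (F i) (x i)) ->
  top (\sum_(i <- r) e i)%N (\prod_(i <- r) F i) (\prod_(i <- r) x i).
Proof.
move=> Fx; elim: r => [|i r IH]; first by rewrite !big_nil; apply: top1.
by rewrite !big_cons; apply: top_mul.
Qed.

Lemma top_sum d (I : eqType) (r : seq I) (F : I -> {poly A}) x :
  (forall i, i \in r -> top d (F i) (x i)) ->
  top d (\sum_(i <- r) F i) (\sum_(i <- r) x i).
Proof.
elim: r => [|i r IH] H; first by rewrite !big_nil; split; rewrite ?size_poly0 ?coef0.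
rewrite !big_cons; have [|s c] := IH; first by move=> j jr; apply: H; rewrite inE jr orbT.
have [|si ci] := H i; first by rewrite inE eqxx.
split; last by rewrite coefD ci c.
by apply: leq_trans (size_polyD _ _) _; rewrite geq_max si s.
Qed.

Lemma top_scale d p x c : top d p x -> top d (c%:P * p) (c * x).
Proof.
move=> px; rewrite -[d]add0n; apply: top_mul => //.
by split; rewrite ?coefC // size_polyC leq_b1.
Qed.

End Top.

(** The base point of the line is the generic point, with the variables as coordinates, so that one
    division with remainder treats all lines of direction [w] at once. *)
Definition generic_line (n : nat) (w : 'rV[k]_n) (f : {mpoly k[n]}) :
    {poly {mpoly k[n]}} :=
  mmap (polyC \o @mpolyC n k) (fun i => ('X_i)%:P + ((w 0 i)%:MP)%:P * 'X) f.

HB.instance Definition _ n w := GRing.RMorphism.copy (@generic_line n w)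
  (mmap (polyC \o @mpolyC n k) (fun i => ('X_i)%:P + ((w 0 i)%:MP)%:P * 'X)).

Section GenericLine.
Variables (n : nat) (w : 'rV[k]_n).
Implicit Type f g : {mpoly k[n]}.

Lemma generic_lineC a : generic_line w a%:MP = (a%:MP)%:P.
Proof. by rewrite /generic_line mmapC. Qed.

Lemma generic_lineXU i :
  generic_line w 'X_i = ('X_i)%:P + ((w 0 i)%:MP)%:P * 'X.
Proof. by rewrite /generic_line mmapX mmap1U. Qed.

Lemma generic_lineD : {morph generic_line w : f g / f + g}.
Proof. exact: rmorphD. Qed.

Lemma generic_lineM : {morph generic_line w : f g / f * g}.
Proof. exact: rmorphM. Qed.

Lemma map_generic_line (c : 'rV[k]_n) f : map_poly (meval (fun i => c 0 i)) (generic_line w f) = line c w f.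
Proof.
elim/mpoly_ring_ind: f => [a|i|p q pE qE|p q pE qE].
- by rewrite generic_lineC map_polyC /= mevalC lineC.
- rewrite generic_lineXU rmorphD rmorphM /= !map_polyC map_polyX /=.
  by rewrite mevalXU mevalC lineXU mul_polyC.
- by rewrite generic_lineD lineD; apply: etrans (rmorphD _ _ _) _; congr (_ + _).
by rewrite generic_lineM lineM; apply: etrans (rmorphM _ _ _) _; congr (_ * _).
Qed.

Lemma horner0_generic_line f : (generic_line w f).[0] = f.
Proof.
elim/mpoly_ring_ind: f => [a|i|p q pE qE|p q pE qE].
- by rewrite generic_lineC hornerC.
- by rewrite generic_lineXU !hornerE.
- by rewrite generic_lineD hornerD; congr (_ + _).
by rewrite generic_lineM hornerM; congr (_ * _).
Qed.

(** The top coefficient of g(X + T w) in T is the constant g(w). When it is nonzero, g becomes monic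
    in T up to a scalar, and can be divided by over k[X]. *)
Lemma top_generic_line e g : g \is e.-homog ->
  top e (generic_line w g) (ev w g)%:MP.
Proof.
move=> /dhomogP ge; rewrite mevalE raddf_sum /=; apply: top_sum => m mg.
rewrite /= mpolyCM; apply: top_scale.
rewrite (_ : e = \sum_i m i)%N; last by rewrite -mdegE -(ge m mg).
rewrite rmorph_prod /=; apply: top_prod => i.
rewrite rmorphXn /= -[X in top X]mul1n; apply: top_exp.
split; last by rewrite coefD coefC coefMX coefC add0r.
apply: leq_trans (size_polyD _ _) _; rewrite geq_max size_polyC.
apply/andP; split; first by case: eqP.
by rewrite mul_polyC (leq_trans (size_scale_leq _ _)) // size_polyX.
Qed.

End GenericLine.

Section Codim2.
Variable n : nat.

Definition linear_form (N : 'M[k]_n) j : {mpoly k[n]} := \sum_i N i j *: 'X_i.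

Lemma ev_linear_form N j (c : 'rV[k]_n) : ev c (linear_form N j) = (c *m N) 0 j.
Proof.
rewrite raddf_sum mxE; apply: eq_bigr => i _ /=.
by rewrite mevalZ mevalXU mulrC.
Qed.

(** A generic line misses a subspace of codimension at least 2. If w N = 0, then c N is constant
    along the line and a nonzero column of N serves. Otherwise the line meets the kernel only if c N
    is proportional to w N, which 2 x 2 minors detect; were they all identically zero, N would be a
    column times w N, of rank at most 1. *)
Lemma avoid_line (N : 'M[k]_n) (w : 'rV[k]_n) : (1 < \rank N)%N ->
  exists2 L : {mpoly k[n]}, L != 0 &
    forall c, ev c L != 0 -> forall z, (c + z *: w) *m N != 0.
Proof.
move=> rN; case: (eqVneq (w *m N) 0) => [wN|wN].
  have /matrix0Pn [i [j Nij]] : N != 0.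
    by apply: contraTneq rN => ->; rewrite mxrank0.
  exists (linear_form N j).
    apply: contraNneq Nij => L0; have := ev_linear_form N j (delta_mx 0 i).
    by rewrite L0 meval0 -rowE mxE => <-.
  move=> c cL z; rewrite mulmxDl -scalemxAl wN scaler0 addr0.
  by apply: contraNneq cL => cN; rewrite ev_linear_form cN mxE.
have /rV0Pn [j wj] := wN.
pose L i := (w *m N) 0 j *: linear_form N i - (w *m N) 0 i *: linear_form N j.
have evL i c : ev c (L i) = (w *m N) 0 j * (c *m N) 0 i - (w *m N) 0 i * (c *m N) 0 j.
  by rewrite mevalB !mevalZ !ev_linear_form.
case: (pickP (fun i => L i != 0)) => [i Li|L0].
  exists (L i) => // c cL z; apply: contraNneq cL => czN; rewrite evL.
  have cN : c *m N = - z *: (w *m N).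
    by apply/eqP; rewrite scaleNr -addr_eq0 scalemxAl -mulmxDl czN.
  by rewrite cN !mxE; apply/eqP; ring.
exfalso; move: rN; rewrite ltnNge.
suff -> : N = col j N *m (((w *m N) 0 j)^-1 *: (w *m N)).
  by rewrite (leq_trans (mxrankM_maxl _ _)) // rank_leq_col.
apply/row_matrixP => l; rewrite row_mul; apply/rowP => i.
have := evL i (delta_mx 0 l); rewrite (eqP (negbFE (L0 i))) meval0 => /eqP.
rewrite eq_sym subr_eq0 -!rowE ![row l _ _ _]mxE => /eqP E.
rewrite [RHS]mxE big_ord1 [row _ _ _ _]mxE [col _ _ _ _]mxE.
by rewrite [X in _ = _ * X]mxE; apply: (mulfI wj); rewrite [LHS]E; field.
Qed.

(** Divide f by g along the generic line, in a direction w with g(w) nonzero. On a line that misses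
    the bad subspaces the one-variable criterion kills the remainder; such lines are dense, so the
    remainder is 0, and the parameter value 0 gives back f and g. *)
Theorem dvd_of_local (e : nat) (f g : {mpoly k[n]}) (bad : seq 'M[k]_n) :
  g \is e.-homog -> g != 0 -> (forall N, N \in bad -> (1 < \rank N)%N) ->
  (forall v, (forall N, N \in bad -> v *m N != 0) -> forall M,
     exists d c, ev v d != 0 /\ vanish M v (d * f - g * c)) ->
  exists q, f = g * q.
Proof.
move=> ge gN0 rbad loc; have [w gw] := ev_neq0 char0 gN0.
have [L LN0 Lbad] : exists2 L : {mpoly k[n]}, L != 0 & forall c, ev c L != 0 ->
    forall z N, N \in bad -> (c + z *: w) *m N != 0.
  elim: bad rbad {loc} => [|N bad IH] rbad.
    by exists 1 => //; apply: oner_neq0.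
  have [|L LN0 LP] := IH; first by move=> N' N'b; apply: rbad; rewrite inE N'b orbT.
  have [|L' L'N0 L'P] := @avoid_line N w; first by apply: rbad; rewrite inE eqxx.
  exists (L' * L); first by rewrite mulf_neq0.
  move=> c; rewrite mevalM mulf_eq0 negb_or => /andP[cL' cL] z N'.
  by rewrite inE => /predU1P [->|]; [apply: L'P|apply: LP].
pose a := ev w g; pose G := ((a^-1)%:MP)%:P * generic_line w g.
have [sG cG] : top e G 1.
  rewrite -(_ : (a^-1)%:MP * a%:MP = 1 :> {mpoly k[n]}).
    by apply: top_scale; apply: top_generic_line.
  by rewrite -mpolyCM mulVf // mpolyC1.
have lG c : line c w g = a%:P * map_poly (meval (fun i => c 0 i)) G.
  rewrite /G rmorphM /= map_polyC /= mevalC map_generic_line mulrA -polyCM.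
  by rewrite mulfV // mul1r.
have G0 : G.[0] = (a^-1)%:MP * g by rewrite hornerM hornerC horner0_generic_line.
clearbody G; have szG : size G = e.+1.
  apply/eqP; rewrite eqn_leq sG ltnNge; apply/negP => /leq_sizeP /(_ e (leqnn _)) /eqP.
  by rewrite cG oner_eq0.
have Gmon : G \is monic by rewrite monicE lead_coefE szG cG.
have GN0 : G != 0 by rewrite -size_poly_eq0 szG.
have := Pdiv.RingMonic.rdivp_eq Gmon (generic_line w f).
set q := Pdiv.Ring.rdivp _ _; set r := Pdiv.Ring.rmodp _ _ => fE.
have sr : (size r <= e)%N.
  by rewrite -ltnS -szG; apply: Pdiv.Ring.ltn_rmodpN0.
have r0 : r = 0.
  apply/polyP => i; rewrite coef0.
  have: L * r`_i = 0.
    apply: (ev_ext char0) => c; rewrite mevalM.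
    case: (eqVneq (ev c L) 0) => [->|cL]; first by rewrite mul0r.
    suff -> : ev c r`_i = 0 by rewrite mulr0.
    rewrite -(coef_map (meval (fun i => c 0 i))).
    have slG : size (map_poly (meval (fun i => c 0 i)) G) = e.+1.
      apply/eqP; rewrite eqn_leq (leq_trans (size_poly _ _)) ?szG //=.
      rewrite ltnNge; apply/negP => /leq_sizeP /(_ e (leqnn _)) /eqP.
      by rewrite coef_map cG /= meval1 oner_eq0.
    have : line c w g %| line c w f.
      apply: dvdp_local => [|z M].
        rewrite lG mulf_neq0 // ?polyC_eq0 //.
        by rewrite -size_poly_eq0 slG.
      have [d [h [dz V]]] := loc (c + z *: w) (Lbad c cL z) M.
      exists (line c w d), (line c w h); split; first by rewrite horner_line.
      by rewrite -!rmorphM -rmorphB; apply: vanish_line.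
    rewrite lG mul_polyC dvdpZl // -map_generic_line fE rmorphD rmorphM /=.
    rewrite dvdp_addr ?dvdp_mull // => /dvdp_leq.
    case: eqVneq => [->|_ /(_ isT)]; first by rewrite coef0.
    by rewrite slG => /leq_trans/(_ (size_poly _ _)); rewrite ltnNge sr.
  by move/eqP; rewrite mulf_eq0 (negPf LN0) => /eqP.
exists (q.[0] * (a^-1)%:MP).
by rewrite -{1}[f](horner0_generic_line w) fE r0 addr0 hornerM G0; ring.
Qed.

End Codim2.
End Divisibility.

(** * Interpolation and invariants of finite groups *)

Section Interpolation.
Variables (k : fieldType) (char0 : [pchar k] =i pred0) (n : nat).
Implicit Types (v a b : 'rV[k]_n).

Lemma separate_points a b : a != b -> exists h, ev a h = 0 /\ ev b h = 1.
Proof.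
move=> ab; have /rV0Pn[i abi] : b - a != 0 by rewrite subr_eq0 eq_sym.
rewrite !mxE in abi.
exists ((b 0 i - a 0 i)^-1 *: ('X_i - (a 0 i)%:MP)).
by rewrite !mevalZ !mevalB !mevalXU !mevalC subrr mulr0 mulVf.
Qed.

Lemma separate_from_points (A : seq 'rV[k]_n) b : b \notin A ->
  exists h, (forall a, a \in A -> ev a h = 0) /\ ev b h = 1.
Proof.
elim: A => [_|a A IH].
  by exists 1; rewrite meval1; split.
rewrite inE negb_or => /andP[ba bA]; have [h [hA hb]] := IH bA.
have [l [la lb]] : exists h, ev a h = 0 /\ ev b h = 1.
  by apply: separate_points; rewrite eq_sym.
exists (l * h); split; last by rewrite mevalM lb hb mulr1.
by move=> c; rewrite inE mevalM => /predU1P[->|/hA ->]; rewrite ?la ?(mul0r, mulr0).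
Qed.

Lemma interpolate01 (A B : seq 'rV[k]_n) : (forall b, b \in B -> b \notin A) ->
  exists h, (forall a, a \in A -> ev a h = 0) /\ (forall b, b \in B -> ev b h = 1).
Proof.
elim: B => [_|b B IH BA].
  by exists 0; split=> // a _; rewrite meval0.
have [|h [hA hB]] := IH; first by move=> c cB; apply: BA; rewrite inE cB orbT.
have [|l [lA lb]] := @separate_from_points A b; first by apply: BA; rewrite inE eqxx.
exists (1 - (1 - h) * (1 - l)); split=> c.
  by move=> cA; rewrite !(mevalB, mevalM, meval1) hA // lA // !subr0 mulr1 subrr.
rewrite inE !(mevalB, mevalM, meval1) => /predU1P[->|cB].
  by rewrite lb subrr mulr0 subr0.
by rewrite (hB c cB) subrr mul0r subr0.
Qed.

Lemma interpolate_jets (A : seq 'rV[k]_n) b M : b \notin A ->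
  exists f, (forall a, a \in A -> vanish M a f) /\ vanish M b (f - 1).
Proof.
move=> /separate_from_points[h [hA hb]].
(* Where h = 0, this is a multiple of h^M; where h = 1, it differs from 1 by an M-th power of a
   function vanishing there. *)
exists (1 - (1 - h ^+ M) ^+ M); case: M => [|M]; first by split.
split=> [a aA|].
  have -> : 1 - (1 - h ^+ M.+1) ^+ M.+1 =
      h ^+ M.+1 * \sum_(i < M.+1) (1 - h ^+ M.+1) ^+ i.
    by rewrite -opprB subrX1; ring.
  exact/vanish_mulr/vanish_exp/hA.
rewrite addrAC subrr add0r; apply/vanishN/vanish_exp.
by rewrite mevalB meval1 rmorphXn /= hb expr1n subrr.
Qed.

End Interpolation.

Section FiniteGroups.
Variables (k : fieldType) (char0 : [pchar k] =i pred0) (n : nat).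
Variables (G : {fset 'M[k]_n}) (GG : finite_linear_group G).

Lemma group1M : 1%:M \in G. Proof. by case: GG. Qed.
Lemma groupMM g h : g \in G -> h \in G -> g *m h \in G.
Proof. by case: GG => _ H _ _; apply: H. Qed.
Lemma groupVM g : g \in G -> invmx g \in G.
Proof. by case: GG => _ _ H _; apply: H. Qed.
Lemma group_unit g : g \in G -> g \in unitmx.
Proof. by case: GG => _ _ _ H; apply: H. Qed.

Lemma groupMl_perm h : h \in G -> perm_eq [seq h *m g | g <- G] G.
Proof.
move=> hG; have uh := group_unit hG.
have U : uniq [seq h *m g | g <- G].
  rewrite map_inj_uniq ?fset_uniq // => x y.
  by move/(congr1 (mulmx (invmx h))); rewrite !mulKmx.
apply: uniq_perm => //; first exact: fset_uniq.
have sub : {subset [seq h *m g | g <- G] <= G}.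
  by move=> _ /mapP[g gG ->]; apply: groupMM.
have sz : (size G <= size [seq h *m g | g <- G])%N by rewrite size_map.
by move=> x; have [_ /(_ x)] := uniq_min_size U sub sz.
Qed.

Lemma groupMr_perm h : h \in G -> perm_eq [seq g *m h | g <- G] G.
Proof.
move=> hG; have uh := group_unit hG.
have U : uniq [seq g *m h | g <- G].
  rewrite map_inj_uniq ?fset_uniq // => x y.
  by move/(congr1 (mulmx^~ (invmx h))); rewrite !mulmxK.
apply: uniq_perm => //; first exact: fset_uniq.
have sub : {subset [seq g *m h | g <- G] <= G}.
  by move=> _ /mapP[g gG ->]; apply: groupMM.
have sz : (size G <= size [seq g *m h | g <- G])%N by rewrite size_map.
by move=> x; have [_ /(_ x)] := uniq_min_size U sub sz.
Qed.

Lemma big_groupMl (R : Type) (idx : R) (op : Monoid.com_law idx) (F : 'M[k]_n -> R) h :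
  h \in G -> \big[op/idx]_(g <- G) F (h *m g) = \big[op/idx]_(g <- G) F g.
Proof. by move=> hG; rewrite -[RHS](perm_big _ (groupMl_perm hG)) big_map. Qed.

Lemma big_groupMr (R : Type) (idx : R) (op : Monoid.com_law idx) (F : 'M[k]_n -> R) h :
  h \in G -> \big[op/idx]_(g <- G) F (g *m h) = \big[op/idx]_(g <- G) F g.
Proof. by move=> hG; rewrite -[RHS](perm_big _ (groupMr_perm hG)) big_map. Qed.

Lemma group_order_neq0 : ((size G)%:R : k) != 0.
Proof.
have : 1%:M \in enum_fset G := group1M.
by case: (enum_fset G) => // a s _; apply: (natr_neq0 char0 (size s)).
Qed.

Lemma expr_group g e : g \in G -> g ^+ e \in G.
Proof.
move=> gG; elim: e => [|e IH]; first exact: group1M.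
by rewrite exprS; apply: groupMM.
Qed.

Lemma group_finite_order g : g \in G -> exists2 e : nat, (0 < e)%N & g ^+ e = 1.
Proof.
move=> gG; pose s := [seq g ^+ i | i <- iota 0 (size G).+1].
have : ~~ uniq s.
  apply/negP => us; have := uniq_leq_size us (s2 := G).
  rewrite size_map size_iota ltnn => H; suff: false by [].
  by apply: H => _ /mapP[i _ ->]; apply: expr_group.
case/(uniqPn 1) => i [j [ij]]; rewrite size_map size_iota => js.
rewrite !(nth_map 0%N) ?size_iota ?(ltn_trans ij) // !nth_iota ?(ltn_trans ij) // !add0n.
move=> E; exists (j - i)%N; first by rewrite subn_gt0.
have ui := group_unit (expr_group i gG).
move: E; rewrite -{1}(subnKC (ltnW ij)) exprD => /esym E.
have := congr1 (mulmx (invmx (g ^+ i))) E.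
by rewrite [X in X = _](mulKmx ui) mulVmx.
Qed.

Lemma rank_nonreflection g : g \in G -> g != 1%:M -> ~ reflection g ->
  (1 < \rank (g - 1%:M)%R)%N.
Proof.
move=> gG g1 ngr; case E: (\rank (g - 1%:M)) => [|[|r]] //.
  by move/eqP: E; rewrite mxrank_eq0 subr_eq0 (negPf g1).
case: ngr; split; [exact: group_unit|exact: group_finite_order|].
rewrite mxrank_ker E subn1 prednK //.
by apply: leq_trans (rank_leq_row (g - 1%:M)); rewrite E.
Qed.

Lemma invariantC c : invariant G c%:MP.
Proof. by move=> g _; rewrite actC. Qed.
Lemma invariant0 : invariant G 0. Proof. by move=> g _; rewrite rmorph0. Qed.
Lemma invariant1 : invariant G 1. Proof. by move=> g _; rewrite rmorph1. Qed.
Lemma invariantD a b : invariant G a -> invariant G b -> invariant G (a + b).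
Proof. by move=> ia ib g gG; rewrite rmorphD /= ia ?ib. Qed.
Lemma invariantN a : invariant G a -> invariant G (- a).
Proof. by move=> ia g gG; rewrite rmorphN /= ia. Qed.
Lemma invariantB a b : invariant G a -> invariant G b -> invariant G (a - b).
Proof. by move=> ia ib; apply/invariantD/invariantN. Qed.
Lemma invariantM a b : invariant G a -> invariant G b -> invariant G (a * b).
Proof. by move=> ia ib g gG; rewrite rmorphM /= ia ?ib. Qed.
Lemma invariantZ c a : invariant G a -> invariant G (c *: a).
Proof. by move=> ia g gG; rewrite linearZ /= ia. Qed.
Lemma invariant_sum (I : Type) (r : seq I) (P : pred I) F :
  (forall i, P i -> invariant G (F i)) -> invariant G (\sum_(i <- r | P i) F i).
Proof. by move=> H; apply: (big_ind (invariant G)) => //; [apply: invariant0|apply: invariantD]. Qed.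

Lemma invariant_comp (p : nat) (t : p.-tuple {mpoly k[n]}) f :
  (forall i, invariant G (tnth t i)) -> invariant G (f \mPo t).
Proof.
move=> it; elim/mpoly_ring_ind: f => [c|i|f g fE gE|f g fE gE].
- by rewrite comp_mpolyC; apply: invariantC.
- by rewrite comp_mpolyU.
- by rewrite rmorphD; apply: invariantD.
by rewrite rmorphM; apply: invariantM.
Qed.

Lemma ev_invariant f g v : invariant G f -> g \in G -> ev (v *m g) f = ev v f.
Proof. by move=> fi gG; rewrite -ev_act fi. Qed.

Definition transfer f := \sum_(g <- G) act g f.

Lemma transfer_invariant f : invariant G (transfer f).
Proof.
move=> h hG; rewrite /transfer raddf_sum /=.
rewrite -[RHS](big_groupMl _ _ hG).
by apply: eq_bigr => g _; rewrite act_comp.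
Qed.

Lemma transferM b f : invariant G b -> transfer (b * f) = b * transfer f.
Proof.
move=> bi; rewrite /transfer big_distrr /=; apply: eq_big_seq => g gG.
by rewrite rmorphM /= bi.
Qed.

Lemma transferD f f' : transfer (f + f') = transfer f + transfer f'.
Proof.
by rewrite /transfer -big_split; apply: eq_bigr => g _; rewrite rmorphD.
Qed.

Lemma transfer_id b : invariant G b -> transfer b = (size G)%:R *: b.
Proof.
move=> bi; rewrite -[b]mulr1 transferM // /transfer.
rewrite (eq_bigr (fun=> 1)) => [|g _]; last by rewrite rmorph1.
by rewrite big_const_seq count_predT iter_addr addr0 mulr1 scaler_nat mulr_natr.
Qed.

(* An invariant with prescribed jet at [v]: average [f0 * f], where the jet of
   [f0] is 1 at [v] and 0 at the other points of the orbit. *)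
Lemma invariant_jet v M f : (forall g, g \in G -> v *m g = v -> act g f = f) ->
  exists2 F, invariant G F & vanish M v (F - f).
Proof.
move=> stabf; pose A := [seq v *m g | g <- G & v *m g != v].
have vA : v \notin A.
  by apply/mapP => -[g]; rewrite mem_filter => /andP[/eqP gv _] /esym.
have [f0 [f0A f0v]] := interpolate_jets M vA.
pose c : k := (count (fun g => v *m g == v) G)%:R.
have cN0 : c != 0.
  have : has (fun g => v *m g == v) G.
    by apply/hasP; exists 1%:M; [exact: group1M|rewrite mulmx1].
  by rewrite has_count /c; case: (count _ _) => // j _; apply: (natr_neq0 char0).
exists (c^-1 *: transfer (f0 * f)); first exact/invariantZ/transfer_invariant.
have -> : c^-1 *: transfer (f0 * f) - f = c^-1 *:
    (\sum_(g <- G | v *m g == v) act g ((f0 - 1) * f) +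
     \sum_(g <- G | v *m g != v) act g (f0 * f)).
  rewrite /transfer (bigID (fun g => v *m g == v)) /=.
  have -> : \sum_(g <- G | v *m g == v) act g (f0 * f) =
      \sum_(g <- G | v *m g == v) act g ((f0 - 1) * f) + c *: f.
    have -> : c *: f = \sum_(g <- G | v *m g == v) f.
      by rewrite big_const_seq iter_addr addr0 scaler_nat.
    rewrite -big_split big_seq_cond [RHS]big_seq_cond.
    apply: eq_bigr => g /andP[gG /eqP gv].
    by rewrite mulrBl mul1r rmorphB /= [act g f]stabf // subrK.
  by rewrite !scalerDr scalerA mulVf // scale1r addrAC addrK.
apply/vanishZ/vanishD; apply: vanish_sum => // g gG gv.
  by apply: vanish_act; rewrite (eqP gv); apply: vanish_mulr.
apply: vanish_act; apply: vanish_mulr; apply: f0A.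
by apply/mapP; exists g => //; rewrite mem_filter gv.
Qed.

(** The quotient map is etale where the stabilizer is trivial: invariants agree there to order 2
    with the coordinate functions. *)
Lemma free_coordinates v : (forall g, g \in G -> g != 1%:M -> v *m g != v) ->
  exists2 u : n.-tuple {mpoly k[n]}, (forall l, invariant G (tnth u l)) &
    \matrix_(i, l) ev v (tnth u l)^`M(i) = 1%:M.
Proof.
move=> vfree.
have H l : exists F, invariant G F /\ vanish 2 v (F - 'X_l).
  have [|F FG Fv] := @invariant_jet v 2 'X_l; last by exists F.
  move=> g gG; case: (eqVneq g 1%:M) => [-> _|g1 /eqP]; first by rewrite act1.
  by rewrite (negPf (vfree g gG g1)).
have [u uP] := boolp.choice H.
exists [tuple u l | l < n] => [l|]; first by rewrite tnth_mktuple; case: (uP l).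
apply/matrixP => i l; rewrite mxE tnth_mktuple.
have [_ [_ /(_ i)[]]] := uP l.
by rewrite mderivB mevalB mderivXU rmorph_nat => /eqP; rewrite subr_eq0 => /eqP ->; rewrite mxE.
Qed.

(** Invariants separate orbits. If g is not in G, some v has v g outside its orbit; for p equal to 0
    on the orbit of v and to 1 on that of v g, the sum of p over G is 0 at v and |G| at v g. *)
Lemma mem_of_fix_invariants g : (forall f, invariant G f -> act g f = f) -> g \in G.
Proof.
move=> fixg; apply: contraT => gNG.
have [v vP] : exists v : 'rV[k]_n, forall h, h \in G -> v *m g != v *m h.
  have [L [LN0 LP]] : exists L : {mpoly k[n]}, L != 0 /\
      forall v, ev v L != 0 -> forall h, h \in (G : seq _) -> v *m g != v *m h.
    have gh h : h \in (G : seq _) -> g - h != 0.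
      by move=> hG; rewrite subr_eq0; apply: contraNneq gNG => ->.
    elim: (G : seq _) gh => [_|h s IH gh].
      by exists 1; rewrite oner_neq0.
    have [|L [LN0 LP]] := IH; first by move=> h' hs; apply: gh; rewrite inE hs orbT.
    have /matrix0Pn[i [j ghij]] : g - h != 0 by apply: gh; rewrite inE eqxx.
    pose L' : {mpoly k[n]} := \sum_i (g - h) i j *: 'X_i.
    have L'E v : ev v L' = (v *m (g - h)) 0 j.
      rewrite raddf_sum mxE; apply: eq_bigr => l _ /=.
      by rewrite mevalZ mevalXU mulrC.
    exists (L' * L); split.
      rewrite mulf_neq0 //; apply: contraNneq ghij => L'0.
      by have := L'E (delta_mx 0 i); rewrite L'0 meval0 -rowE mxE => <-.
    move=> v; rewrite mevalM mulf_eq0 negb_or L'E => /andP[vL' vL] h'.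
    rewrite inE => /predU1P[->|]; last exact: LP.
    by apply: contraNneq vL' => vgh; rewrite mulmxBr vgh subrr mxE.
  by have [v vL] := ev_neq0 char0 LN0; exists v; apply: LP.
have [|p [pA pB]] := @interpolate01 k n [seq v *m h | h <- G] [seq v *m g *m h | h <- G].
  move=> _ /mapP[h hG ->]; apply/mapP => -[h' h'G E].
  have /eqP[] := vP _ (groupMM h'G (groupVM hG)).
  by rewrite mulmxA -E mulmxK // group_unit.
have := congr1 (meval (fun i => v 0 i)) (fixg _ (transfer_invariant p)).
rewrite ev_act /transfer !raddf_sum /=.
rewrite (eq_big_seq (fun=> 1)) => [|h hG]; last first.
  by rewrite ev_act pB //; apply/mapP; exists h.
rewrite [RHS]big1_seq => [|h /andP[_ hG]]; last first.
  by rewrite ev_act pA //; apply/mapP; exists h.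
rewrite big_const_seq count_predT iter_addr addr0 => /eqP.
by rewrite (negPf group_order_neq0).
Qed.

End FiniteGroups.

(** * Homogeneity and Jacobians *)

Section Homogeneity.
Variables (k : fieldType) (char0 : [pchar k] =i pred0).

Definition weight (n : nat) (d : 'I_n -> nat) (m : 'X_{1..n}) : nat :=
  (\sum_i d i * m i)%N.

Lemma mcoeff_act_grading (n : nat) (d : 'I_n -> nat) t (f : {mpoly k[n]}) m :
  (act (grading_mx d t) f)@_m = t ^+ weight d m * f@_m.
Proof.
have actm m' : act (grading_mx d t) 'X_[m'] = t ^+ weight d m' *: 'X_[m'].
  rewrite {1}mpolyXE_id rmorph_prod /= (eq_bigr (fun i => (t ^+ (d i * m' i)) *: 'X_i ^+ m' i)).
    by rewrite scaler_prod -mpolyXE_id prodrXr.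
  move=> i _; rewrite rmorphXn /= actX (bigD1 i) //= big1 => [|j ji].
    by rewrite addr0 !mxE eqxx mulr1n exprZn exprM.
  by rewrite !mxE (negPf ji) mulr0n scale0r.
rewrite {1}(mpolyE f) act_sum raddf_sum /=.
have [mf|/[dup] mf /memN_msupp_eq0 ->] := boolP (m \in msupp f).
  rewrite (bigD1_seq m) ?msupp_uniq //= actZ actm scalerA mcoeffZ mcoeffX eqxx.
  rewrite big1 => [|m' m'm]; first by rewrite addr0 mulr1 mulrC.
  by rewrite actZ actm scalerA mcoeffZ mcoeffX (negPf m'm) mulr0.
rewrite mulr0 big_seq big1 // => m' m'f.
rewrite actZ actm scalerA mcoeffZ mcoeffX; case: eqP => [E|]; last by rewrite mulr0.
by rewrite -E m'f in mf.
Qed.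

Lemma weighted_homogP (n : nat) (d : 'I_n -> nat) e (f : {mpoly k[n]}) :
  (forall t, t != 0 -> act (grading_mx d t) f = t ^+ e *: f) <->
  {in msupp f, forall m, weight d m = e}.
Proof.
split=> [H m mf|H t t0].
  (* The single value t = 2 suffices, its powers being distinct in characteristic 0. *)
  have := congr1 (mcoeff m) (H 2%:R (natr_neq0 char0 1)).
  rewrite mcoeff_act_grading mcoeffZ; rewrite mcoeff_msupp in mf.
  move/(mulIf mf); rewrite -!natrX => /(natr_inj char0) /eqP.
  by rewrite eqn_exp2l // => /eqP.
apply/mpolyP => m; rewrite mcoeff_act_grading mcoeffZ.
have [/H -> //|/memN_msupp_eq0 ->] := boolP (m \in msupp f).
by rewrite !mulr0.
Qed.

Lemma weight_std (n : nat) m : weight (std_grading n) m = mdeg m.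
Proof. by rewrite mdegE; apply: eq_bigr => i _; rewrite mul1n. Qed.

Lemma grading_std (n : nat) (t : k) : grading_mx (std_grading n) t = t%:M.
Proof. by apply/matrixP => i j; rewrite !mxE expr1. Qed.

Lemma ev_act_scalar (n : nat) t v (f : {mpoly k[n]}) :
  ev v (act t%:M f) = ev (t *: v) f.
Proof. by rewrite ev_act mul_mx_scalar. Qed.

Lemma dhomog_evP (n e : nat) (f : {mpoly k[n]}) :
  (forall t v, t != 0 -> ev (t *: v) f = t ^+ e * ev v f) <-> f \is e.-homog.
Proof.
have stdP := weighted_homogP (std_grading n) e f; split=> [H|/dhomogP H t v t0].
  apply/dhomogP => m mf; rewrite /= -weight_std; apply: (proj1 stdP) => // t t0.
  by apply: (ev_inj char0) => v; rewrite grading_std ev_act_scalar H // mevalZ.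
rewrite -ev_act_scalar -grading_std (proj2 stdP) ?mevalZ // => m mf.
by rewrite weight_std; apply: H.
Qed.

Lemma act_scalar_dhomog (n e : nat) t (f : {mpoly k[n]}) : t != 0 ->
  f \is e.-homog -> act t%:M f = t ^+ e *: f.
Proof.
move=> t0 /dhomog_evP fe; apply: (ev_inj char0) => v.
by rewrite ev_act_scalar fe // mevalZ.
Qed.

Lemma euler (n e : nat) (f : {mpoly k[n]}) : f \is e.-homog ->
  \sum_j 'X_j * f^`M(j) = e%:R *: f.
Proof.
move=> /dhomogP fe; rewrite [in RHS](mpolyE f) scaler_sumr.
transitivity (\sum_j \sum_(m <- msupp f) f@_m *: ('X_j * 'X_[m]^`M(j))).
  apply: eq_bigr => j _; rewrite {1}(mpolyE f) raddf_sum big_distrr /=.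
  by apply: eq_bigr => m _; rewrite mderivZ scalerAr.
rewrite exchange_big /=; apply: eq_big_seq => m mf.
rewrite -scaler_sumr [RHS]scalerA mulrC -[RHS]scalerA; congr (_ *: _).
have XE j : 'X_j * ('X_[m])^`M(j) = (m j)%:R *: 'X_[m] :> {mpoly k[n]}.
  rewrite mderivX -scalerAr -mpolyXD.
  case: (m j =P 0%N) => [->|mj]; first by rewrite !scale0r.
  congr (_ *: 'X_[_]); apply/mnmP => i; rewrite mnmDE mnmBE mnm1E.
  by case: eqP => [<-|_]; rewrite ?subn0 // subnKC // lt0n; apply/eqP.
rewrite (eq_bigr _ (fun j _ => XE j)) -scaler_suml -natr_sum -mdegE.
by congr (_%:R *: _); apply: fe.
Qed.

Lemma deriv_scalar (n e : nat) t v j (f : {mpoly k[n]}) : t != 0 -> f \is e.-homog ->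
  t * ev (t *: v) f^`M(j) = t ^+ e * ev v f^`M(j).
Proof.
move=> t0 fe; have := congr1 (mderiv j) (act_scalar_dhomog t0 fe).
rewrite mderiv_act mderivZ => /(congr1 (meval (fun i => v 0 i))).
rewrite mevalZ => <-; rewrite [RHS]ev_sum [RHS](bigD1 j) //= [X in _ + X]big1 => [|i ij].
  by rewrite mevalZ ev_act_scalar !mxE eqxx mulr1n addr0.
by rewrite mevalZ !mxE eq_sym (negPf ij) mulr0n mul0r.
Qed.

End Homogeneity.

Section Jacobian.
Variables (k : fieldType) (n : nat).
Implicit Types (u : n.-tuple {mpoly k[n]}).

Definition jacmx u : 'M[{mpoly k[n]}]_n := \matrix_(i, l) (tnth u l)^`M(i).
Definition jac u : {mpoly k[n]} := \det (jacmx u).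
Definition jac_at u (v : 'rV[k]_n) : 'M[k]_n := map_mx (meval (fun i => v 0 i)) (jacmx u).

Lemma ev_jac u v : ev v (jac u) = \det (jac_at u v).
Proof. by rewrite /jac_at det_map_mx. Qed.

Lemma jac_atE u v i l : jac_at u v i l = ev v (tnth u l)^`M(i).
Proof. by rewrite !mxE. Qed.

Lemma jac_at_col u v l : col l (jac_at u v) = \col_i ev v (tnth u l)^`M(i).
Proof. by apply/colP => i; rewrite !mxE. Qed.

Lemma jac_at_unit u v : (ev v (jac u) != 0) = (jac_at u v \in unitmx).
Proof. by rewrite ev_jac unitmxE unitfE. Qed.

End Jacobian.

Section HomogeneousJacobian.
Variables (k : fieldType) (char0 : [pchar k] =i pred0) (n : nat).
Variables (y : n.-tuple {mpoly k[n]}) (e : 'I_n -> nat).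
Hypothesis yhomog : forall l, tnth y l \is (e l).-homog.

Lemma jac_at_scale t w : t != 0 ->
  t *: jac_at y (t *: w) = jac_at y w *m diag_mx (\row_l t ^+ e l).
Proof.
move=> t0; apply/matrixP => i l; rewrite mul_mx_diag ![_ i l]mxE !mxE.
by rewrite (deriv_scalar char0 _ _ t0 (yhomog l)) mulrC.
Qed.

Lemma jac_dhomog : (forall l, (0 < e l)%N) -> jac y \is (\sum_l (e l).-1).-homog.
Proof.
move=> e_gt0; apply/(dhomog_evP char0) => t v t0; rewrite !ev_jac.
have := congr1 determinant (jac_at_scale v t0); rewrite detZ det_mulmx det_diag.
rewrite (eq_bigr (fun l => t * t ^+ (e l).-1)) => [|l _]; last first.
  by rewrite mxE -exprS prednK.
rewrite big_split /= prodr_const card_ord mulrCA => /(mulfI _) -> //.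
  by rewrite mulrC prodrXr.
exact: expf_neq0.
Qed.

(** Euler's identity in matrix form: it recovers a point from the values of [y] and an invertible
    Jacobian matrix there. *)
Lemma euler_jac w : w *m jac_at y w = \row_l ((e l)%:R * pt y w 0 l).
Proof.
apply/rowP => l; rewrite !mxE -mevalZ -(euler (yhomog l)) ev_sum.
by apply: eq_bigr => i _; rewrite mevalM mevalXU jac_atE.
Qed.

End HomogeneousJacobian.

(** * Points of the quotient *)

Section Points.
Variables (k : closedFieldType) (char0 : [pchar k] =i pred0) (n : nat).
Variables (G : {fset 'M[k]_n}) (GG : finite_linear_group G).
Variable psi : {mpoly k[n]} -> k.
Hypothesis psiD : forall a b, invariant G a -> invariant G b -> psi (a + b) = psi a + psi b.
Hypothesis psiM : forall a b, invariant G a -> invariant G b -> psi (a * b) = psi a * psi b.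
Hypothesis psiC : forall c, psi c%:MP = c.

(** Nonzero linear forms on the fibre of k[V] over the point [psi] of the quotient, that is on k[V]
    tensored with k over the invariants. *)
Let psi_functional (L : {mpoly k[n]} -> k) :=
  [/\ forall a b, L (a + b) = L a + L b,
      forall a b, invariant G a -> L (a * b) = psi a * L b
    & exists a, L a != 0].

Let functional_mul L h : psi_functional L -> (exists a, L (h * a) != 0) ->
  psi_functional (fun a => L (h * a)).
Proof.
move=> [LD LM _] ha; split=> // a b; first by rewrite mulrDr LD.
by move=> ai; rewrite mulrCA LM.
Qed.

(** The variable X_j is a root of the product of the X - g X_j, whose coefficients are invariant;
    applying [psi] to them gives a monic p over k such that p(X_j) kills L. Linear factors of p are
    dropped one at a time until the remaining product h no longer kills L; the root dropped last is
    the eigenvalue. *)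
Let eigen_functional L j : psi_functional L ->
  exists h c, psi_functional (fun a => L (h * a)) /\
    forall a, L (h * ('X_j * a)) = c * L (h * a).
Proof.
move=> LP; have [LD LM [a0 La0]] := LP.
have L0 : L 0 = 0 by apply: (addrI (L 0)); rewrite -LD !addr0.
have Lsum (I : Type) (r : seq I) F : L (\sum_(i <- r) F i) = \sum_(i <- r) L (F i).
  by elim: r => [|i r IH]; rewrite ?big_nil // !big_cons LD IH.
have LC c a : L (c%:MP * a) = c * L a by rewrite LM ?psiC //; apply: invariantC.
pose P : {poly {mpoly k[n]}} := \prod_(g <- G) ('X - (act g 'X_j)%:P).
have Pinv i : invariant G P`_i.
  move=> h hG; suff E : map_poly (act h) P = P by rewrite -[RHS](congr1 (fun p : {poly _} => p`_i) E) coef_map.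
  rewrite /P rmorph_prod /= -[RHS](big_groupMl GG _ _ hG); apply: eq_bigr => g _.
  by rewrite rmorphB /= map_polyX map_polyC /= act_comp.
have PX : P.[ 'X_j ] = 0.
  rewrite horner_prod; under eq_bigr => g _ do rewrite hornerXsubC.
  rewrite (big_rem 1%:M); last exact: (group1M GG).
  by rewrite (act1 char0) subrr; apply: mul0r.
pose p := \poly_(i < size P) psi P`_i.
have XL (r : {poly k}) a : L ((map_poly (@mpolyC n k) r).['X_j] * a) =
    \sum_(i < size r) r`_i * L ('X_j ^+ i * a).
  rewrite (@horner_coef_wide _ (size r)) ?size_poly // big_distrl Lsum.
  by apply: eq_bigr => i _; rewrite coef_map /= -mulrA LC.
have pE a : L ((map_poly (@mpolyC n k) p).['X_j] * a) = 0.
  have sP : (size p <= size P)%N by apply: size_poly.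
  rewrite XL (big_ord_widen _ (fun i => p`_i * L ('X_j ^+ i * a)) sP).
  rewrite big_mkcond -[RHS]L0 -(mul0r a) -PX horner_coef big_distrl Lsum /=.
  apply: eq_bigr => i _; rewrite -mulrA [RHS]LM; last exact: Pinv.
  have pi : p`_i = psi P`_i by rewrite coef_poly ltn_ord.
  rewrite -pi.
  by case: ltnP => // /leq_sizeP /(_ _ (leqnn i)) ->; rewrite mul0r.
have sP : size P = (size G).+1 by rewrite size_prod_XsubC.
have p1 : p \is monic.
  have lP : P`_(size G) = 1.
    by have := monic_prod_XsubC G xpredT (fun g => act g 'X_j);
      rewrite monicE lead_coefE -/P sP => /eqP.
  have cp : p`_(size G) = 1 by rewrite coef_poly sP ltnSn lP -mpolyC1 psiC.
  have sp : size p = (size G).+1.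
    apply/eqP; rewrite eqn_leq; apply/andP; split; first by rewrite -sP size_poly.
    rewrite ltnNge; apply/negP => /leq_sizeP /(_ _ (leqnn _)) /eqP.
    by rewrite cp oner_eq0.
  by rewrite monicE lead_coefE sp cp.
have [r pr] := closed_field_poly_normal p.
have {}pE a : L ((\prod_(c <- r) ('X_j - c%:MP)) * a) = 0.
  rewrite -[RHS](pE a) pr (monicP p1) scale1r rmorph_prod /= horner_prod.
  congr (L (_ * a)); apply: eq_bigr => c _.
  by rewrite rmorphB /= map_polyX map_polyC /= hornerXsubC.
elim: r {pr} pE => [pE|c r IH pE].
  by case/eqP: La0; have := pE a0; rewrite big_nil mul1r.
have [H|H] := boolp.EM (exists a, L ((\prod_(c <- r) ('X_j - c%:MP)) * a) != 0).
  exists (\prod_(c <- r) ('X_j - c%:MP)), c; split; first exact: functional_mul.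
  move=> a; apply/eqP; rewrite -subr_eq0; have := pE a; rewrite big_cons.
  set h := \prod_(c <- r) _ => E.
  have : L (h * ('X_j * a)) = L (('X_j - c%:MP) * h * a) + L (c%:MP * (h * a)).
    by rewrite -LD; congr L; ring.
  by rewrite E add0r LC => ->; rewrite subrr.
apply: IH => a; apply/eqP; apply: boolp.contrapT => /negP H'.
by apply: H; exists a.
Qed.

(* [psi] extends to the functional [psi \o transfer]; multiplying it by suitable
   elements yields a common eigenvector of the coordinates, i.e. a point. *)
Lemma point_of_invariant_morphism :
  exists q, forall b, invariant G b -> psi b = ev q b.
Proof.
have [L [[LD LM [a0 La0]] La]] : exists L, psi_functional L /\
    forall j, j \in enum 'I_n -> exists c, forall a, L ('X_j * a) = c * L a.
  elim: (enum 'I_n) => [|j s [L [LP Ls]]].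
    exists (fun a => psi (transfer G a)); split=> //.
    have TI a := transfer_invariant char0 GG a.
    split=> [a b|a b ai|]; first by rewrite transferD psiD.
      by rewrite transferM // psiM.
    exists 1; rewrite transfer_id; last exact: invariant1.
    by rewrite -mul_mpolyC mulr1 psiC (group_order_neq0 char0 GG).
  have [h [c [LhP Lh]]] := eigen_functional j LP.
  exists (fun a => L (h * a)); split=> // i; rewrite inE => /predU1P[->|/Ls[b Lb]].
    by exists c.
  by exists b => a; rewrite mulrCA Lb.
have [c cP] := boolp.choice (fun j => La j (mem_enum _ j)).
exists (\row_j c j) => b bi.
have evL p : forall a, L (p * a) = ev (\row_j c j) p * L a.
  elim/mpoly_ring_ind: p => [e|j|p q pE qE|p q pE qE] a.
  - by rewrite mevalC LM ?psiC //; apply: invariantC.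
  - by rewrite mevalXU mxE cP.
  - by rewrite mulrDl LD mevalD mulrDl pE qE.
  by rewrite -mulrA mevalM pE qE mulrA.
by apply: (mulIf La0); rewrite -LM // evL.
Qed.

End Points.

(** * Separable relations and the rank of the Jacobian *)

Section SeparableRelation.
Variables (k : fieldType) (n p : nat) (y : p.-tuple {mpoly k[n]}).

(** [y] is substituted only at the end, so that relations can be differentiated in their
    coefficients and compared at two points with the same values of [y]. *)
Definition eval_rel (R : {poly {mpoly k[p]}}) (b : {mpoly k[n]}) : {mpoly k[n]} :=
  (map_poly (comp_mpoly y) R).[b].

Lemma eval_relD R S b : eval_rel (R + S) b = eval_rel R b + eval_rel S b.
Proof. by rewrite /eval_rel rmorphD hornerD. Qed.

Lemma eval_relMXC R c b : eval_rel (R * 'X + c%:P) b = eval_rel R b * b + (c \mPo y).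
Proof.
by rewrite /eval_rel rmorphD rmorphM /= map_polyX map_polyC hornerMXaddC.
Qed.

Lemma coef_map_mderiv s (R : {poly {mpoly k[p]}}) i :
  (map_poly (mderiv s) R)`_i = (R`_i)^`M(s).
Proof. by apply: coef_map_id0; apply: mderiv0. Qed.

Lemma mderiv_eval_rel R b l :
  (eval_rel R b)^`M(l) =
  \sum_s eval_rel (map_poly (mderiv s) R) b * (tnth y s)^`M(l)
  + eval_rel R^`() b * b^`M(l).
Proof.
elim/poly_ind: R => [|R c IH].
  rewrite /eval_rel !rmorph0 horner0 mderiv0 deriv0 rmorph0 horner0 mul0r addr0.
  by rewrite big1 // => s _; rewrite !raddf0 /= horner0 mul0r.
rewrite eval_relMXC mderivD mderivM IH mderiv_comp derivMXaddC.
have E s : eval_rel (map_poly (mderiv s) (R * 'X + c%:P)) b =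
    eval_rel (map_poly (mderiv s) R) b * b + (c^`M(s) \mPo y).
  rewrite -eval_relMXC; congr eval_rel; apply/polyP => i.
  rewrite [LHS]coef_map_mderiv.
  rewrite [RHS]coefD [X in _ = X + _]coefMX [X in _ = _ + X]coefC.
  rewrite [X in X^`M(s) = _]coefD [X in (X + _)^`M(s) = _]coefMX.
  rewrite [X in (_ + X)^`M(s) = _]coefC.
  case: i => [|i] /=; first by rewrite !add0r.
  by rewrite !addr0 [RHS]coef_map_mderiv.
under [X in _ = X + _]eq_bigr => s _ do rewrite E mulrDl.
rewrite big_split /=.
have -> : eval_rel (R + R^`() * 'X) b = eval_rel R b + eval_rel R^`() b * b.
  by rewrite eval_relD -[_ * 'X]addr0 -polyC0 eval_relMXC comp_mpoly0 addr0.
have -> : \sum_s eval_rel (map_poly (mderiv s) R) b * b * (tnth y s)^`M(l) =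
  (\sum_s eval_rel (map_poly (mderiv s) R) b * (tnth y s)^`M(l)) * b.
  by rewrite big_distrl; apply: eq_bigr => s _ /=; rewrite mulrAC.
by ring.
Qed.

Lemma ev_eval_rel R b v :
  ev v (eval_rel R b) = (map_poly (meval (fun i => pt y v 0 i)) R).[ev v b].
Proof.
rewrite /eval_rel -horner_map /=; congr (_.[_]).
apply/polyP => i; rewrite !coef_map /=.
exact: ev_comp.
Qed.

Definition separable_over (b : {mpoly k[n]}) :=
  exists R, eval_rel R b = 0 /\ eval_rel R^`() b != 0.

(** If R'(b) = 0, then R' is a nonzero relation of smaller degree; the descent cannot reach the
    constants, [y] being algebraically independent. *)
Lemma separable_of_algebraic (char0 : [pchar k] =i pred0) b :
  (forall f, f \mPo y = 0 -> f = 0) ->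
  (exists2 R, R != 0 & eval_rel R b = 0) -> separable_over b.
Proof.
move=> yfree [R0 R0N0 R0b].
have [s] := ubnP (size R0); elim: s R0 R0N0 R0b => // s IH R RN0 Rb sR.
case: (eqVneq (eval_rel R^`() b) 0) => [R'b|R'b]; last by exists R.
have s1 : (1 < size R)%N.
  rewrite ltnNge; apply/negP => /size1_polyC RC; case/eqP: RN0.
  by move: Rb; rewrite RC /eval_rel map_polyC hornerC => /yfree ->.
have natN0 j : (j.+1%:R : {mpoly k[p]}) != 0.
  by rewrite -mpolyC_nat mpolyC_eq0 natr_neq0.
have szR' : R^`() != 0.
  apply/negP => /eqP R'0.
  have := congr1 (fun q : {poly _} => q`_(size R).-2) R'0.
  have : R`_(size R).-1 != 0 by rewrite -lead_coefE lead_coef_eq0.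
  rewrite coef_deriv coef0 -mulr_natr.
  case: (size R) s1 => [|[|j]] //= _ lN0 /eqP.
  by rewrite mulf_eq0 (negPf lN0) (negPf (natN0 j)).
apply: (IH R^`()) => //; rewrite -ltnS; apply: leq_trans sR.
by rewrite ltnS lt_size_deriv.
Qed.

End SeparableRelation.

Section JacobianCriterion.
Variables (k : fieldType) (char0 : [pchar k] =i pred0) (n p : nat).
Variables (G : {fset 'M[k]_n}) (GG : finite_linear_group G).
Variable (y : p.-tuple {mpoly k[n]}).

Lemma free_point : exists v : 'rV[k]_n, forall g, g \in G -> g != 1%:M -> v *m g != v.
Proof.
have [L [LN0 LP]] : exists L : {mpoly k[n]}, L != 0 /\
    forall v, ev v L != 0 -> forall g, g \in (G : seq _) -> g != 1%:M -> v *m g != v.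
  elim: (G : seq _) => [|g s [L [LN0 LP]]]; first by exists 1; rewrite oner_neq0.
  case: (eqVneq g 1%:M) => [g1|gN1].
    exists L; split=> // v vL h; rewrite inE => /predU1P[->|]; last exact: LP.
    by rewrite g1 eqxx.
  have /matrix0Pn[i [j gij]] : g - 1%:M != 0 by rewrite subr_eq0.
  pose L' : {mpoly k[n]} := \sum_i (g - 1%:M) i j *: 'X_i.
  have L'E v : ev v L' = (v *m (g - 1%:M)) 0 j.
    by rewrite ev_sum mxE; apply: eq_bigr => l _ /=; rewrite mevalZ mevalXU mulrC.
  exists (L' * L); split.
    rewrite mulf_neq0 //; apply: contraNneq gij => L'0.
    by have := L'E (delta_mx 0 i); rewrite L'0 meval0 -rowE [X in _ = X]mxE => <-.
  move=> v; rewrite mevalM mulf_eq0 negb_or L'E => /andP[vL' vL] h.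
  rewrite inE => /predU1P[-> _|]; last exact: LP.
  by apply: contraNneq vL' => vg; rewrite mulmxBr vg mulmx1 subrr mxE.
by have [v vL] := ev_neq0 char0 LN0; exists v; apply: LP.
Qed.

(** Take n invariants [u] that are coordinates somewhere. Differentiating their separable relations
    writes the gradients of [u] at a general point as combinations of those of [y]. *)
Lemma gradients_span : (forall b, invariant G b -> separable_over y b) ->
  exists v, row_free (\matrix_(i < n, s < p) ev v (tnth y s)^`M(i)).
Proof.
move=> sep; have [v0 v0free] := free_point.
have [u uG uv0] := free_coordinates char0 GG v0free.
have [R RP] := boolp.choice (fun l => sep _ (uG l)).
have uN0 : jac u != 0.
  suff: ev v0 (jac u) != 0 by apply: contraNneq => ->; rewrite meval0.
  rewrite jac_at_unit; suff -> : jac_at u v0 = 1%:M by apply: unitmx1.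
  by rewrite -uv0; apply/matrixP => i l; rewrite jac_atE mxE.
have LN0 : jac u * \prod_l eval_rel y (R l)^`() (tnth u l) != 0.
  by rewrite mulf_neq0 //; apply/prodf_neq0 => l _; case: (RP l).
have [v] := ev_neq0 char0 LN0.
rewrite mevalM mulf_eq0 negb_or jac_at_unit rmorph_prod => /andP[uv Rv].
exists v; set Y := \matrix_(i, s) _.
have [C CE] : exists C, jac_at u v = Y *m C.
  pose D l := ev v (eval_rel y (R l)^`() (tnth u l)).
  exists (\matrix_(s, l) (- (D l)^-1 * ev v (eval_rel y (map_poly (mderiv s) (R l)) (tnth u l)))).
  apply/matrixP => i l; rewrite jac_atE mxE.
  have DN0 : D l != 0 by move/prodf_neq0: Rv; apply.
  have := congr1 (meval (fun i => v 0 i)) (mderiv_eval_rel y (R l) (tnth u l) i).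
  have [-> _] := RP l; rewrite mderiv0 meval0 mevalD mevalM -/(D l) ev_sum => /esym/eqP.
  rewrite addr_eq0 => /eqP E; apply: (mulfI DN0); rewrite -[LHS]opprK -E.
  rewrite big_distrr -sumrN; apply: eq_bigr => s _ /=.
  by rewrite mevalM !mxE; field.
have : row_free (jac_at u v) by rewrite row_free_unit.
rewrite -!row_leq_rank CE => /leq_trans; apply; exact: mxrankM_maxl.
Qed.

Lemma gradients_rank : (forall b, invariant G b -> separable_over y b) -> (n <= p)%N.
Proof.
case/gradients_span => v; rewrite -row_leq_rank => /leq_trans; apply.
exact: rank_leq_col.
Qed.

End JacobianCriterion.

(** * Lifting automorphisms of the invariant ring *)

Lemma act_scalarC (k : fieldType) (char0 : [pchar k] =i pred0) (n : nat)
    (g : 'M[k]_n) t f : act g (act t%:M f) = act t%:M (act g f).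
Proof.
by apply: (ev_inj char0) => v; rewrite !ev_act !mul_mx_scalar scalemxAl.
Qed.

Lemma map_linear_factors (A B : comNzRingType) (f : {rmorphism A -> B})
    (I : Type) (r : seq I) (a b : I -> A) :
  map_poly f (\prod_(i <- r) ((a i)%:P * 'X - (b i)%:P)) =
  \prod_(i <- r) ((f (a i))%:P * 'X - (f (b i))%:P).
Proof.
rewrite rmorph_prod; apply: eq_bigr => i _.
by rewrite rmorphB rmorphM /= map_polyX !map_polyC.
Qed.

Section TwoPoints.
Variables (k : fieldType) (char0 : [pchar k] =i pred0) (n : nat).
Implicit Types (v q : 'rV[k]_n) (T : {mpoly {mpoly k[n]}[n]}).

(* Polynomials in two points [v] and [q]: the coefficients depend on [v]. *)
Definition ev2 v q T : k := mmap (meval (fun i => v 0 i)) (fun i => q 0 i) T.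

HB.instance Definition _ v q := GRing.RMorphism.copy (@ev2 v q)
  (mmap (meval (fun i => v 0 i)) (fun i => q 0 i)).

Definition second (b : {mpoly k[n]}) : {mpoly {mpoly k[n]}[n]} := map_mpoly (@mpolyC n k) b.

HB.instance Definition _ := GRing.RMorphism.copy second (map_mpoly (@mpolyC n k)).

Definition act_first (g : 'M[k]_n) T : {mpoly {mpoly k[n]}[n]} := map_mpoly (act g) T.

HB.instance Definition _ g := GRing.RMorphism.copy (@act_first g) (map_mpoly (act g)).

Lemma ev2_first v q b : ev2 v q b%:MP = ev v b.
Proof. by rewrite /ev2 mmapC. Qed.

Lemma ev2_XU v q i : ev2 v q 'X_i = q 0 i.
Proof. by rewrite /ev2 mmapX mmap1U. Qed.

Lemma ev2D v q : {morph ev2 v q : S T / S + T}. Proof. exact: rmorphD. Qed.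
Lemma ev2M v q : {morph ev2 v q : S T / S * T}. Proof. exact: rmorphM. Qed.
Lemma secondD : {morph second : S T / S + T}. Proof. exact: rmorphD. Qed.
Lemma secondM : {morph second : S T / S * T}. Proof. exact: rmorphM. Qed.
Lemma act_firstD g : {morph act_first g : S T / S + T}. Proof. exact: rmorphD. Qed.
Lemma act_firstM g : {morph act_first g : S T / S * T}. Proof. exact: rmorphM. Qed.

Lemma secondC c : second c%:MP = (c%:MP)%:MP.
Proof. by rewrite /second map_mpolyC ?mpolyC0. Qed.

Lemma secondXU i : second 'X_i = 'X_i.
Proof. by rewrite /second map_mpolyX ?mpolyC0 ?mpolyC1. Qed.

Lemma ev2_second v q b : ev2 v q (second b) = ev q b.
Proof.
elim/mpoly_ring_ind: b => [c|i|f g fE gE|f g fE gE].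
- by rewrite secondC ev2_first !mevalC.
- by rewrite secondXU ev2_XU mevalXU.
- by rewrite secondD ev2D mevalD; congr (_ + _).
by rewrite secondM ev2M mevalM; congr (_ * _).
Qed.

Lemma act_firstC g b : act_first g b%:MP = (act g b)%:MP.
Proof. by rewrite /act_first map_mpolyC ?rmorph0. Qed.

Lemma act_firstXU g i : act_first g 'X_i = 'X_i.
Proof. by rewrite /act_first map_mpolyX ?rmorph1 ?rmorph0. Qed.

Lemma act_first_second g b : act_first g (second b) = second b.
Proof.
elim/mpoly_ring_ind: b => [c|i|f h fE hE|f h fE hE].
- by rewrite secondC act_firstC actC.
- by rewrite secondXU act_firstXU.
- by rewrite secondD act_firstD; exact: (f_equal2 +%R fE hE).
by rewrite secondM act_firstM; exact: (f_equal2 *%R fE hE).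
Qed.

Lemma ev2_act_first v q g T : ev2 v q (act_first g T) = ev2 (v *m g) q T.
Proof.
elim/mpoly_ring_ind: T => [b|i|S T SE TE|S T SE TE].
- by rewrite act_firstC !ev2_first ev_act.
- by rewrite act_firstXU !ev2_XU.
- by rewrite act_firstD !ev2D; congr (_ + _).
by rewrite act_firstM !ev2M; congr (_ * _).
Qed.

Lemma mcoeff_act_first g T m : (act_first g T)@_m = act g T@_m.
Proof. exact: mcoeff_map_mpoly. Qed.

Lemma act_first_comp g h T : act_first g (act_first h T) = act_first (g *m h) T.
Proof.
apply/mpolyP => m.
apply: etrans (mcoeff_act_first _ _ _) _; apply/esym.
apply: etrans (mcoeff_act_first _ _ _) _.
by apply: etrans (act_comp char0 _ _ _) _; rewrite (mcoeff_act_first h).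
Qed.

End TwoPoints.

Section Lifting.
Variables (k : closedFieldType) (char0 : [pchar k] =i pred0) (n : nat).
Variables (G : {fset 'M[k]_n}) (GG : finite_linear_group G).

(** An endomorphism of the graded algebra of invariants, encoded as a function on all polynomials of
    which only the values on invariants matter. *)
Definition invariant_morphism (s : {mpoly k[n]} -> {mpoly k[n]}) : Prop :=
  [/\ forall a, invariant G a -> invariant G (s a),
      forall a b, invariant G a -> invariant G b -> s (a + b) = s a + s b,
      forall a b, invariant G a -> invariant G b -> s (a * b) = s a * s b,
      forall c, s c%:MP = c%:MP
    & forall t a, t != 0 -> invariant G a -> s (act t%:M a) = act t%:M (s a)].

Variables (sg sg' : {mpoly k[n]} -> {mpoly k[n]}).
Hypotheses (sgP : invariant_morphism sg) (sgP' : invariant_morphism sg').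
Hypotheses (sgK : forall a, invariant G a -> sg' (sg a) = a)
           (sgK' : forall a, invariant G a -> sg (sg' a) = a).
Hypothesis G_norefl : forall g, g \in G -> ~ reflection g.

Variables (y : n.-tuple {mpoly k[n]}) (e : 'I_n -> nat).
Hypotheses (yG : forall l, invariant G (tnth y l))
           (e_gt0 : forall l, (0 < e l)%N)
           (yhomog : forall l, tnth y l \is (e l).-homog)
           (yjac : jac y != 0)
           (sgy : forall l, sg (tnth y l) = tnth y l)
           (ysep : forall b, invariant G b -> separable_over y b).

(** The orbit of q is the image of the orbit of v under the map of the quotient to itself that [sg]
    defines. *)
Let graph (v q : 'rV[k]_n) := forall b, invariant G b -> ev q b = ev v (sg b).

Let Qmx (v q : 'rV[k]_n) := jac_at y v *m invmx (jac_at y q).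

Lemma graph_total v : exists q, graph v q.
Proof.
case: sgP => sI sD sM sC _.
have [a b ai bi|a b ai bi|c|q qP] :=
    @point_of_invariant_morphism k char0 n G GG (fun b => ev v (sg b)).
- by rewrite sD // mevalD.
- by rewrite sM // mevalM.
- by rewrite sC mevalC.
by exists q => b bi; rewrite -qP.
Qed.

Lemma graph_surj q : exists v, graph v q.
Proof.
case: sgP => sI _ _ _ _; case: sgP' => sI' sD sM sC _.
have [a b ai bi|a b ai bi|c|v vP] :=
    @point_of_invariant_morphism k char0 n G GG (fun b => ev q (sg' b)).
- by rewrite sD // mevalD.
- by rewrite sM // mevalM.
- by rewrite sC mevalC.
by exists v => b bi; rewrite -vP ?sgK //; apply: sI.
Qed.

Lemma graphM v q g : graph v q -> g \in G -> graph (v *m g) q.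
Proof.
case: sgP => sI _ _ _ _ vq gG b bi.
by rewrite (ev_invariant v (sI b bi) gG) vq.
Qed.

Lemma graphZ v q t : t != 0 -> graph v q -> graph (t *: v) (t *: q).
Proof.
case: sgP => _ _ _ _ sZ t0 vq b bi.
have tb : invariant G (act t%:M b).
  by move=> g gG; rewrite act_scalarC // bi.
by rewrite -!ev_act_scalar vq // sZ.
Qed.

Lemma graph_y v q : graph v q -> pt y v = pt y q.
Proof. by move=> vq; apply/rowP => l; rewrite !mxE vq // sgy. Qed.

Lemma sg_comp f : sg (f \mPo y) = f \mPo y.
Proof.
case: sgP => sI sD sM sC _.
elim/mpoly_ring_ind: f => [c|l|f g fE gE|f g fE gE].
- by rewrite comp_mpolyC sC.
- by rewrite comp_mpolyU.
- by rewrite comp_mpolyD sD ?fE ?gE //; apply: invariant_comp.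
by rewrite rmorphM /= sM ?fE ?gE //; apply: invariant_comp.
Qed.

Lemma sg_eval_rel R b : invariant G b -> sg (eval_rel y R b) = eval_rel y R (sg b).
Proof.
case: sgP => sI sD sM sC _ bi.
have RI S : invariant G (eval_rel y S b).
  elim/poly_ind: S => [|S c IH]; first by rewrite /eval_rel rmorph0 horner0; apply: invariant0.
  rewrite eval_relMXC; apply: invariantD; last exact: invariant_comp.
  exact: invariantM.
elim/poly_ind: R => [|R c IH].
  by rewrite /eval_rel rmorph0 !horner0 -mpolyC0 sC.
rewrite !eval_relMXC sD ?sM ?IH ?sg_comp //; last exact: invariant_comp.
exact: invariantM.
Qed.

(** Both points have the same values of [y] and of the function in the relation R. Differentiating R
    therefore expresses the two gradients by one and the same column, multiplied by the respective
    Jacobian matrix of [y]. *)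
Lemma gradient_transport v q R b : graph v q -> invariant G b ->
  jac_at y q \in unitmx -> eval_rel y R b = 0 -> ev q (eval_rel y R^`() b) != 0 ->
  \col_i ev v (sg b)^`M(i) = Qmx v q *m \col_i ev q b^`M(i).
Proof.
move=> vq bi yq Rb R'b.
have Rsb : eval_rel y R (sg b) = 0.
  by rewrite -sg_eval_rel // Rb; case: sgP => _ _ _ sC _; rewrite -mpolyC0 sC.
pose A : 'cV[k]_n := \col_s ev q (eval_rel y (map_poly (mderiv s) R) b).
pose c := ev q (eval_rel y R^`() b).
have grad w f : pt y w = pt y q -> ev w f = ev q b -> eval_rel y R f = 0 ->
    c *: (\col_i ev w f^`M(i)) = - (jac_at y w *m A).
  move=> wq fb Rf; apply/colP => i.
  have := congr1 (meval (fun i => w 0 i)) (mderiv_eval_rel y R f i).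
  rewrite Rf mderiv0 meval0 mevalD mevalM ev_sum => /esym/eqP.
  rewrite addrC addr_eq0 => /eqP E; rewrite !mxE.
  rewrite (_ : c = ev w (eval_rel y R^`() f)); last by rewrite /c !ev_eval_rel wq fb.
  rewrite E; congr (- _); apply: eq_bigr => s _.
  by rewrite mevalM mulrC !mxE !ev_eval_rel wq fb.
have gq := grad q b erefl erefl Rb.
have gv := grad v (sg b) (graph_y vq) (esym (vq b bi)) Rsb.
have cN0 : c != 0 by [].
apply: (scalerI cN0); rewrite gv scalemxAr gq mulmxN; congr (- _).
by rewrite /Qmx !mulmxA mulmxKV.
Qed.

Lemma jac_at_scale_unit t q : t != 0 -> jac_at y q \in unitmx ->
  jac_at y (t *: q) \in unitmx.
Proof.
move=> t0 yq; rewrite -(unitmxZ _ (a := t)) ?unitfE // (jac_at_scale char0 yhomog) // unitmx_mul yq.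
rewrite unitmxE det_diag unitfE; apply/prodf_neq0 => l _.
by rewrite mxE expf_neq0.
Qed.

Lemma Qmx_scale t v q : t != 0 -> jac_at y q \in unitmx ->
  Qmx (t *: v) (t *: q) = Qmx v q.
Proof.
move=> t0 yq; have ytq := jac_at_scale_unit t0 yq.
rewrite /Qmx; apply: (canLR (mulmxK ytq)); apply: (scalerI t0).
by rewrite scalemxAr !(jac_at_scale char0 yhomog) // !mulmxA mulmxKV.
Qed.

Lemma Qmx_point v q : graph v q -> jac_at y q \in unitmx -> q = v *m Qmx v q.
Proof.
move=> vq yq; rewrite /Qmx mulmxA; apply: (canRL (mulmxK yq)).
by rewrite !(euler_jac yhomog) (graph_y vq).
Qed.

(** On the graph a(v) = (sg' a)(q) for an invariant a; this is applied to each coefficient of T. *)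
Lemma descend T : (forall g, g \in G -> act_first g T = T) ->
  exists A, forall v q, graph v q -> ev q A = ev2 v q T.
Proof.
case: sgP => sI _ _ _ _; case: sgP' => sI' _ _ _ _ TG.
exists (\sum_(m <- msupp T) sg' T@_m * 'X_[m]) => v q vq.
rewrite ev_sum; apply: eq_bigr => m _; rewrite mevalM mevalX.
have Tm : invariant G T@_m.
  by move=> g gG; rewrite -[in RHS](TG g gG) mcoeff_act_first.
by rewrite vq ?sgK' //; apply: sI'.
Qed.

Section Characteristic.
Variables i j : 'I_n.

Let su (u : n.-tuple {mpoly k[n]}) := [tuple sg (tnth u l) | l < n].

(** An entry of Jac (sg u)(v) (Jac u(q))^-1, with the denominator [jac u] cleared by the adjugate to
    get a polynomial in both points. *)
Let entry u : {mpoly {mpoly k[n]}[n]} :=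
  \sum_l ((tnth (su u) l)^`M(i))%:MP * second (\adj (jacmx u) l j).

Let ev2_entry u v q :
  ev2 v q (entry u) = (jac_at (su u) v *m \adj (jac_at u q)) i j.
Proof.
rewrite /entry (raddf_sum (ev2 v q)) mxE; apply: eq_bigr => l _ /=.
rewrite ev2M ev2_first ev2_second jac_atE; congr (_ * _).
by rewrite /jac_at -map_mx_adj [RHS]mxE; exact: erefl.
Qed.

Let charpoly_descend u s : exists A, forall v q, graph v q -> ev q A =
  (\prod_(g <- G) ((ev q (jac u))%:P * 'X
     - ((jac_at (su u) (v *m g) *m \adj (jac_at u q)) i j)%:P))`_s.
Proof.
pose P := \prod_(g <- G) ((second (jac u))%:P * 'X - (act_first g (entry u))%:P).
have PG h : h \in G -> map_poly (act_first h) P = P.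
  move=> hG; rewrite /P map_linear_factors -[RHS](big_groupMl GG _ _ hG).
  apply: eq_bigr => g _.
  apply: (f_equal2 (fun a b => a%:P * 'X - b%:P)); first exact: act_first_second.
  exact: (act_first_comp char0).
have [h hG|A AP] := @descend P`_s.
  by rewrite -[RHS](congr1 (fun p : {poly _} => p`_s) (PG h hG)) coef_map.
exists A => v q /AP ->; rewrite -coef_map /P map_linear_factors.
congr ((_ : {poly k})`_s); apply: eq_bigr => g _.
apply: (f_equal2 (fun a b => a%:P * 'X - b%:P)); first exact: ev2_second.
exact: etrans (ev2_act_first _ _ _ _) (ev2_entry _ _ _).
Qed.

(** The product runs over the orbit of v because all the v g are related to the same q; this makes
    its coefficients functions of q. *)
Let chi v q := \prod_(g <- G) ('X - (Qmx (v *m g) q i j)%:P).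

Let charpolyE u v q :
  (forall g, g \in G -> jac_at (su u) (v *m g) = Qmx (v *m g) q *m jac_at u q) ->
  \prod_(g <- G) ((ev q (jac u))%:P * 'X
     - ((jac_at (su u) (v *m g) *m \adj (jac_at u q)) i j)%:P)
  = (ev q (jac u) ^+ size G) *: chi v q.
Proof.
move=> H; rewrite big_seq.
rewrite (eq_bigr (fun g => (ev q (jac u))%:P * ('X - (Qmx (v *m g) q i j)%:P))).
  rewrite -big_seq big_split /= big_const_seq count_predT iter_mulr mulr1.
  by rewrite -polyC_exp mul_polyC.
move=> g gG; rewrite H // -mulmxA mul_mx_adj mul_mx_scalar mulrBr -polyCM ev_jac.
by rewrite mxE.
Qed.

Let su_y : su y = y.
Proof. by apply: eq_from_tnth => l; rewrite tnth_mktuple sgy. Qed.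

Let charpoly_y v q : jac_at y q \in unitmx ->
  \prod_(g <- G) ((ev q (jac y))%:P * 'X
     - ((jac_at (su y) (v *m g) *m \adj (jac_at y q)) i j)%:P)
  = (ev q (jac y) ^+ size G) *: chi v q.
Proof.
by move=> yq; apply: charpolyE => g gG; rewrite su_y /Qmx mulmxKV.
Qed.

(** A coefficient of [chi] is a polynomial in q divided by a power of [jac y]. With coordinates [u]
    that are free at a given point, it is also a polynomial divided by a power of [jac u], which is
    invertible there. This gives local divisibility by the power of [jac y], hence divisibility. The
    quotient is unchanged by scaling, hence constant. *)
Lemma Qmx_charpoly_coef s : exists c : k, forall v q, graph v q ->
  jac_at y q \in unitmx -> (chi v q)`_s = c.
Proof.
have [A AP] := charpoly_descend y s.
pose D := jac y ^+ size G.
have Dhomog : D \is ((\sum_l (e l).-1) * size G).-homog.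
  exact/dhomogMn/(jac_dhomog char0 yhomog).
have DN0 : D != 0 by rewrite expf_neq0.
have AD : exists q, A = D * q.
  pose bad := [seq g - 1%:M | g <- G & g != 1%:M].
  apply: (dvd_of_local char0 (bad := bad) Dhomog DN0) => [N /mapP[g gf ->]|v vbad M].
    move: gf; rewrite mem_filter => /andP[g1 gG].
    exact: (rank_nonreflection GG gG g1 (G_norefl gG)).
  have vfree g : g \in G -> g != 1%:M -> v *m g != v.
    move=> gG g1; rewrite -subr_eq0 -{2}[v]mulmx1 -mulmxBr; apply: vbad.
    by apply/mapP; exists g => //; rewrite mem_filter g1.
  have [u uG uv] := free_coordinates char0 GG vfree.
  have uv1 : ev v (jac u) = 1.
    by rewrite ev_jac (_ : jac_at u v = 1%:M) ?det1 // -uv; apply/matrixP => a b;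
      rewrite jac_atE mxE.
  have [Au AuP] := charpoly_descend u s.
  exists (jac u ^+ size G), Au; rewrite rmorphXn /= uv1 expr1n oner_neq0; split=> //.
  (* The two fractions agree exactly, hence to every order; this is checked on the dense set where
     [jac y] and the derivatives of the relations of [u] are nonzero. *)
  suff -> : jac u ^+ size G * A - D * Au = 0 by apply: vanish0.
  have [R RP] := boolp.choice (fun l => ysep (uG l)).
  pose L := jac y * \prod_l eval_rel y (R l)^`() (tnth u l).
  have LN0 : L != 0.
    by rewrite mulf_neq0 //; apply/prodf_neq0 => l _; case: (RP l).
  suff : L * (jac u ^+ size G * A - D * Au) = 0.
    by move/eqP; rewrite mulf_eq0 (negPf LN0) => /eqP.
  apply: (ev_ext char0) => q.
  rewrite mevalM; case: (eqVneq (ev q L) 0) => [->|]; first by rewrite mul0r.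
  rewrite /L mevalM mulf_eq0 negb_or jac_at_unit => /andP[yq].
  rewrite rmorph_prod => /prodf_neq0 Rq.
  have [w wq] := graph_surj q.
  suff -> : ev q (jac u ^+ size G * A - D * Au) = 0 by rewrite mulr0.
  have key (a b x : k) : a * (b * x) - b * (a * x) = 0 by rewrite mulrCA subrr.
  have EA := AP w q wq; rewrite charpoly_y // coefZ in EA.
  have EAu := AuP w q wq; rewrite charpolyE ?coefZ in EAu.
    rewrite mevalB !mevalM; apply: etrans (key (ev q (jac u) ^+ size G)
      (ev q (jac y) ^+ size G) (chi w q)`_s).
    apply: (f_equal2 (fun a b : k => a - b)).
      exact: (f_equal2 *%R (rmorphXn _ _ _) EA).
    exact: (f_equal2 *%R (rmorphXn _ _ _) EAu).
  move=> g gG; apply/matrixP => a l.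
  have entryE (X : 'M[k]_n) : X a l = col l X a 0 by rewrite mxE.
  rewrite entryE [RHS]entryE [in RHS]colE -mulmxA -[in RHS]colE.
  rewrite jac_at_col tnth_mktuple.
  have [Rl _] := RP l.
  rewrite jac_at_col (gradient_transport (graphM wq gG) (uG l) yq Rl) //.
  exact: Rq.
have [c cP] := AD.
have cE v q : graph v q -> jac_at y q \in unitmx -> (chi v q)`_s = ev q c.
  move=> vq yq; have DqN0 : ev q (jac y) ^+ size G != 0.
    by rewrite expf_neq0 // jac_at_unit.
  apply: (mulfI DqN0); rewrite -coefZ -charpoly_y // -(AP v q vq) cP mevalM.
  by rewrite /D rmorphXn.
exists (ev 0 c) => v q vq yq.
(* By homogeneity of degree 0, c is constant on the line through 0 and q. *)
have cline : line 0 q c = (ev q c)%:P.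
  apply/eqP; rewrite -subr_eq0; apply/eqP; apply: (poly_infty char0) => t t0.
  rewrite hornerD hornerN hornerC horner_line add0r.
  rewrite -(cE _ _ (graphZ t0 vq) (jac_at_scale_unit t0 yq)) -(cE _ _ vq yq).
  apply/eqP; rewrite subr_eq0; apply/eqP; congr ((_ : {poly k})`_s).
  by apply: eq_bigr => g _; rewrite -scalemxAl Qmx_scale.
rewrite (cE _ _ vq yq) -[LHS](hornerC _ 0) -cline horner_line.
by rewrite scale0r addr0.
Qed.

Lemma Qmx_entry_algebraic : exists2 nu : {poly k}, nu != 0 &
  forall v q, graph v q -> jac_at y q \in unitmx -> root nu (Qmx v q i j).
Proof.
have [q0 yq0] := ev_neq0 char0 yjac; rewrite jac_at_unit in yq0.
have [v0 vq0] := graph_surj q0.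
exists (chi v0 q0) => [|v q vq yq].
  by apply: monic_neq0; apply: monic_prod_XsubC.
have <- : chi v q = chi v0 q0.
  apply/polyP => s; have [c cP] := Qmx_charpoly_coef s.
  by rewrite (cP v q) ?(cP v0 q0).
rewrite rootE /chi horner_prod (big_rem 1%:M); last exact: (group1M GG).
apply/eqP; apply: etrans (mul0r _); apply: (f_equal2 *%R) => //.
by rewrite hornerXsubC mulmx1 subrr.
Qed.

End Characteristic.

Lemma Qmx_finite : exists s : seq 'M[k]_n,
  forall v q, graph v q -> jac_at y q \in unitmx -> Qmx v q \in s.
Proof.
have root_list i j : exists s : seq k, forall v q, graph v q ->
    jac_at y q \in unitmx -> Qmx v q i j \in s.
  have [nu nuN0 nuP] := Qmx_entry_algebraic i j.
  have [s nuE] := closed_field_poly_normal nu.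
  exists s => v q vq yq; have := nuP v q vq yq.
  by rewrite nuE rootZ ?lead_coef_eq0 // root_prod_XsubC.
have [s sP] := boolp.choice (fun ij : 'I_n * 'I_n => root_list ij.1 ij.2).
pose S := flatten [seq s ij | ij <- enum {: 'I_n * 'I_n}].
exists [seq \matrix_(i, j) ssval (f (i, j)) | f : {ffun 'I_n * 'I_n -> seq_sub S}].
move=> v q vq yq; have inS ij : Qmx v q ij.1 ij.2 \in S.
  apply/flattenP; exists (s ij); last exact: sP.
  by apply/mapP; exists ij; rewrite ?mem_enum.
apply/mapP; exists [ffun ij => SeqSub (inS ij)]; first by rewrite mem_enum.
by apply/matrixP => i j; rewrite [RHS]mxE ffunE.
Qed.

(* [q = v * Q(v, q)] with [Q(v, q)] in a finite set, so by irreducibility of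
   affine space one matrix works for all [v]. *)
Theorem lift_invariant_morphism :
  exists2 g, g \in unitmx & forall b, invariant G b -> act g b = sg b.
Proof.
have [s sP] := Qmx_finite.
apply: boolp.contrapT => nolift.
have bad g : exists b, invariant G b /\ (g \in unitmx -> act g b != sg b).
  apply: boolp.contrapT => H; case: (boolP (g \in unitmx)) => ug; last first.
    by apply: H; exists 0; split; [exact: invariant0|rewrite (negPf ug)].
  apply: nolift; exists g => // b bi; apply/eqP; apply: boolp.contrapT => /negP gb.
  by apply: H; exists b; split.
have [b bP] := boolp.choice bad.
(* Since N(q) = (sg N)(v) for every q related to v, keeping v away from the zeros of the polynomial
   sg N makes [jac y] nonzero at q. *)
pose N := \prod_(g <- G) act g (jac y).
have NN0 : N != 0.
  rewrite prodf_seq_neq0; apply/allP => g gG /=.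
  apply: contraNneq yjac => gy.
  rewrite -(act1 char0 (jac y)) -(mulVmx (group_unit GG gG)) (act_comp char0).
  by rewrite gy rmorph0.
have NI : invariant G N.
  move=> h hG; rewrite /N rmorph_prod /= -[RHS](big_groupMl GG _ _ hG).
  by apply: eq_bigr => g _; apply/esym/(act_comp char0).
have sN0 : sg N != 0.
  case: sgP' => _ _ _ sC' _; apply: contraNneq NN0 => sN.
  by rewrite -(sgK NI) sN -mpolyC0 sC'.
pose L := sg N * jac y * \prod_(g <- s | g \in unitmx) (act g (b g) - sg (b g)).
have LN0 : L != 0.
  rewrite !mulf_neq0 // prodf_seq_neq0; apply/allP => g _; apply/implyP => ug.
  by rewrite subr_eq0; case: (bP g) => _; apply.
have [v] := ev_neq0 char0 LN0.
rewrite !mevalM !mulf_eq0 !negb_or -andbA => /and3P[vN vy].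
rewrite rmorph_prod /= prodf_seq_neq0 => /allP vs.
have [q vq] := graph_total v.
have yq : jac_at y q \in unitmx.
  rewrite -jac_at_unit; move: vN; rewrite -(vq _ NI) rmorph_prod /= prodf_seq_neq0.
  by move/allP/(_ _ (group1M GG)); rewrite /= (act1 char0).
have uQ : Qmx v q \in unitmx.
  by rewrite unitmx_mul unitmx_inv yq -jac_at_unit vy.
have := vs _ (sP v q vq yq); rewrite uQ /= mevalB subr_eq0 ev_act.
by rewrite -(Qmx_point vq yq) vq ?eqxx //; case: (bP (Qmx v q)).
Qed.

End Lifting.

(** * Transcendence degree by counting monomials *)

Section TranscendenceDegree.
Variables (k : fieldType).

Lemma msizeM_leq (n a b : nat) (p q : {mpoly k[n]}) :
  (msize p <= a.+1)%N -> (msize q <= b.+1)%N -> (msize (p * q) <= (a + b).+1)%N.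
Proof.
move=> pa qb; case: (eqVneq p 0) => [->|p0]; first by rewrite mul0r msize0.
case: (eqVneq q 0) => [->|q0]; first by rewrite mulr0 msize0.
rewrite msizeM // -ltnS prednK; last by rewrite addn_gt0 lt0n msize_poly_eq0 p0.
by apply: leq_trans (leq_add pa qb) _; rewrite addSn addnS.
Qed.

Lemma msize_exp_leq (n a e : nat) (p : {mpoly k[n]}) :
  (msize p <= a.+1)%N -> (msize (p ^+ e) <= (a * e).+1)%N.
Proof.
move=> pa; elim: e => [|e IH]; first by rewrite expr0 msize1 muln0.
by rewrite exprS mulnS; apply: msizeM_leq.
Qed.

Lemma msize_prod_leq (n : nat) (I : Type) (r : seq I) (F : I -> {mpoly k[n]}) (e : I -> nat) :
  (forall i, msize (F i) <= (e i).+1)%N ->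
  (msize (\prod_(i <- r) F i) <= (\sum_(i <- r) e i).+1)%N.
Proof.
move=> Fe; elim: r => [|i r IH]; first by rewrite !big_nil msize1.
by rewrite !big_cons; apply: msizeM_leq.
Qed.

(* Counting: the [D ^ r] monomials in [t] with exponents [< D] have degree
   [O(D)], hence live in a space of dimension [O(D ^ n)]. *)
Lemma alg_free_leq (n r : nat) (t : r.-tuple {mpoly k[n]}) :
  (forall f, f \mPo t = 0 -> f = 0) -> (r <= n)%N.
Proof.
move=> tfree; rewrite leqNgt; apply/negP => nr.
pose e := \max_(i < r) msize (tnth t i).
(* M exceeds the degrees that occur. As M <= C D and C^n < D, one gets M^n <= C^n D^n < D^(n+1) <=
   D^r. *)
pose C := (r * e).+1; pose D := (C ^ n).+1; pose M := (r * (e * D)).+1.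
have MD : (M ^ n < D ^ r)%N.
  have MC : (M <= C * D)%N by rewrite /M /C mulSn mulnA addnC -addn1 leq_add2l.
  apply: (@leq_ltn_trans ((C * D) ^ n)); first by case: (posnP n) => [->|n0]; rewrite ?expn0 ?leq_exp2r.
  apply: (@leq_trans (D ^ n.+1)); last by rewrite leq_pexp2l.
  by rewrite expnMn expnS ltn_pmul2r ?expn_gt0.
pose I := {ffun 'I_r -> 'I_D}; pose J := {ffun 'I_n -> 'I_M}.
pose monI (a : I) : 'X_{1..r} := [multinom (a i : nat) | i < r].
pose monJ (b : J) : 'X_{1..n} := [multinom (b i : nat) | i < n].
have monI_inj : injective monI.
  move=> a b /mnmP ab; apply/ffunP => i; apply/val_inj.
  by have := ab i; rewrite !mnmE.
pose A := \matrix_(a < #|I|, b < #|J|) ('X_[monI (enum_val a)] \mPo t)@_(monJ (enum_val b)).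
have : kermx A != 0.
  rewrite -mxrank_eq0 mxrank_ker subn_eq0 -ltnNge.
  by apply: leq_ltn_trans (rank_leq_col A) _; rewrite !card_ffun !card_ord.
case/rowV0Pn => c /sub_kermxP cA cN0.
pose f : {mpoly k[r]} := \sum_a c 0 a *: 'X_[monI (enum_val a)].
have fN0 : f != 0.
  have /rV0Pn[a ca] := cN0; apply: contraNneq ca => f0.
  have := congr1 (mcoeff (monI (enum_val a))) f0.
  rewrite mcoeff0 raddf_sum (bigD1 a) //= mcoeffZ mcoeffX eqxx mulr1.
  rewrite big1 ?addr0 => [->//|b ba]; rewrite mcoeffZ mcoeffX.
  case: eqP => [/monI_inj/enum_val_inj E|]; last by rewrite mulr0.
  by rewrite E eqxx in ba.
case/eqP: fN0; apply: tfree; apply/mpolyP => m; rewrite mcoeff0.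
have -> : (f \mPo t)@_m = \sum_a c 0 a * ('X_[monI (enum_val a)] \mPo t)@_m.
  rewrite /f (raddf_sum (comp_mpoly t)) (raddf_sum (mcoeff m)).
  by apply: eq_bigr => a _ /=; rewrite comp_mpolyZ mcoeffZ.
case: (boolP [forall i, m i < M]%N) => [/forallP mM|].
  pose b : J := [ffun i => Ordinal (mM i)].
  have bm : monJ b = m by apply/mnmP => i; rewrite mnmE ffunE.
  have := congr1 (fun v : 'rV_ _ => v 0 (enum_rank b)) cA.
  rewrite !mxE => E; rewrite -[RHS]E; apply: eq_bigr => a _.
  by rewrite mxE enum_rankK bm.
rewrite negb_forall => /existsP[i]; rewrite -leqNgt => Mi.
apply: big1 => a _; rewrite memN_msupp_eq0 ?mulr0 //; apply: msize_mdeg_ge.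
rewrite comp_mpolyX.
apply: (@leq_trans (\sum_(l < r) e * (monI (enum_val a) l)).+1).
  apply: msize_prod_leq => l; apply: msize_exp_leq.
  by apply: leqW; apply: (leq_bigmax l).
apply: (@leq_trans M); last first.
  by apply: leq_trans Mi _; rewrite mdegE (bigD1 i) //= leq_addr.
rewrite /M ltnS -[X in (X * _)%N](card_ord r) -sum_nat_const; apply: leq_sum => l _.
by rewrite leq_mul2l mnmE (ltnW (ltn_ord _)) orbT.
Qed.

End TranscendenceDegree.

(** * The fibre product *)

(** Replaces positional coefficients by coefficients indexed by the elements of a list without
    repetitions, such as the enumeration of J. *)
Lemma ideal_spanP (R : comNzRingType) (I : eqType) (h : I -> R) (s : seq I) f :
  uniq s ->
  ideal_span [seq h i | i <- s] f <-> exists a : I -> R, f = \sum_(i <- s) a i * h i.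
Proof.
case: s => [|i0 s0]; last set s := i0 :: s0.
  move=> _; split=> [[c ->]|[a ->]].
    by exists (fun=> 0); rewrite big_nil big_ord0.
  by exists (fun=> 0); rewrite big_nil big_ord0.
move=> us; have E (c : nat -> R) : \sum_(l < size [seq h i | i <- s]) c l * [seq h i | i <- s]`_l
    = \sum_(i <- s) c (index i s) * h i.
  rewrite (big_nth i0) big_mkord -(big_mkord xpredT (fun l => c l * [seq h i | i <- s]`_l)).
  rewrite size_map big_mkord; apply: eq_bigr => l _.
  by rewrite index_uniq // (nth_map i0).
split=> [[c ->]|[a ->]].
  pose c' l := if insub l is Some o then c o else 0.
  exists (fun i => c' (index i s)); rewrite -E; apply: eq_bigr => l _.
  by rewrite /c' valK.
exists (fun l => a (nth i0 s l)); rewrite (E (fun l => a (nth i0 s l))).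
by apply: eq_big_seq => i si; rewrite nth_index.
Qed.

Section LinearPart.
Variables (k : fieldType) (char0 : [pchar k] =i pred0).

Definition linear_part (q : nat) (f : {mpoly k[q]}) : 'cV[k]_q := \col_i ev 0 f^`M(i).

Lemma linear_partM (q : nat) (f g : {mpoly k[q]}) :
  linear_part (f * g) = ev 0 f *: linear_part g + ev 0 g *: linear_part f.
Proof.
apply/colP => i; rewrite !mxE mderivM mevalD !mevalM.
by rewrite addrC; congr (_ + _); rewrite mulrC.
Qed.

Lemma linear_part_sum (q : nat) (I : Type) (s : seq I) (P : pred I) (f : I -> {mpoly k[q]}) :
  linear_part (\sum_(i <- s | P i) f i) = \sum_(i <- s | P i) linear_part (f i).
Proof.
apply/colP => i; rewrite summxE mxE mderiv_sum ev_sum.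
by apply: eq_bigr => l _; rewrite mxE.
Qed.

Lemma linear_part_act (q : nat) (g : 'M[k]_q) f : linear_part (act g f) = g *m linear_part f.
Proof. by rewrite /linear_part grad_act mul0mx. Qed.

Lemma linear_partXU (q : nat) (i : 'I_q) : linear_part 'X_i = delta_mx i 0.
Proof.
apply/colP => j; rewrite !mxE mderivXU eqxx andbT.
by case: eqP => _; rewrite ?meval1 ?meval0.
Qed.

Lemma linear_partB (q : nat) (f g : {mpoly k[q]}) :
  linear_part (f - g) = linear_part f - linear_part g.
Proof. by apply/colP => i; rewrite !mxE mderivB mevalB. Qed.

End LinearPart.

Section Setting.
Variables (k : closedFieldType) (char0 : [pchar k] =i pred0) (n : nat).
Variables (G : {fset 'M[k]_n}) (GG : finite_linear_group G).
Variables (m : nat) (d : 'I_m -> nat).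
Hypothesis d_gt0 : forall i, (0 < d i)%N.
Variables (W : {fset 'M[k]_m}) (WG : finite_linear_group W).
Variables (r : nat) (F : r.-tuple {mpoly k[m]}).
Hypothesis F_gen : homogeneous_generators d W F.
Variables (J : {set 'I_r}) (phi : {lrmorphism {mpoly k[m]} -> {mpoly k[n]}}).
Hypothesis phi_iso : fibre_product_iso G d F J phi.

Lemma phi_invariant s : invariant G (phi s).
Proof. by case: phi_iso => H _ _; apply/H; exists s. Qed.

Lemma phi_surj b : invariant G b -> exists s, phi s = b.
Proof. by case: phi_iso => H _ _ /H. Qed.

Lemma phi_kerP f : phi f = 0 <-> exists a : 'I_r -> {mpoly k[m]}, f = \sum_(j in J) a j * tnth F j.
Proof.
case: phi_iso => _ H _; rewrite H ideal_spanP ?enum_uniq //.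
by split=> -[a ->]; exists a; rewrite big_enum.
Qed.

Lemma F_free f : f \mPo F = 0 -> f = 0.
Proof. by case: F_gen => _ H _; apply: H. Qed.

Lemma F_invariantP f : invariant W f <-> exists p, f = p \mPo F.
Proof. by case: F_gen => _ _ H; apply: H. Qed.

Lemma F_invariant j : invariant W (tnth F j).
Proof. by apply/F_invariantP; exists 'X_j; rewrite comp_mpolyU. Qed.

Lemma weight_eq0 (x : 'X_{1..m}) : weight d x = 0%N -> x = 0%MM.
Proof.
move/eqP; rewrite sum_nat_eq0 => /forallP H; apply/mnmP => i; rewrite mnm0E.
by have := H i; rewrite /= muln_eq0 -[d i == 0%N]leqn0 leqNgt d_gt0 => /eqP.
Qed.

(** The weights [d] being positive, a generator of weight 0 would be constant, against algebraic
    independence. *)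
Lemma F_weights : exists e : 'I_r -> nat, forall j,
  (0 < e j)%N /\ {in msupp (tnth F j), forall x, weight d x = e j}.
Proof.
have H j : exists e, (0 < e)%N /\ {in msupp (tnth F j), forall x, weight d x = e}.
  case: F_gen => /(_ j)[e He] _ _; exists e; move/(weighted_homogP char0): He => He.
  split=> //; rewrite lt0n; apply: contraT; rewrite negbK => /eqP e0.
  have FC : tnth F j = ((tnth F j)@_0%MM)%:MP.
    apply/mpolyP => x; rewrite mcoeffC.
    case: eqP => [->|x0]; first by rewrite mulr1.
    rewrite mulr0; apply: memN_msupp_eq0; apply/negP => /He.
    by rewrite e0 => /weight_eq0.
  have /F_free : ('X_j - ((tnth F j)@_0%MM)%:MP) \mPo F = 0.
    by rewrite comp_mpolyB comp_mpolyU comp_mpolyC -FC subrr.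
  move/(congr1 (mcoeff U_(j)%MM)); rewrite mcoeffB mcoeffX eqxx mcoeffC mcoeff0.
  by rewrite mnm1_eq0 mulr0 subr0 => /eqP; rewrite oner_eq0.
by have [e eP] := boolp.choice H; exists e.
Qed.

Lemma F0 j : ev 0 (tnth F j) = 0.
Proof.
have [e eP] := F_weights; have [ej Hj] := eP j.
rewrite mevalE big_seq big1 // => x xF.
have /eqP xN0 : x != 0%MM.
  apply: contraTneq ej => x0; rewrite -(Hj x xF) x0 /weight.
  by rewrite big1 // => i _; rewrite mnm0E muln0.
have [i xi] : exists i, x i != 0%N.
  apply/existsP; apply: contraT; rewrite negb_exists => /forallP H.
  by case: xN0; apply/mnmP => i; rewrite mnm0E; apply/eqP; have := H i; rewrite negbK.
by rewrite (bigD1 i) //= mxE expr0n (negPf xi) mul0r mulr0.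
Qed.

Lemma linear_part_ideal (a : 'I_r -> {mpoly k[m]}) :
  linear_part (\sum_(j in J) a j * tnth F j) =
  \sum_(j in J) ev 0 (a j) *: linear_part (tnth F j).
Proof.
rewrite linear_part_sum; apply: eq_bigr => j _.
by rewrite linear_partM F0 scale0r addr0.
Qed.

Lemma linear_part_kernel_invariant f w : phi f = 0 -> w \in W ->
  w *m linear_part f = linear_part f.
Proof.
move=> /phi_kerP[a ->] wW; rewrite linear_part_ideal mulmx_sumr.
apply: eq_bigr => j _; rewrite -scalemxAr -linear_part_act.
by rewrite F_invariant.
Qed.

Lemma phi_act_kernel f w : phi f = 0 -> w \in W -> phi (act w f) = 0.
Proof.
move=> /phi_kerP[a ->] wW; apply/phi_kerP; exists (fun j => act w (a j)).
rewrite act_sum; apply: eq_bigr => j _.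
by rewrite rmorphM /= [act w (tnth F j)]F_invariant.
Qed.

(** w - 1 maps a linear form to the linear part of an element of the ideal of Z, which is
    W-invariant. So (w - 1)^2 = 0 and w^j = 1 + j (w - 1); finite order forces w = 1 in
    characteristic 0. *)
Lemma faithful w : w \in W -> (forall f, phi (act w f) = phi f) -> w = 1%:M.
Proof.
move=> wW wtriv; pose z := w - 1%:M.
have zz : z *m z = 0.
  apply/matrixP => a i.
  have zi : z *m linear_part 'X_i = linear_part (act w 'X_i - 'X_i).
    by rewrite linear_partB linear_part_act mulmxBl mul1mx.
  have kz : phi (act w 'X_i - 'X_i) = 0 by rewrite rmorphB /= wtriv subrr.
  have : z *m (z *m linear_part 'X_i) = 0.
    by rewrite zi mulmxBl mul1mx (linear_part_kernel_invariant kz wW) subrr.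
  by rewrite mulmxA linear_partXU -colE => /matrixP/(_ a 0); rewrite !mxE.
have [e e0 we] := group_finite_order WG wW.
have wE j : w ^+ j = 1%:M + j%:R *: z.
  elim: j => [|j IH]; first by rewrite expr0 scale0r addr0.
  rewrite exprS IH -[w in LHS](subrK 1%:M) -/z.
  have -> : (z + 1%:M) * (1%:M + j%:R *: z) = (z + 1%:M) *m (1%:M + j%:R *: z) by [].
  rewrite mulmxDl mul1mx mulmxDr mulmx1 -scalemxAr zz scaler0 addr0.
  by rewrite addrCA -[j.+1]addn1 natrD scalerDl scale1r [z + _]addrC.
move: we; rewrite wE => /eqP; rewrite -[X in _ == X]addr0 (inj_eq (addrI _)).
rewrite scaler_eq0 => /orP[|/eqP z0]; last by rewrite -[w](subrK 1%:M) -/z z0 add0r.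
by case: e e0 {wE} => // e _; rewrite (negPf (natr_neq0 char0 e)).
Qed.

Lemma tangent_claim w (v : 'rV[k]_m) : w \in W -> tangent0 (fun f => phi f = 0) (v *m w - v).
Proof.
move=> wW f kf.
have E : (v *m w - v) *m linear_part f = 0.
  by rewrite mulmxBl -mulmxA (linear_part_kernel_invariant kf wW) subrr.
rewrite -[RHS](_ : ((v *m w - v) *m linear_part f) 0 0 = 0); last by rewrite E mxE.
rewrite [RHS]mxE; apply: eq_bigr => i _; rewrite [X in _ = _ * X]mxE; congr (_ * _).
by apply: meval_eq => j; rewrite mxE.
Qed.

Section RestrictedGenerators.

Let p0 := #|~: J|.
Let y0 : p0.-tuple {mpoly k[n]} := [tuple phi (tnth F (enum_val l)) | l < p0].
(* Restriction of functions on [V/W] to [L], with the [F_i], [i \notin J], as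
   coordinates on [L]. *)
Let tau : r.-tuple {mpoly k[p0]} :=
  [tuple if [pick l : 'I_p0 | enum_val l == i] is Some l then 'X_l else 0 | i < r].

Let tau_notinJ l : tnth tau (enum_val l) = 'X_l.
Proof.
rewrite tnth_mktuple; case: pickP => [l' /eqP/enum_val_inj -> //|/(_ l)].
by rewrite eqxx.
Qed.

Let tau_inJ j : j \in J -> tnth tau j = 0.
Proof.
move=> jJ; rewrite tnth_mktuple; case: pickP => // l /eqP jl.
by have := enum_valP l; rewrite jl inE jJ.
Qed.

Let phi_F_inJ j : j \in J -> phi (tnth F j) = 0.
Proof.
move=> jJ; apply/phi_kerP; exists (fun i => (i == j)%:R).
by rewrite (bigD1 j) //= eqxx mul1r big1 ?addr0 // => i /andP[_ /negPf ->]; rewrite mul0r.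
Qed.

(** The fibre square on functions: pulling back to Z from V/W factors through restriction to L. *)
Let phi_compF p : phi (p \mPo F) = (p \mPo tau) \mPo y0.
Proof.
rewrite mpoly_morphE !comp_mpolyA; congr (_ \mPo _); apply: eq_from_tnth => i.
rewrite !tnth_mktuple -mpoly_morphE.
case: pickP => [l /eqP <-|H]; first by rewrite comp_mpolyU tnth_mktuple.
rewrite comp_mpoly0 phi_F_inJ //; apply: contraT => iJ.
have iJ' : i \in ~: J by rewrite inE.
by have := H (enum_rank_in iJ' i); rewrite enum_rankK_in ?eqxx.
Qed.

(** Z dominates L. If f(y0) = 0, then f of the F_i with i outside J lies in the ideal of k[V]
    generated by the F_j. Summing over W puts |W| times it into the ideal that they generate in the
    polynomial ring k[V]^W, where setting the F_j to 0 yields f = 0. *)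
Let y0_free f : f \mPo y0 = 0 -> f = 0.
Proof.
pose Fc : p0.-tuple {mpoly k[m]} := [tuple tnth F (enum_val l) | l < p0].
pose Xc : p0.-tuple {mpoly k[r]} := [tuple 'X_(enum_val l) | l < p0].
have FcE g : g \mPo Fc = (g \mPo Xc) \mPo F.
  rewrite comp_mpolyA; congr (_ \mPo _); apply: eq_from_tnth => l.
  by rewrite !tnth_mktuple comp_mpolyU.
have XcK : (f \mPo Xc) \mPo tau = f.
  rewrite comp_mpolyA -[RHS]comp_mpoly_id; congr (_ \mPo _); apply: eq_from_tnth => l.
  by rewrite !tnth_mktuple comp_mpolyU tau_notinJ.
move=> fy0; have /phi_kerP[a aE] : phi (f \mPo Fc) = 0.
  by rewrite FcE phi_compF XcK fy0.
have [b bE] := boolp.choice (fun j => (proj1 (F_invariantP _)) (transfer_invariant char0 WG (a j))).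
have Fcinv : invariant W (f \mPo Fc) by apply/F_invariantP; exists (f \mPo Xc).
have /F_free : ((size W)%:R *: (f \mPo Xc) - \sum_(j in J) b j * 'X_j) \mPo F = 0.
  rewrite comp_mpolyB comp_mpolyZ -FcE -transfer_id // aE.
  rewrite (raddf_sum (comp_mpoly F)) /transfer.
  under eq_bigr => w _ do rewrite act_sum.
  rewrite exchange_big -sumrB big1 // => j jJ /=.
  rewrite rmorphM /= comp_mpolyU -bE /transfer big_distrl -sumrB big1_seq // => w /andP[_ wW].
  by rewrite rmorphM /= [act w (tnth F j)]F_invariant // subrr.
move/(congr1 (comp_mpoly tau)); rewrite comp_mpoly0 comp_mpolyB comp_mpolyZ XcK.
rewrite (raddf_sum (comp_mpoly tau)) big1 => [|j jJ /=].
  by rewrite subr0 => /eqP; rewrite scaler_eq0 (negPf (group_order_neq0 char0 WG)) => /eqP.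
by rewrite rmorphM /= comp_mpolyU tau_inJ // mulr0.
Qed.

Let y0_gen s : (forall w, w \in W -> phi (act w s) = phi s) -> exists f, phi s = f \mPo y0.
Proof.
move=> sW; have [p pE] := (proj1 (F_invariantP _)) (transfer_invariant char0 WG s).
have : (size W)%:R *: phi s = (p \mPo tau) \mPo y0.
  rewrite -phi_compF -pE /transfer (raddf_sum phi) (eq_big_seq (fun=> phi s)) //.
  by rewrite big_const_seq count_predT iter_addr addr0 scaler_nat.
move=> E; exists ((size W)%:R^-1 *: (p \mPo tau)).
by rewrite comp_mpolyZ -E scalerA mulVf ?scale1r // (group_order_neq0 char0 WG).
Qed.

(** A function s on V is a root of the product of the X - w s over W, whose coefficients are
    polynomials in F; restricted to Z, this is a monic relation over [y0]. *)
Let y0_sep b : invariant G b -> separable_over y0 b.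
Proof.
move=> /phi_surj[s <-]; apply: (separable_of_algebraic char0 y0_free).
pose P := \prod_(w <- W) ('X - (act w s)%:P).
have PI i : invariant W P`_i.
  move=> h hW; suff E : map_poly (act h) P = P.
    by rewrite -[RHS](congr1 (fun p : {poly _} => p`_i) E) coef_map.
  rewrite /P rmorph_prod /= -[RHS](big_groupMl WG _ _ hW); apply: eq_bigr => g _.
  by rewrite rmorphB /= map_polyX map_polyC /= act_comp.
have [q qE] := boolp.choice (fun i => (proj1 (F_invariantP _)) (PI i)).
have sP : size P = (size W).+1 by rewrite size_prod_XsubC.
pose R := \poly_(i < size P) (q i \mPo tau).
have RE i : R`_i \mPo y0 = phi P`_i.
  rewrite coef_poly; case: ltnP => [_|si]; first by rewrite qE phi_compF.
  by rewrite comp_mpoly0 nth_default // rmorph0.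
exists R.
  apply/eqP => R0; have := RE (size W); rewrite R0 coef0 comp_mpoly0.
  have := monic_prod_XsubC W xpredT (fun w => act w s).
  rewrite monicE lead_coefE -/P sP => /eqP -> /esym/eqP.
  by rewrite rmorph1 oner_eq0.
have Ps : P.[s] = 0.
  rewrite horner_prod; under eq_bigr => g _ do rewrite hornerXsubC.
  rewrite (big_rem 1%:M); last exact: (group1M WG).
  by rewrite (act1 char0) subrr; apply: mul0r.
rewrite /eval_rel -[RHS](rmorph0 phi) -Ps -horner_map /=; congr (_.[_]).
by apply/polyP => i; rewrite [LHS]coef_map [RHS]coef_map; apply: RE.
Qed.

(** Algebraic independence of [y0] bounds dim L by dim Z, and the rank of the Jacobian gives the
    converse. *)
Let p0_n : p0 = n.
Proof.
apply/eqP; rewrite eqn_leq (alg_free_leq y0_free) /=.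
exact: (gradients_rank char0 GG y0_sep).
Qed.

Lemma rank_r : r = m.
Proof.
apply/eqP; rewrite eqn_leq (alg_free_leq F_free) /=.
apply: (gradients_rank (G := W) (y := F) char0 WG) => b /F_invariantP[p ->].
exists ('X - p%:P); split; last first.
  by rewrite derivXsubC /eval_rel rmorph1 hornerC oner_neq0.
by rewrite /eval_rel rmorphB /= map_polyX map_polyC hornerXsubC subrr.
Qed.

Lemma card_J : (n + #|J| = m)%N.
Proof. by rewrite -p0_n -rank_r addnC cardsC card_ord. Qed.

Lemma parameters_exist : exists (y : n.-tuple {mpoly k[n]}) (Y : n.-tuple {mpoly k[m]})
    (e : 'I_n -> nat),
  [/\ [/\ forall l, invariant W (tnth Y l), forall l, phi (tnth Y l) = tnth y l
        & forall l, invariant G (tnth y l)],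
      forall l, (0 < e l)%N /\ tnth y l \is (e l).-homog,
      forall b, invariant G b -> separable_over y b,
      jac y != 0 &
      forall s, (forall w, w \in W -> phi (act w s) = phi s) -> exists f, phi s = f \mPo y].
Proof.
have [eF eFP] := F_weights.
have [y [Y [e [H1 H2 H3 H4 [vv H5]]]]] : exists (y : p0.-tuple {mpoly k[n]})
    (Y : p0.-tuple {mpoly k[m]}) (e : 'I_p0 -> nat),
  [/\ [/\ forall l, invariant W (tnth Y l), forall l, phi (tnth Y l) = tnth y l
        & forall l, invariant G (tnth y l)],
      forall l, (0 < e l)%N /\ tnth y l \is (e l).-homog,
      forall b, invariant G b -> separable_over y b,
      forall s, (forall w, w \in W -> phi (act w s) = phi s) -> exists f, phi s = f \mPo y &
      exists v, row_free (\matrix_(i < n, s < p0) ev v (tnth y s)^`M(i))].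
  exists y0, [tuple tnth F (enum_val l) | l < p0], (fun l => eF (enum_val l)).
  split=> //; last exact: (gradients_span char0 GG y0_sep).
    by split=> l; rewrite !tnth_mktuple //; [apply: F_invariant|apply: phi_invariant].
  move=> l; rewrite tnth_mktuple; have [e0 He] := eFP (enum_val l).
  split=> //; apply/dhomogP => x xF; rewrite /= -weight_std; move: x xF.
  apply: (proj1 (weighted_homogP char0 _ _ _)) => t t0.
  case: phi_iso => _ _ <- //; move/(weighted_homogP char0): He => -> //.
  by rewrite linearZ.
(* Transport along p0 = n, after which the Jacobian matrix is square. *)
move: p0_n y Y e H1 H2 H3 H4 H5 => E; rewrite E => y Y e H1 H2 H3 H4 H5.
exists y, Y, e; split=> //.
suff : ev vv (jac y) != 0 by apply: contraNneq => ->; rewrite meval0.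
rewrite jac_at_unit -row_free_unit; move: H5; congr (is_true (row_free _)).
by apply/matrixP => i l; rewrite mxE jac_atE.
Qed.

End RestrictedGenerators.
End Setting.

(** * Reflection groups *)

Section ShephardTodd.
Variables (k : closedFieldType) (char0 : [pchar k] =i pred0) (n : nat).

Lemma dhomog_act (a : nat) (h : 'M[k]_n) f : f \is (a).-homog -> act h f \is (a).-homog.
Proof.
move=> /(dhomog_evP char0) fa; apply/(dhomog_evP char0) => t v t0.
by rewrite !ev_act -scalemxAl fa.
Qed.

Lemma pihomog_act a (h : 'M[k]_n) f :
  pihomog mdeg a (act h f) = act h (pihomog mdeg a f).
Proof.
rewrite {1}(@pihomog_partitionE n k mdeg (maxn (msize f) a).+1 f) //; last first.
  by rewrite leqW // leq_maxl.
rewrite act_sum raddf_sum /=.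
have a_lt : (a < (maxn (msize f) a).+1)%N by rewrite ltnS leq_maxr.
rewrite (bigD1 (Ordinal a_lt)) //= big1 ?addr0.
  by rewrite pihomog_dE //; apply/dhomog_act/pihomogP.
move=> b ba; apply: (pihomog_ne0 (d := b)); last exact/dhomog_act/pihomogP.
by apply: contra ba => /eqP E; apply/eqP/val_inj.
Qed.

Variables (Gam : {fset 'M[k]_n}) (GG : finite_linear_group Gam).
Variables (y : n.-tuple {mpoly k[n]}) (e : 'I_n -> nat).
Hypotheses (yG : forall l, invariant Gam (tnth y l))
           (e_gt0 : forall l, (0 < e l)%N)
           (yhomog : forall l, tnth y l \is (e l).-homog)
           (yjac : jac y != 0)
           (ygen : forall f, invariant Gam f -> exists p, f = p \mPo y).

Let prod_refl (g : 'M[k]_n) := exists2 s : seq 'M[k]_n,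
  forall r, r \in s -> r \in Gam /\ reflection r & g = \prod_(r <- s) r.

Let H : {fset 'M[k]_n} := [fset g in Gam | boolp.asbool (prod_refl g)]%fset.

Let inH g : (g \in H) <-> (g \in Gam /\ prod_refl g).
Proof.
rewrite /H !inE /=; split=> [/andP[gG /boolp.asboolP]|[gG gr]] //.
by apply/andP; split=> //; apply/boolp.asboolP.
Qed.

Let HG : finite_linear_group H.
Proof.
have HM g h : g \in H -> h \in H -> g *m h \in H.
  move=> /inH[gG [s sP gE]] /inH[hG [s' sP' hE]]; apply/inH.
  split; first exact: groupMM; exists (s ++ s').
    by move=> r; rewrite mem_cat => /orP[/sP|/sP'].
  by rewrite big_cat /= -gE -hE.
have H1 : 1%:M \in H.
  by apply/inH; split; [exact: (group1M GG)|exists [::]; rewrite ?big_nil].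
split=> // g gH; last by case/inH: gH => /(group_unit GG).
have [gG _] := (proj1 (inH g)) gH; have [a a0 ga] := group_finite_order GG gG.
suff -> : invmx g = g ^+ a.-1.
  by elim: a.-1 => [|b IH]; rewrite ?expr0 ?exprS //; apply: HM.
have := ga; rewrite -(prednK a0) exprS /= => /(congr1 (mulmx (invmx g))).
by rewrite [X in X = _](mulKmx (group_unit GG gG)) mulmx1 => ->.
Qed.

(** Cramer's rule: for f in k[y] this is [jac y] times the derivative with respect to y_l, and it is
    a polynomial for every f. *)
Let num (f : {mpoly k[n]}) l := \sum_j (\adj (jacmx y)) l j * f^`M(j).

Let num_comp p l : num (p \mPo y) l = jac y * (p^`M(l) \mPo y).
Proof.
rewrite /num; under eq_bigr => j _ do rewrite mderiv_comp big_distrr /=.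
rewrite exchange_big /=.
transitivity (\sum_s (p^`M(s) \mPo y) * ((\adj (jacmx y) *m jacmx y) l s)).
  apply: eq_bigr => s _; rewrite mxE big_distrr; apply: eq_bigr => j _ /=.
  by rewrite [jacmx y j s]mxE; ring.
rewrite mul_adj_mx (bigD1 l) //= big1 ?addr0 => [|s sl].
  by rewrite !mxE eqxx mulr1n mulrC.
by rewrite !mxE eq_sym (negPf sl) mulr0n mulr0.
Qed.

(* Away from a set of codimension 2, the stabilizers in [Gam] are generated by
   reflections, so to any order [f] agrees with an element of [k[y]]. *)
Let deriv_y f : invariant H f -> exists D : 'I_n -> {mpoly k[n]}, forall l, num f l = jac y * D l.
Proof.
move=> fH.
suff E l : exists q, num f l = jac y * q by have [D DP] := boolp.choice E; exists D.
pose bad := [seq g - 1%:M | g <- Gam & (1 < \rank (g - 1%:M)%R)%N].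
apply: (dvd_of_local char0 (bad := bad) (jac_dhomog char0 yhomog e_gt0) yjac).
  by move=> N /mapP[g]; rewrite mem_filter => /andP[gr _] ->.
move=> v vbad M.
have [|f' f'G vf'] := @invariant_jet k char0 n Gam GG v M.+1 f.
  move=> g gG gv; case: (eqVneq g 1%:M) => [->|g1]; first by rewrite act1.
  apply: fH; apply/inH; split=> //; exists [:: g]; last by rewrite big_seq1.
  move=> r; rewrite inE => /eqP ->; split=> //; apply: boolp.contrapT => ngr.
  have /vbad/eqP : g - 1%:M \in bad.
    by apply/mapP; exists g; rewrite // mem_filter (rank_nonreflection GG).
  by apply; rewrite mulmxBr gv mulmx1 subrr.
have [p pE] := ygen f'G.
exists 1, (p^`M(l) \mPo y); rewrite meval1 oner_neq0 mul1r -num_comp -pE; split=> //.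
rewrite /num -sumrB; apply: vanish_sum => j _ _; rewrite -mulrBr -mderivB mulrC.
apply: vanish_mulr; have [_ /(_ j)] := vanishN vf'.
by rewrite opprB.
Qed.

Let gradE f D : (forall l, num f l = jac y * D l) ->
  forall j, f^`M(j) = \sum_l (tnth y l)^`M(j) * D l.
Proof.
move=> fD j; apply: (mulfI yjac); rewrite [RHS]big_distrr /=.
transitivity (\sum_l (jacmx y) j l * num f l); last first.
  by apply: eq_bigr => l _; rewrite fD [jacmx y j l]mxE mulrCA.
transitivity (\sum_s (jacmx y *m \adj (jacmx y)) j s * f^`M(s)).
  rewrite mul_mx_adj (bigD1 j) //= big1 => [|s sj].
    by rewrite addr0 !mxE eqxx mulr1n.
  by rewrite !mxE eq_sym (negPf sj) mulr0n mul0r.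
rewrite /num; under [RHS]eq_bigr => l _ do rewrite big_distrr /=.
rewrite [RHS]exchange_big; apply: eq_bigr => s _ /=; rewrite mxE big_distrl.
by apply: eq_bigr => l _; rewrite mulrA.
Qed.

Let grad_at f D v : (forall l, num f l = jac y * D l) ->
  \col_i ev v f^`M(i) = jac_at y v *m \col_l ev v (D l).
Proof.
move=> fD; apply/colP => j; rewrite mxE (gradE fD) ev_sum mxE.
by apply: eq_bigr => l _; rewrite mevalM -jac_atE [X in _ = _ * X]mxE.
Qed.

(** Under h, the gradients of f and of the y_l are multiplied by the same matrix, so the
    coefficients relating them are invariant wherever [jac y] is nonzero. *)
Let deriv_y_inv f D : invariant H f -> (forall l, num f l = jac y * D l) ->
  forall l, invariant H (D l).
Proof.
move=> fH fD l h hH; have [hG _] := (proj1 (inH h)) hH.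
apply/eqP; rewrite -subr_eq0; apply: contraT => DN0.
have : jac y * (act h (D l) - D l) != 0 by rewrite mulf_neq0.
case/(ev_neq0 char0) => v; rewrite mevalM mevalB mulf_eq0 negb_or jac_at_unit.
case/andP => yv; rewrite ev_act.
have yvh : jac_at y v = h *m jac_at y (v *m h).
  apply/matrixP => i s; have entryE (X : 'M[k]_n) : X i s = col s X i 0 by rewrite mxE.
  rewrite entryE [RHS]entryE [in RHS]colE -mulmxA -[in RHS]colE !jac_at_col -grad_act.
  by rewrite (yG s hG).
have := grad_at v fD; rewrite -(fH h hH) grad_act (grad_at (v *m h) fD) mulmxA -yvh.
move/(congr1 (mulmx (invmx (jac_at y v)))); rewrite !mulKmx //.
by move/colP/(_ l); rewrite !mxE => ->; rewrite subrr eqxx.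
Qed.

(** The subtraction is truncated: a monomial x of D_l satisfies e_l + deg x = a, so D_l is 0 when
    e_l exceeds a. *)
Let deriv_y_homog a f D : f \is (a).-homog -> (forall l, num f l = jac y * D l) ->
  forall l, D l \is (a - e l).-homog.
Proof.
move=> fa fD l; have E t : t != 0 -> t ^+ e l *: act t%:M (D l) = t ^+ a *: D l.
  move=> t0; apply/eqP; rewrite -subr_eq0; apply: contraT => DN0.
  have : jac y * (t ^+ e l *: act t%:M (D l) - t ^+ a *: D l) != 0 by rewrite mulf_neq0.
  case/(ev_neq0 char0) => v; rewrite mevalM mevalB mulf_eq0 negb_or jac_at_unit.
  case/andP => yv; rewrite !mevalZ ev_act_scalar.
  have Et : t *: (\col_i ev (t *: v) f^`M(i)) = t ^+ a *: \col_i ev v f^`M(i).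
    by apply/colP => i; rewrite !mxE (deriv_scalar char0 _ _ t0 fa).
  move: Et; rewrite !(grad_at _ fD) scalemxAl (jac_at_scale char0 yhomog) //.
  rewrite -mulmxA scalemxAr => /(congr1 (mulmx (invmx (jac_at y v)))).
  rewrite !mulKmx // mul_diag_mx => /colP/(_ l); rewrite !mxE => ->.
  by rewrite subrr eqxx.
apply/dhomogP => x xD; have := congr1 (mcoeff x) (E 2%:R (natr_neq0 char0 1)).
rewrite !mcoeffZ -grading_std mcoeff_act_grading mulrA weight_std.
rewrite mcoeff_msupp in xD; move/(mulIf xD); rewrite -exprD -!natrX.
move/(natr_inj char0)/eqP; rewrite eqn_exp2l // => /eqP <-.
by rewrite addKn.
Qed.

(** Euler's identity in the coordinates y: a f is the sum of the e_l y_l D_l, with D_l invariant and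
    of smaller degree. *)
Let poly_in_y a f : f \is (a).-homog -> invariant H f -> exists p, f = p \mPo y.
Proof.
have [b] := ubnP a; elim: b a f => // b IH a f ab fa fH.
case: (posnP a) => [a0|a0].
  exists (f@_0%MM)%:MP; rewrite comp_mpolyC; apply/mpolyP => x; rewrite mcoeffC.
  case: eqP => [->|x0]; first by rewrite mulr1.
  rewrite mulr0; apply: memN_msupp_eq0; apply/negP => xf; case: x0; apply/eqP.
  by rewrite -mdeg_eq0; move/dhomogP: fa => /(_ _ xf) /= ->; rewrite a0.
have [D fD] := deriv_y fH.
have exP l : exists p, D l = p \mPo y.
  apply: (IH (a - e l)%N); [|exact: (deriv_y_homog fa fD)|exact: (deriv_y_inv fH fD)].
  by apply: (@leq_trans a); [rewrite ltn_subrL e_gt0|].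
have [p pE] := boolp.choice exP.
have aN0 : (a%:R : k) != 0 by case: a a0 {ab fa} => // a _; apply: natr_neq0.
exists (a%:R^-1 *: \sum_l (e l)%:R *: (p l * 'X_l)).
rewrite comp_mpolyZ; apply: (scalerI aN0); rewrite scalerA mulfV // scale1r.
rewrite -(euler fa) (raddf_sum (comp_mpoly y)) /=.
under eq_bigr => j _ do rewrite (gradE fD) big_distrr /=.
rewrite exchange_big; apply: eq_bigr => l _ /=.
rewrite comp_mpolyZ rmorphM /= comp_mpolyU -pE scalerAr -(euler (yhomog l)) big_distrr.
by apply: eq_bigr => j _ /=; ring.
Qed.

Theorem reflection_group_of_free_invariants : reflection_group Gam.
Proof.
split=> // g gG; suff /inH[] : g \in H by [].
apply: (mem_of_fix_invariants char0 HG) => f fH.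
have [p ->] : exists p, f = p \mPo y.
  rewrite (@pihomog_partitionE n k mdeg _ f (leqnn (msize f))).
  have exP (l : 'I_(msize f)) : exists p, pihomog mdeg l f = p \mPo y.
    apply: (@poly_in_y l); first exact: pihomogP.
    by move=> h hH; rewrite -pihomog_act fH.
  have [p pE] := boolp.choice exP.
  exists (\sum_l p l); rewrite (raddf_sum (comp_mpoly y)); apply: eq_bigr => l _.
  exact: pE.
exact: invariant_comp.
Qed.

End ShephardTodd.

(** * The group of lifts of W *)

Section Extension.
Variables (k : closedFieldType) (char0 : [pchar k] =i pred0) (n : nat).
Variables (G : {fset 'M[k]_n}) (GG : finite_linear_group G).
Hypothesis G_norefl : forall g, g \in G -> ~ reflection g.
Variables (m : nat) (d : 'I_m -> nat).
Hypothesis d_gt0 : forall i, (0 < d i)%N.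
Variables (W : {fset 'M[k]_m}) (WG : finite_linear_group W).
Hypothesis W_graded : forall w (t : k), w \in W -> t != 0 ->
  w *m grading_mx d t = grading_mx d t *m w.
Variables (r : nat) (F : r.-tuple {mpoly k[m]}).
Hypothesis F_gen : homogeneous_generators d W F.
Variables (J : {set 'I_r}) (phi : {lrmorphism {mpoly k[m]} -> {mpoly k[n]}}).
Hypothesis phi_iso : fibre_product_iso G d F J phi.

Definition lifts (g : 'M[k]_n) (w : 'M[k]_m) := forall s, act g (phi s) = phi (act w s).

Lemma lifts1 g : g \in G -> lifts g 1%:M.
Proof. by move=> gG s; rewrite act1 // (phi_invariant phi_iso). Qed.

Lemma liftsM g h w v : lifts g w -> lifts h v -> lifts (g *m h) (w *m v).
Proof. by move=> gw hv s; rewrite act_comp // hv gw -act_comp. Qed.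

Lemma liftsV g w : g \in unitmx -> w \in W -> lifts g w -> lifts (invmx g) (invmx w).
Proof.
move=> ug wW gw s; have uw := group_unit WG wW.
have -> : phi s = phi (act w (act (invmx w) s)) by rewrite -act_comp // mulmxV // act1.
by rewrite -gw -act_comp // mulVmx // act1.
Qed.

Lemma lifts1_mem g : lifts g 1%:M -> g \in G.
Proof.
move=> g1; apply: (mem_of_fix_invariants char0 GG) => b /(phi_surj phi_iso)[s <-].
by rewrite g1 act1.
Qed.

(** Elements with a common lift act alike on Z, where W acts faithfully. *)
Lemma lifts_inj g w v : w \in W -> v \in W -> lifts g w -> lifts g v -> w = v.
Proof.
move=> wW vW gw gv; have uv := group_unit WG vW.
have : invmx v *m w = 1%:M.
  apply: (faithful char0 d_gt0 WG F_gen phi_iso) => [|s].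
    by apply: groupMM => //; apply: groupVM.
  apply/eqP; rewrite -subr_eq0 -rmorphB /=; apply/eqP.
  have -> : act (invmx v *m w) s - s = act (invmx v) (act w s - act v s).
    by rewrite rmorphB /= -!act_comp // mulVmx // act1.
  apply: (phi_act_kernel F_gen phi_iso); last exact: groupVM.
  by rewrite rmorphB /= -gw -gv subrr.
by move/(congr1 (mulmx v)); rewrite mulKVmx // mulmx1.
Qed.

Lemma phi_act_grading t s : t != 0 -> phi (act (grading_mx d t) s) = act t%:M (phi s).
Proof. by move=> t0; case: phi_iso => _ _ -> //; rewrite grading_std. Qed.

(** w induces an automorphism of B^G through any section of phi, because W preserves the ideal of Z.
    It fixes [y], which comes from W-invariant functions, so the lifting theorem applies. *)
Lemma lift_exists w : w \in W -> exists2 g, g \in unitmx & lifts g w.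
Proof.
move=> wW; have [y [Y [e [[YW Yy yG] ye ysep yjac _]]]] :=
  parameters_exist char0 GG d_gt0 WG F_gen phi_iso.
have secE b : exists s, invariant G b -> phi s = b.
  case: (boolp.EM (invariant G b)) => [/(phi_surj phi_iso)[s <-]|nb]; first by exists s.
  by exists 0.
have [sec secP] := boolp.choice secE.
pose sg v b := phi (act v (sec b)).
have sgE v s : v \in W -> sg v (phi s) = phi (act v s).
  move=> vW; apply/eqP; rewrite -subr_eq0 /sg -rmorphB -rmorphB /=; apply/eqP.
  apply: (phi_act_kernel F_gen phi_iso) => //.
  by rewrite rmorphB /= secP ?subrr //; apply: (phi_invariant phi_iso).
have sgP v : v \in W -> invariant_morphism G (sg v).
  move=> vW; split=> [a _|a b|a b|c|t a t0].
  - exact: (phi_invariant phi_iso).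
  - move=> /(phi_surj phi_iso)[s <-] /(phi_surj phi_iso)[s' <-].
    by rewrite -rmorphD /= !sgE // rmorphD /= rmorphD.
  - move=> /(phi_surj phi_iso)[s <-] /(phi_surj phi_iso)[s' <-].
    by rewrite -rmorphM /= !sgE // rmorphM /= rmorphM.
  - have phiC : phi c%:MP = c%:MP by rewrite mpoly_morphE comp_mpolyC.
    by rewrite -{1}phiC sgE // actC phiC.
  move=> /(phi_surj phi_iso)[s <-].
  by rewrite -phi_act_grading // !sgE // -act_comp // W_graded // act_comp // phi_act_grading.
have wV := groupVM WG wW; have uw := group_unit WG wW.
have [| | | | |g ug gP] := @lift_invariant_morphism k char0 n G GG (sg w) (sg (invmx w))
  (sgP w wW) (sgP _ wV) _ _ G_norefl y e yG _ _ yjac _ ysep.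
- by move=> a /(phi_surj phi_iso)[s <-]; rewrite !sgE // -act_comp // mulVmx // act1.
- by move=> a /(phi_surj phi_iso)[s <-]; rewrite !sgE // -act_comp // mulmxV // act1.
- by move=> l; case: (ye l).
- by move=> l; case: (ye l).
- by move=> l; rewrite -Yy sgE // YW.
by exists g => // s; rewrite gP ?sgE //; apply: (phi_invariant phi_iso).
Qed.

Lemma quotient_lifts (Wt : {fset 'M[k]_n}) : quotient_is G Wt W phi ->
  (forall g, g \in Wt -> exists2 w, w \in W & lifts g w) /\
  (forall w, w \in W -> exists2 g, g \in Wt & lifts g w).
Proof.
case=> pi [piW _ piS _ piA]; split=> [g gWt|w wW].
  by exists (pi g); [exact: piW|move=> s; rewrite piA].
by have [g gWt <-] := piS w wW; exists g => // s; rewrite piA.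
Qed.

(** Two lifts of the same w differ by an element of G, so such a group is the set of all lifts of
    elements of W. *)
Theorem extension_unique (Wt Wt' : {fset 'M[k]_n}) :
  finite_linear_group Wt -> normal_in G Wt -> quotient_is G Wt W phi ->
  finite_linear_group Wt' -> normal_in G Wt' -> quotient_is G Wt' W phi ->
  Wt = Wt'.
Proof.
suff sub (X X' : {fset 'M[k]_n}) : finite_linear_group X -> quotient_is G X W phi ->
    finite_linear_group X' -> normal_in G X' -> quotient_is G X' W phi ->
    {subset X <= X'}.
  move=> g1 n1 q1 g2 n2 q2; apply/fsetP => g.
  by apply/idP/idP; apply: sub.
move=> XG qX XG' [GX' _] qX' g gX.
have [w wW gw] := (proj1 (quotient_lifts qX)) g gX.
have [h hX' hw] := (proj2 (quotient_lifts qX')) w wW.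
have uh := group_unit XG' hX'.
have hg : invmx h *m g \in G.
  apply: lifts1_mem; rewrite -(mulVmx (group_unit WG wW)).
  by apply: liftsM => //; apply: liftsV.
by rewrite -(mulKVmx uh g); apply: (groupMM XG' hX'); apply: GX'.
Qed.

Theorem extension_exists : exists Wt : {fset 'M[k]_n},
  [/\ reflection_group Wt, normal_in G Wt & quotient_is G Wt W phi].
Proof.
have liftE w : exists g, w \in W -> g \in unitmx /\ lifts g w.
  case: (boolP (w \in W)) => [/lift_exists[g ug gw]|nw]; first by exists g.
  by exists 0.
have [lw lwP] := boolp.choice liftE.
(* One chosen lift for each element of W, times G: this enumeration shows finiteness, while [inWt]
   is the description used afterwards. *)
pose Wt : {fset 'M[k]_n} := seq_fset tt [seq lw w *m h | w <- W, h <- G].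
have inWt g : g \in Wt <-> exists2 w, w \in W & lifts g w.
  rewrite seq_fsetE; split=> [/allpairsP[[w h] /= [wW hG ->]]|[w wW gw]].
    exists w => //; rewrite -[w]mulmx1; apply: liftsM; last exact: lifts1.
    by case: (lwP w wW) => _; rewrite mulmx1.
  have [uw lww] := lwP w wW.
  apply/allpairsP; exists (w, invmx (lw w) *m g); split=> //=; last by rewrite mulKVmx.
  apply: lifts1_mem; rewrite -(mulVmx (group_unit WG wW)).
  by apply: liftsM => //; apply: liftsV.
have Wt_unit g : g \in Wt -> g \in unitmx.
  rewrite seq_fsetE => /allpairsP[[w h] /= [wW hG ->]].
  by rewrite unitmx_mul (group_unit GG hG) andbT; case: (lwP w wW).
have WtG : finite_linear_group Wt.
  split=> // [|g h /inWt[w wW gw] /inWt[v vW hv]|g gWt].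
  - by apply/inWt; exists 1%:M; [exact: (group1M WG)|apply/lifts1/(group1M GG)].
  - by apply/inWt; exists (w *m v); [exact: (groupMM WG)|exact: liftsM].
  have [w wW gw] := (proj1 (inWt g)) gWt.
  by apply/inWt; exists (invmx w); [exact: (groupVM WG)|apply: liftsV => //; apply: Wt_unit].
have GWt g : g \in G -> g \in Wt.
  by move=> gG; apply/inWt; exists 1%:M; [exact: (group1M WG)|exact: lifts1].
exists Wt; split.
- have [y [Y [e [[YW Yy yG] ye ysep yjac ygen]]]] :=
    parameters_exist char0 GG d_gt0 WG F_gen phi_iso.
  apply: (reflection_group_of_free_invariants char0 WtG (y := y) (e := e)) => //.
  + by move=> l g /inWt[w wW gw]; rewrite -Yy gw YW.
  + by move=> l; case: (ye l).
  + by move=> l; case: (ye l).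
  move=> f fWt; have [s sf] : exists s, phi s = f.
    by apply: (phi_surj phi_iso) => g /GWt; apply: fWt.
  rewrite -sf; apply: ygen => w wW.
  have [g gWt gw] : exists2 g, g \in Wt & lifts g w.
    have [_ lww] := lwP w wW; exists (lw w) => //.
    by apply/inWt; exists w.
  by rewrite -gw sf fWt.
- split=> // h hWt; have uh := Wt_unit h hWt; split=> // x.
  have [w wW hw] := (proj1 (inWt h)) hWt; have uw := group_unit WG wW.
  apply/idP/idP => [xG|/lifts1 x1]; last first.
    apply: lifts1_mem; rewrite -(mulVmx uw) -[invmx w]mulmx1.
    exact: (liftsM (liftsM (liftsV uh wW hw) x1) hw).
  rewrite (_ : x = h *m (invmx h *m x *m h) *m invmx h); last first.
    by rewrite !mulmxA mulmxV // mul1mx -mulmxA mulmxV // mulmx1.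
  apply: lifts1_mem; rewrite -(mulmxV uw) -[X in X *m invmx w]mulmx1.
  exact: (liftsM (liftsM hw (lifts1 xG)) (liftsV uh wW hw)).
have piE g : exists w, g \in Wt -> w \in W /\ lifts g w.
  case: (boolP (g \in Wt)) => [/inWt[w wW gw]|ng]; first by exists w.
  by exists 0.
have [pi piP] := boolp.choice piE; exists pi; split=> [g gWt|g h gWt hWt|w wW|g gWt|g f gWt].
- by case: (piP g gWt).
- have [gW gl] := piP g gWt; have [hW hl] := piP h hWt.
  have [ghW ghl] := piP _ (groupMM WtG gWt hWt).
  apply: (lifts_inj ghW _ ghl); first exact: (groupMM WG).
  exact: liftsM.
- have [_ lww] := lwP w wW; have gWt : lw w \in Wt by apply/inWt; exists w.
  by exists (lw w) => //; have [pW pl] := piP _ gWt; apply: (lifts_inj pW wW pl).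
- have [pW pl] := piP g gWt; apply/eqP/idP => [E|gG].
    by apply: lifts1_mem; rewrite -E.
  exact: (lifts_inj pW (group1M WG) pl (lifts1 gG)).
by have [pW pl] := piP g gWt; rewrite pl.
Qed.

End Extension.

(** * Goodness *)

Section WeightedHomogeneity.
Variables (k : fieldType) (char0 : [pchar k] =i pred0).

Lemma weight0 (n : nat) (d : 'I_n -> nat) : weight d 0%MM = 0%N.
Proof. by apply: big1 => i _; rewrite mnm0E muln0. Qed.

Lemma weightD (n : nat) (d : 'I_n -> nat) :
  {morph weight d : x z / (x + z)%MM >-> (x + z)%N}.
Proof.
by move=> x z; rewrite -big_split; apply: eq_bigr => i _; rewrite mnmDE mulnDr.
Qed.

HB.instance Definition _ n d := isMeasure.Build n (@weight n d) (weight0 d) (@weightD n d).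

Lemma weightU (n : nat) (d : 'I_n -> nat) i : weight d U_(i)%MM = d i.
Proof.
rewrite /weight (bigD1 i) //= big1 ?addn0 => [|j ji]; first by rewrite mnm1E eqxx muln1.
by rewrite mnm1E eq_sym (negPf ji) muln0.
Qed.

Lemma weight_homogP (n : nat) (d : 'I_n -> nat) D (f : {mpoly k[n]}) :
  {in msupp f, forall x, weight d x = D} <-> f \is D.-homog for (weight d).
Proof. by split=> [H|/dhomogP H]; [apply/dhomogP|]. Qed.

Lemma comp_dhomog (q n : nat) (mf : measure q) (mf' : measure n)
    (t : q.-tuple {mpoly k[n]}) D p :
  (forall i, tnth t i \is (mf U_(i)%MM).-homog for mf') ->
  p \is D.-homog for mf -> p \mPo t \is D.-homog for mf'.
Proof.
move=> th /dhomogP pD; rewrite comp_mpolyEX big_seq; apply: rpred_sum => x xp.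
apply: rpredZ; rewrite comp_mpolyX -(pD x xp) (mfE mf x).
rewrite -[index_enum _]/(index_enum _); elim: (index_enum _) => [|i s IH].
  by rewrite !big_nil; apply: dhomog1.
rewrite !big_cons; apply: dhomogM => //; rewrite mulnC; exact: dhomogMn.
Qed.

Lemma pihomog_sum_homog (n : nat) (mf : measure n) K (h : nat -> {mpoly k[n]}) D :
  (forall a, h a \is (a).-homog for mf) -> (D < K)%N ->
  pihomog mf D (\sum_(a < K) h a) = h D.
Proof.
move=> hh DK; rewrite raddf_sum /= (bigD1 (Ordinal DK)) //= big1 ?addr0.
  by rewrite pihomog_dE.
by move=> b bD; apply: (pihomog_ne0 (d := b)).
Qed.

Lemma pihomog_partition_geq (n : nat) (mf : measure n) D (p : {mpoly k[n]}) :
  exists2 K, (D < K)%N & p = \sum_(a < K) pihomog mf a p.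
Proof.
exists (maxn (mmeasure mf p) D).+1; first by rewrite ltnS leq_maxr.
by apply: pihomog_partitionE; rewrite leqW // leq_maxl.
Qed.

Lemma pihomog_comp (q n : nat) (mf : measure q) (mf' : measure n)
    (t : q.-tuple {mpoly k[n]}) D p :
  (forall i, tnth t i \is (mf U_(i)%MM).-homog for mf') ->
  pihomog mf' D (p \mPo t) = pihomog mf D p \mPo t.
Proof.
move=> th; have [K DK pE] := pihomog_partition_geq mf D p.
rewrite {1}pE (raddf_sum (comp_mpoly t)).
apply: (pihomog_sum_homog (h := fun a => pihomog mf a p \mPo t)) => // a.
by apply: (comp_dhomog th); apply: pihomogP.
Qed.

Lemma pihomogM (n : nat) (mf : measure n) D (p q : {mpoly k[n]}) :
  pihomog mf D (p * q) = \sum_(a < D.+1) pihomog mf a p * pihomog mf (D - a) q.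
Proof.
have [K DK pE] := pihomog_partition_geq mf D p.
rewrite {1}pE big_distrl raddf_sum /=.
have E (a : nat) : pihomog mf D (pihomog mf a p * q) =
    if (a <= D)%N then pihomog mf a p * pihomog mf (D - a) q else 0.
  have [L DL qE] := pihomog_partition_geq mf D q.
  rewrite {1}qE big_distrr raddf_sum /=.
  have H (b : nat) : pihomog mf D (pihomog mf a p * pihomog mf b q) =
      if (a + b == D)%N then pihomog mf a p * pihomog mf b q else 0.
    have hab : pihomog mf a p * pihomog mf b q \is (a + b).-homog for mf.
      by apply: dhomogM; apply: pihomogP.
    case: eqP => [<-|ab]; first by rewrite pihomog_dE.
    by apply: (pihomog_ne0 (d := (a + b)%N)) => //; apply/eqP.
  under eq_bigr => b _ do rewrite H.
  case: leqP => aD; last first.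
    apply: big1 => b _; case: eqP => // E; move: aD.
    by rewrite -E ltnNge leq_addr.
  have bL : (D - a < L)%N by apply: leq_ltn_trans (leq_subr _ _) DL.
  rewrite (bigD1 (Ordinal bL)) //= subnKC // eqxx big1 ?addr0 // => b bN.
  case: (a + b =P D)%N => // abD; case/eqP: bN; apply/val_inj => /=.
  by rewrite -abD addKn.
under eq_bigr => a _ do rewrite E.
rewrite (big_ord_widen K (fun a => pihomog mf a p * pihomog mf (D - a) q)) //.
by rewrite [RHS]big_mkcond.
Qed.

End WeightedHomogeneity.

Lemma mulrB_telescope (R : comPzRingType) (a a' b b' : R) :
  a' * b' - a * b = b' * (a' - a) + a * (b' - b).
Proof. by rewrite !mulrBr ![b' * _]mulrC addrA subrK. Qed.

Section LowOrder.
Variables (k : fieldType).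

Lemma mcoeff0_ev (n : nat) (p : {mpoly k[n]}) : p@_0%MM = ev 0 p.
Proof.
elim/mpoly_ring_ind: p => [c|i|p q pE qE|p q pE qE].
- by rewrite mcoeffC eqxx mulr1 mevalC.
- by rewrite mcoeffX mnm1_eq0 mevalXU mxE.
- by rewrite mcoeffD mevalD pE qE.
by rewrite mevalM -pE -qE; apply: (rmorphM (mcoeff 0%MM)).
Qed.

Lemma linear_part_coeff (n : nat) (p : {mpoly k[n]}) i : linear_part p i 0 = p@_U_(i)%MM.
Proof. by rewrite mxE -mcoeff0_ev mcoeff_deriv mnm0E add0m mulr1n. Qed.

Lemma ev0_mpolyX (n : nat) (x : 'X_{1..n}) : x != 0%MM -> ev 0 ('X_[x] : {mpoly k[n]}) = 0.
Proof. by move=> x0; rewrite -mcoeff0_ev mcoeffX (negPf x0). Qed.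

Lemma quadratic_decomposition (n : nat) (f : {mpoly k[n]}) :
  ev 0 f = 0 -> linear_part f = 0 ->
  exists2 s : seq ({mpoly k[n]} * {mpoly k[n]}),
    forall x, x \in s -> ev 0 x.1 = 0 /\ ev 0 x.2 = 0 & f = \sum_(x <- s) x.1 * x.2.
Proof.
move=> f0 lf.
have H (m : 'X_{1..n}) : exists x : {mpoly k[n]} * {mpoly k[n]}, m \in msupp f ->
    [/\ ev 0 x.1 = 0, ev 0 x.2 = 0 & f@_m *: 'X_[m] = x.1 * x.2].
  case: (boolP (m \in msupp f)) => [mf|_]; last by exists (0, 0).
  have mN0 : m != 0%MM.
    by apply: contraTneq mf => ->; rewrite mcoeff_msupp mcoeff0_ev f0 eqxx.
  have [i mi] : exists i, m i != 0%N.
    apply/existsP; apply: contraNT mN0; rewrite negb_exists => /forallP H.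
    by apply/eqP/mnmP => i; rewrite mnm0E; apply/eqP; have := H i; rewrite negbK.
  have mE : (m - U_(i) + U_(i))%MM = m by rewrite submK // lep1mP.
  exists (f@_m *: 'X_[m - U_(i)], 'X_i) => _ /=; split.
  - rewrite mevalZ ev0_mpolyX ?mulr0 //; apply: contraTneq mf => m1.
    by rewrite -mE m1 add0m mcoeff_msupp -linear_part_coeff lf mxE eqxx.
  - by rewrite mevalXU mxE.
  by rewrite -scalerAl -mpolyXD mE.
have [g gP] := boolp.choice H; exists [seq g m | m <- msupp f].
  by move=> _ /mapP[m mf ->]; case: (gP m mf).
rewrite big_map {1}(mpolyE f); apply: eq_big_seq => m mf.
by case: (gP m mf).
Qed.

Section IdealMul.
Variables (q : nat) (T : pzRingType) (psi : {rmorphism {mpoly k[q]} -> T}).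
(** [psi] is arbitrary because two presentations of B^G are used: [comp_mpoly u] from A and [phi]
    from k[V]. *)
Let AI := ideal_mul (@mplus k q) (fun p => psi p = 0).

Lemma ideal_mul_gen a b : ev 0 a = 0 -> psi b = 0 -> AI (a * b).
Proof.
move=> a0 b0; exists [:: (a, b)]; last by rewrite big_seq1.
by move=> x; rewrite inE => /eqP ->; split=> //; rewrite /mplus mcoeff0_ev.
Qed.

Lemma ideal_mul0 : AI 0.
Proof. by exists [::]; rewrite ?big_nil. Qed.

Lemma ideal_mulD a b : AI a -> AI b -> AI (a + b).
Proof.
move=> [s sP ->] [s' sP' ->]; exists (s ++ s'); last by rewrite big_cat.
by move=> x; rewrite mem_cat => /orP[/sP|/sP'].
Qed.

Lemma ideal_mulMl c a : AI a -> AI (c * a).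
Proof.
move=> [s sP ->]; exists [seq (c * x.1, x.2) | x <- s].
  move=> _ /mapP[x xs ->] /=; have [x1 x2] := sP x xs; split=> //.
  by move: x1; rewrite /mplus !mcoeff0_ev mevalM => ->; rewrite mulr0.
by rewrite big_map big_distrr; apply: eq_bigr => x _ /=; rewrite mulrA.
Qed.

Lemma ideal_mulN a : AI a -> AI (- a).
Proof. by rewrite -mulN1r; apply: ideal_mulMl. Qed.

Lemma ideal_mulB a b : AI a -> AI b -> AI (a - b).
Proof. by move=> Aa Ab; apply/ideal_mulD/ideal_mulN. Qed.

Lemma ideal_mul_sum (I : eqType) (r : seq I) (P : pred I) f :
  (forall i, i \in r -> P i -> AI (f i)) -> AI (\sum_(i <- r | P i) f i).
Proof.
move=> H; rewrite big_seq_cond; apply: (big_ind AI) => [||i /andP[]].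
- exact: ideal_mul0.
- exact: ideal_mulD.
exact: H.
Qed.

(* Substituting tuples that agree modulo the kernel: the linear part is the only
   obstruction to agreement modulo [A_+ I]. *)
Lemma comp_perturb (p : nat) (f : {mpoly k[p]}) (t t' : p.-tuple {mpoly k[q]}) :
  linear_part f = 0 -> (forall i, ev 0 (tnth t i) = 0) ->
  (forall i, ev 0 (tnth t' i) = 0) ->
  (forall i, psi (tnth t' i) = psi (tnth t i)) ->
  AI ((f \mPo t') - (f \mPo t)).
Proof.
move=> lf t0 t0' tt'.
have pt0 (z : p.-tuple {mpoly k[q]}) : (forall i, ev 0 (tnth z i) = 0) -> pt z 0 = 0.
  by move=> z0; apply/rowP => i; rewrite !mxE z0.
have psiE g : psi ((g \mPo t') - (g \mPo t)) = 0.
  rewrite rmorphB; apply/eqP; rewrite subr_eq0; apply/eqP.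
  elim/mpoly_ring_ind: g => [c|i|g h gE hE|g h gE hE].
  - by rewrite !comp_mpolyC.
  - by rewrite !comp_mpolyU tt'.
  - by rewrite !comp_mpolyD [LHS]rmorphD [RHS]rmorphD; exact: (f_equal2 +%R gE hE).
  have cM (z : p.-tuple {mpoly k[q]}) : (g * h) \mPo z = (g \mPo z) * (h \mPo z).
    exact: rmorphM.
  by rewrite !cM [LHS]rmorphM [RHS]rmorphM; exact: (f_equal2 *%R gE hE).
have f0 : ev 0 (f - (ev 0 f)%:MP) = 0 by rewrite mevalB mevalC subrr.
have lf0 : linear_part (f - (ev 0 f)%:MP) = 0.
  rewrite linear_partB lf sub0r; apply/eqP; rewrite oppr_eq0; apply/eqP/colP => i.
  by rewrite !mxE mderivC meval0.
have [s sP sE] := quadratic_decomposition f0 lf0.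
have -> : (f \mPo t') - (f \mPo t) = \sum_(x <- s)
    ((x.2 \mPo t') * ((x.1 \mPo t') - (x.1 \mPo t)) + (x.1 \mPo t) * ((x.2 \mPo t') - (x.2 \mPo t))).
  have cE (z : p.-tuple {mpoly k[q]}) : f \mPo z = (ev 0 f)%:MP + \sum_(x <- s) (x.1 \mPo z) * (x.2 \mPo z).
    rewrite -{1}[f](subrK (ev 0 f)%:MP) sE addrC comp_mpolyD comp_mpolyC.
    congr (_ + _); rewrite (raddf_sum (comp_mpoly z)).
    by apply: eq_bigr => x _; apply: rmorphM.
  rewrite !cE opprD addrACA subrr add0r -sumrB; apply: eq_bigr => x _.
  exact: mulrB_telescope.
apply: ideal_mul_sum => x xs _; have [x1 x2] := sP x xs.
by apply: ideal_mulD; apply: ideal_mul_gen => //; rewrite ev_comp pt0.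
Qed.

End IdealMul.
End LowOrder.

Lemma mcoeff_pihomog (k : fieldType) (n : nat) (mf : measure n) D (p : {mpoly k[n]}) x :
  (pihomog mf D p)@_x = if mf x == D then p@_x else 0.
Proof.
have [K xK pE] := pihomog_partition_geq mf (mf x) p.
have px : p@_x = (pihomog mf (mf x) p)@_x.
  rewrite {1}pE raddf_sum /= (bigD1 (Ordinal xK)) //= big1 ?addr0 // => a ax.
  apply: (dhomog_nemf_coeff (pihomogP mf a p)).
  by apply: contra ax => /eqP E; apply/eqP/val_inj.
case: eqP => [<-|/eqP xD]; first by rewrite px.
exact: dhomog_nemf_coeff (pihomogP _ _ _) xD.
Qed.

Lemma dhomog0_const (k : fieldType) (n : nat) (f : {mpoly k[n]}) :
  f \is 0.-homog -> f = (ev 0 f)%:MP.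
Proof.
move=> /dhomogP f0; apply/mpolyP => x; rewrite mcoeffC -mcoeff0_ev.
case: eqP => [->|x0]; first by rewrite mulr1.
rewrite mulr0; apply: memN_msupp_eq0; apply/negP => /f0 /= /eqP.
by rewrite mdeg_eq0 => /eqP.
Qed.

Lemma dhomog_ev0 (k : fieldType) (n D : nat) (f : {mpoly k[n]}) :
  (0 < D)%N -> f \is D.-homog -> ev 0 f = 0.
Proof.
move=> D0 fD; rewrite -mcoeff0_ev; apply: (dhomog_nemf_coeff fD).
by rewrite /= mdeg0 eq_sym -lt0n.
Qed.

Lemma dhomogC_weight (k : fieldType) (n : nat) (mf : measure n) (c : k) :
  (c%:MP : {mpoly k[n]}) \is 0.-homog for mf.
Proof. by rewrite -[_%:MP]mulr1 mul_mpolyC; apply/dhomogZ/dhomog1. Qed.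

Lemma linear_partD (k : fieldType) (q : nat) (f g : {mpoly k[q]}) :
  linear_part (f + g) = linear_part f + linear_part g.
Proof. by apply/colP => i; rewrite !mxE mderivD mevalD. Qed.

Lemma linear_part0 (k : fieldType) (q : nat) : linear_part (0 : {mpoly k[q]}) = 0.
Proof. by apply/colP => i; rewrite !mxE mderiv0 meval0. Qed.

Lemma linear_part_linear (k : fieldType) (q : nat) (v : 'I_q -> k) :
  linear_part (\sum_i v i *: 'X_i) = \col_i v i.
Proof.
rewrite linear_part_sum; apply/colP => i; rewrite summxE (bigD1 i) //= big1 ?addr0 => [|j ji].
  by rewrite !mxE mderivZ mevalZ mderivXU eqxx meval1 mulr1.
by rewrite mxE mderivZ mevalZ mderivXU eq_sym (negPf ji) meval0 mulr0.
Qed.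

Lemma ev0_linear (k : fieldType) (q : nat) (v : 'I_q -> k) :
  ev 0 (\sum_i v i *: 'X_i) = 0.
Proof. by rewrite ev_sum big1 // => i _; rewrite mevalZ mevalXU mxE mulr0. Qed.

Section Decomposables.
Variables (k : fieldType) (n : nat) (G : {fset 'M[k]_n}).

Let D2 := ideal_mul (inv_plus G) (inv_plus G).

Lemma inv_plusE f : inv_plus G f <-> invariant G f /\ ev 0 f = 0.
Proof. by rewrite /inv_plus /mplus mcoeff0_ev. Qed.

Lemma decomposableD a b : D2 a -> D2 b -> D2 (a + b).
Proof.
move=> [s sP ->] [s' sP' ->]; exists (s ++ s'); last by rewrite big_cat.
by move=> x; rewrite mem_cat => /orP[/sP|/sP'].
Qed.

Lemma decomposableZ c a : D2 a -> D2 (c *: a).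
Proof.
move=> [s sP ->]; exists [seq (c *: x.1, x.2) | x <- s].
  move=> _ /mapP[x xs ->] /=; have [/inv_plusE[xi x0] x2] := sP x xs; split=> //.
  by apply/inv_plusE; rewrite mevalZ x0 mulr0; split=> //; apply: invariantZ.
by rewrite big_map scaler_sumr; apply: eq_bigr => x _ /=; rewrite scalerAl.
Qed.

Lemma decomposableN a : D2 a -> D2 (- a).
Proof. by rewrite -scaleN1r; apply: decomposableZ. Qed.

Lemma decomposable0 : D2 0.
Proof. by exists [::]; rewrite ?big_nil. Qed.

Lemma decomposableM a b : inv_plus G a -> inv_plus G b -> D2 (a * b).
Proof.
by move=> ia ib; exists [:: (a, b)]; [move=> x; rewrite inE => /eqP ->|rewrite big_seq1].
Qed.

Lemma decomposable_sum (I : eqType) (s : seq I) (P : pred I) f :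
  (forall i, i \in s -> P i -> D2 (f i)) -> D2 (\sum_(i <- s | P i) f i).
Proof.
move=> H; rewrite big_seq_cond; apply: (big_ind D2) => [||i /andP[]].
- exact: decomposable0.
- exact: decomposableD.
exact: H.
Qed.

End Decomposables.

Section Good.
Variables (k : closedFieldType) (char0 : [pchar k] =i pred0) (n : nat).
Variables (G : {fset 'M[k]_n}) (GG : finite_linear_group G).
Variables (m : nat) (d : 'I_m -> nat).
Hypothesis d_gt0 : forall i, (0 < d i)%N.
Variables (W : {fset 'M[k]_m}) (WG : finite_linear_group W).
Variables (r : nat) (F : r.-tuple {mpoly k[m]}).
Hypothesis F_gen : homogeneous_generators d W F.
Variables (J : {set 'I_r}) (phi : {lrmorphism {mpoly k[m]} -> {mpoly k[n]}}).
Hypothesis phi_iso : fibre_product_iso G d F J phi.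

Let D2 := ideal_mul (inv_plus G) (inv_plus G).

Lemma phi_weight i : phi 'X_i \is (d i).-homog.
Proof.
apply/dhomogP => x xp; rewrite /= -weight_std; move: x xp.
apply: (proj1 (weighted_homogP char0 _ _ _)) => t t0.
case: phi_iso => _ _ <- //.
rewrite (proj2 (weighted_homogP char0 d (d i) 'X_i)) ?linearZ // => x.
by rewrite msuppX inE => /eqP ->; rewrite weightU.
Qed.

Let px : m.-tuple {mpoly k[n]} := [tuple phi 'X_i | i < m].

Let pt_px : pt px 0 = 0.
Proof.
by apply/rowP => i; rewrite !mxE tnth_mktuple (dhomog_ev0 (d_gt0 i) (phi_weight i)).
Qed.

Lemma ev0_phi f : ev 0 (phi f) = ev 0 f.
Proof. by rewrite mpoly_morphE ev_comp pt_px. Qed.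

Lemma decomposable_lift f : ev 0 f = 0 -> linear_part f = 0 -> D2 (phi f).
Proof.
move=> f0 lf; have [s sP ->] := quadratic_decomposition f0 lf.
rewrite (raddf_sum phi); apply: decomposable_sum => x xs _; rewrite /= rmorphM.
have [x1 x2] := sP x xs.
by apply: decomposableM; apply/inv_plusE; rewrite ev0_phi; split=> //; apply: phi_invariant phi_iso _.
Qed.

Lemma decomposable_linear f : ev 0 f = 0 -> D2 (phi f - \sum_i linear_part f i 0 *: phi 'X_i).
Proof.
move=> f0; have -> : \sum_i linear_part f i 0 *: phi 'X_i = phi (\sum_i linear_part f i 0 *: 'X_i).
  by rewrite (raddf_sum phi); apply: eq_bigr => i _; rewrite /= linearZ.
rewrite -[phi f - _](raddfB phi); apply: decomposable_lift.
  by rewrite mevalB f0 ev0_linear subrr.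
rewrite linear_partB linear_part_linear; apply/eqP; rewrite subr_eq0; apply/eqP.
by apply/colP => i; rewrite [RHS]mxE.
Qed.

Variables (e : nat) (u : e.-tuple {mpoly k[n]}).
Hypothesis spl : equivariant_splitting G u.
Section Degrees.
Variable eps : 'I_e -> nat.
Hypotheses (eps_gt0 : forall l, (0 < eps l)%N)
           (u_homog : forall l, tnth u l \is (eps l).-homog).

Let uI l : invariant G (tnth u l).
Proof. by case: spl => /(_ l)[[]]. Qed.

Let u0 l : ev 0 (tnth u l) = 0.
Proof. exact: dhomog_ev0 (eps_gt0 l) (u_homog l). Qed.

Let u_indep c : D2 (\sum_(i < e) c i *: tnth u i) -> forall i, c i = 0.
Proof. by case: spl => _ _ H _; apply: H. Qed.

Let u_weight l : tnth u l \is (weight eps U_(l)%MM).-homog.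
Proof. by rewrite weightU. Qed.

Let lifted D f := exists2 p : {mpoly k[e]}, p \is D.-homog for (weight eps) & p \mPo u = f.

Let lifted0 D : lifted D 0.
Proof. by exists 0; rewrite ?comp_mpoly0 // rpred0. Qed.

Let liftedD D f g : lifted D f -> lifted D g -> lifted D (f + g).
Proof.
by move=> [p pD <-] [q qD <-]; exists (p + q); rewrite ?comp_mpolyD // rpredD.
Qed.

Let lifted_sum D (I : eqType) (s : seq I) f :
  (forall i, i \in s -> lifted D (f i)) -> lifted D (\sum_(i <- s) f i).
Proof.
move=> H; rewrite big_seq; apply: (big_ind (lifted D)) => // a b; exact: liftedD.
Qed.

(** Graded Nakayama: modulo the span of the u_i, an invariant is a sum of products of invariants of
    smaller positive degree. *)
Lemma invariant_lift_homog D f : invariant G f -> f \is D.-homog -> lifted D f.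
Proof.
have [B] := ubnP D; elim: B D f => // B IH D f DB fi fD.
case: (posnP D) => [D0|D0].
  exists (ev 0 f)%:MP; first by rewrite D0; apply: dhomogC_weight.
  by move: fD; rewrite D0 comp_mpolyC => /dhomog0_const <-.
have [_ span _ _] := spl; have [|c [s sP sE]] := span f.
  by apply/inv_plusE; rewrite (dhomog_ev0 D0 fD).
rewrite -(pihomog_dE fD) -[f](subrK (\sum_(i < e) c i *: tnth u i)) sE.
rewrite addrC raddfD !raddf_sum /=; apply: liftedD; [apply: lifted_sum => i _|apply: lifted_sum => x xs].
  rewrite linearZ /=; case: (eqVneq (eps i) D) => [eD|eD].
    exists (c i *: 'X_i); last by rewrite comp_mpolyZ comp_mpolyU pihomog_dE // -eD.
    by apply: dhomogZ; rewrite dhomogX /= weightU eD.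
  by rewrite (pihomog_ne0 eD) // scaler0.
have [/inv_plusE[i1 z1] /inv_plusE[i2 z2]] := sP x xs.
rewrite pihomogM; apply: lifted_sum => a _.
have pi0 (g : {mpoly k[n]}) : ev 0 g = 0 -> pihomog mdeg 0 g = 0.
  move=> g0; rewrite (dhomog0_const (pihomogP mdeg 0 g)) -mcoeff0_ev mcoeff_pihomog.
  by rewrite mf0 eqxx mcoeff0_ev g0.
have invpi b (g : {mpoly k[n]}) : invariant G g -> invariant G (pihomog mdeg b g).
  by move=> gi h hG; rewrite -pihomog_act // gi.
case: (posnP a) => [->|a0]; first by rewrite pi0 // mul0r.
case: (ltnP a D) => [aD|Da]; last first.
  have -> : (D - a = 0)%N by apply/eqP.
  by rewrite pi0 ?mulr0.
have [|p1 p1h <-] := IH a (pihomog mdeg a x.1) _ (invpi _ _ i1) (pihomogP _ _ _).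
  by apply: leq_trans aD _.
have [|p2 p2h <-] := IH (D - a)%N (pihomog mdeg (D - a) x.2) _ (invpi _ _ i2) (pihomogP _ _ _).
  by apply: (@leq_trans D) => //; rewrite ltn_subrL a0 D0.
exists (p1 * p2); last by rewrite rmorphM.
by rewrite -(subnKC (ltnW aD)); apply: dhomogM.
Qed.

Let pt_u : pt u 0 = 0.
Proof. by apply/rowP => i; rewrite !mxE u0. Qed.

Let ev0_u p : ev 0 (p \mPo u) = ev 0 p.
Proof. by rewrite ev_comp pt_u. Qed.

(** [bt] goes from k[V] to A, and [st] below from A to k[V], both compatibly with the maps to B^G;
    they compare the two presentations. *)
Let beta_exists : exists bt : m.-tuple {mpoly k[e]}, forall i,
  tnth bt i \is (d i).-homog for (weight eps) /\ tnth bt i \mPo u = phi 'X_i.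
Proof.
have H i : exists p : {mpoly k[e]}, p \is (d i).-homog for (weight eps) /\ p \mPo u = phi 'X_i.
  have [p ph pu] := invariant_lift_homog (phi_invariant phi_iso 'X_i) (phi_weight i).
  by exists p.
have [b bP] := boolp.choice H; exists [tuple b i | i < m] => i.
by rewrite tnth_mktuple.
Qed.

Let alpha_exists : exists st : e.-tuple {mpoly k[m]}, forall l, phi (tnth st l) = tnth u l.
Proof.
have [st stP] := boolp.choice (fun l => phi_surj phi_iso (uI l)).
by exists [tuple st l | l < e] => l; rewrite tnth_mktuple.
Qed.

(** The presentation by [u] is minimal: a linear part would make a nontrivial combination of the u_i
    decomposable. *)
Let ker_linear p : p \mPo u = 0 -> ev 0 p = 0 /\ linear_part p = 0.
Proof.
move=> pu; have p0 : ev 0 p = 0 by rewrite -ev0_u pu meval0.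
split=> //; pose q := p - \sum_i linear_part p i 0 *: 'X_i.
have q0 : ev 0 q = 0 by rewrite mevalB p0 ev0_linear subrr.
have lq : linear_part q = 0.
  rewrite linear_partB linear_part_linear; apply/eqP; rewrite subr_eq0; apply/eqP.
  by apply/colP => i; rewrite [RHS]mxE.
have [s sP sE] := quadratic_decomposition q0 lq.
apply/colP => i; rewrite [RHS]mxE; apply: (u_indep (c := fun i => linear_part p i 0)).
have -> : \sum_(i < e) linear_part p i 0 *: tnth u i = - (q \mPo u).
  rewrite comp_mpolyB pu sub0r opprK (raddf_sum (comp_mpoly u)).
  by apply: eq_bigr => l _ /=; rewrite comp_mpolyZ comp_mpolyU.
apply: decomposableN; rewrite sE (raddf_sum (comp_mpoly u)); apply: decomposable_sum => x xs _ /=.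
have [x1 x2] := sP x xs; rewrite rmorphM /=; apply: decomposableM; apply/inv_plusE;
  by rewrite ev0_u; split=> //; apply: invariant_comp.
Qed.

Section Lifts.
Variables (bt : m.-tuple {mpoly k[e]}) (st : e.-tuple {mpoly k[m]}).
Hypothesis bt_homog : forall i, tnth bt i \is (d i).-homog for (weight eps).
Hypothesis btu : forall i, tnth bt i \mPo u = phi 'X_i.
Hypothesis phi_st : forall l, phi (tnth st l) = tnth u l.

Let ucomp : {rmorphism {mpoly k[e]} -> {mpoly k[n]}} := comp_mpoly u.
Let AI := ideal_mul (@mplus k e) (splitting_ker u).

Let beta_u f : (f \mPo bt) \mPo u = phi f.
Proof.
rewrite comp_mpolyA (mpoly_morphE phi); congr (_ \mPo _); apply: eq_from_tnth => i.
by rewrite !tnth_mktuple btu.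
Qed.

Let phi_alpha p : phi (p \mPo st) = p \mPo u.
Proof.
rewrite (mpoly_morphE phi) comp_mpolyA; congr (_ \mPo _); apply: eq_from_tnth => i.
by rewrite tnth_mktuple -(mpoly_morphE phi).
Qed.

Let pt_bt : pt bt 0 = 0.
Proof. by apply/rowP => i; rewrite !mxE -ev0_u btu ev0_phi mevalXU mxE. Qed.

Let pt_st : pt st 0 = 0.
Proof. by apply/rowP => l; rewrite !mxE -ev0_phi phi_st u0. Qed.

Let bt0 i : ev 0 (tnth bt i) = 0.
Proof. by rewrite -ev0_u btu ev0_phi mevalXU mxE. Qed.

Let st0 l : ev 0 (tnth st l) = 0.
Proof. by rewrite -ev0_phi phi_st u0. Qed.

Let q := #|J|.
Let Fj (a : 'I_q) := tnth F (enum_val a).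
(** Those with [c *m A2 = 0] have no linear part; through [bt] they represent the classes of I
    modulo A_+ I. *)
Let Fc (c : 'rV[k]_q) := \sum_(a < q) c 0 a *: Fj a.
Let A2 : 'M[k]_(q, m) := \matrix_(a, i) ev 0 (Fj a)^`M(i).

Let linear_part_Fc c : linear_part (Fc c) = (c *m A2)^T.
Proof.
apply/colP => i; rewrite [RHS]mxE [RHS]mxE /Fc linear_part_sum summxE.
by apply: eq_bigr => a _; rewrite mxE mderivZ mevalZ [X in _ = _ * X]mxE.
Qed.

Let phi_Fj a : phi (Fj a) = 0.
Proof.
apply/(phi_kerP phi_iso); exists (fun j => (j == enum_val a)%:R).
rewrite (bigD1 (enum_val a)) ?enum_valP //= eqxx mul1r big1 ?addr0 // => j /andP[_ /negPf ->].
by rewrite mul0r.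
Qed.

Let phi_Fc c : phi (Fc c) = 0.
Proof.
by rewrite (raddf_sum phi) big1 // => a _; rewrite /= linearZ /= phi_Fj scaler0.
Qed.

Let Fc_lin (I : Type) (s : seq I) (x : I -> k) (c : I -> 'rV[k]_q) :
  Fc (\sum_(b <- s) x b *: c b) = \sum_(b <- s) x b *: Fc (c b).
Proof.
rewrite /Fc (eq_bigr (fun a => \sum_(b <- s) (x b * c b 0 a) *: Fj a)) => [|a _].
  by rewrite exchange_big; apply: eq_bigr => b _; rewrite scaler_sumr; apply: eq_bigr => a _; rewrite scalerA.
by rewrite summxE scaler_suml; apply: eq_bigr => b _; rewrite mxE.
Qed.

Let linear_part_comp0 (a b : nat) (t : a.-tuple {mpoly k[b]}) f :
  pt t 0 = 0 -> linear_part f = 0 -> linear_part (f \mPo t) = 0.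
Proof.
move=> t0 lf; apply/colP => i; rewrite [LHS]mxE [RHS]mxE mderiv_comp ev_sum big1 // => l _.
have := congr1 (fun M : 'cV_a => M l 0) lf; rewrite mxE [RHS]mxE => E.
by rewrite mevalM ev_comp t0 E mul0r.
Qed.

(** As p has no linear part, substituting [st] and then [bt] changes it only modulo A_+ I. In
    between it lies in the ideal of Z, and replacing the coefficients of the F_j there by their
    values at 0 also changes nothing modulo A_+ I. *)
Lemma splitting_ker_beta p : splitting_ker u p ->
  exists2 c, c *m A2 = 0 & AI (p - (Fc c \mPo bt)).
Proof.
move=> pI; have [p0 lp] := ker_linear pI.
have [|s sE] := proj1 (phi_kerP phi_iso (p \mPo st)); first by rewrite phi_alpha.
have sE' : p \mPo st = \sum_(a < q) s (enum_val a) * Fj a by rewrite sE big_enum_val.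
have lE : linear_part (Fc (\row_a ev 0 (s (enum_val a)))) = 0.
  rewrite -(linear_part_comp0 pt_st lp) sE (linear_part_ideal char0 d_gt0 F_gen).
  rewrite [LHS]linear_part_sum [RHS]big_enum_val; apply: eq_bigr => a _.
  by apply/colP => i; rewrite [RHS]mxE !mxE mderivZ mevalZ.
exists (\row_a ev 0 (s (enum_val a))).
  by apply: (can_inj (@trmxK _ _ _)); rewrite -linear_part_Fc lE trmx0.
have -> : p - (Fc (\row_a ev 0 (s (enum_val a))) \mPo bt) =
   \sum_(a < q) ((s (enum_val a) \mPo bt) - (ev 0 (s (enum_val a)))%:MP) * (Fj a \mPo bt)
   - ((p \mPo [tuple tnth st l \mPo bt | l < e]) - (p \mPo [tuple 'X_l | l < e])).
  rewrite -comp_mpolyA sE' comp_mpoly_id.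
  have <- : ((\sum_(a < q) s (enum_val a) * Fj a) \mPo bt)
      - (Fc (\row_a ev 0 (s (enum_val a))) \mPo bt) =
      \sum_(a < q) ((s (enum_val a) \mPo bt) - (ev 0 (s (enum_val a)))%:MP) * (Fj a \mPo bt).
    rewrite /Fc !(raddf_sum (comp_mpoly bt)) -sumrB; apply: eq_bigr => a _.
    rewrite /= mxE comp_mpolyZ -mul_mpolyC mulrBl; congr (_ - _).
    exact: rmorphM.
  by rewrite [in RHS]opprB [RHS]addrC subrKA.
apply: (ideal_mulB (psi := ucomp)).
  apply: (ideal_mul_sum (psi := ucomp)) => a _ _.
  apply: (ideal_mul_gen (psi := ucomp)).
    by rewrite mevalB mevalC ev_comp pt_bt subrr.
  by rewrite /ucomp /= beta_u phi_Fj.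
apply: (comp_perturb (psi := ucomp)) => // i; rewrite !tnth_mktuple.
- by rewrite mevalXU mxE.
- by rewrite ev_comp pt_bt st0.
by rewrite /ucomp /= beta_u phi_st comp_mpolyU.
Qed.

Let act_comp_act (a b : nat) (g : 'M[k]_a) (h : 'M[k]_b) (t : b.-tuple {mpoly k[a]}) f :
  act g (act h f \mPo t) = f \mPo [tuple act g (act h 'X_i \mPo t) | i < b].
Proof.
exact: (mpoly_morphE (act g \o comp_mpoly t \o act h)).
Qed.

(** It suffices to treat the [Fc c \mPo bt]. As [Fc c] is W-invariant, acting by g amounts to
    replacing [bt] by its conjugate under g and w^-1, which agrees with [bt] modulo I. *)
Lemma trivial_action (Wt : {fset 'M[k]_n}) g (cm : 'M[k]_e) :
  quotient_is G Wt W phi -> g \in Wt ->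
  (forall j, act g (tnth u j) = \sum_(i < e) cm i j *: tnth u i) ->
  forall p, splitting_ker u p -> AI (act cm p - p).
Proof.
move=> [pi [piW _ _ _ piE]] gW gu p pI; have wW := piW g gW; set w := pi g in wW.
have wu := group_unit WG wW.
have act_u f : (act cm f) \mPo u = act g (f \mPo u).
  rewrite /act !comp_mpolyA; congr (_ \mPo _); apply: eq_from_tnth => j.
  rewrite !tnth_mktuple -/(act g _) gu (raddf_sum (comp_mpoly u)).
  by apply: eq_bigr => i _; rewrite /= comp_mpolyZ comp_mpolyU.
have actAI f : AI f -> AI (act cm f).
  move=> [s sP ->]; exists [seq (act cm x.1, act cm x.2) | x <- s].
    move=> _ /mapP[x xs ->] /=; have [x1 x2] := sP x xs; split.
      by move: x1; rewrite /mplus !mcoeff0_ev ev_act mul0mx.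
    by rewrite /splitting_ker act_u x2 raddf0.
  by rewrite big_map act_sum; apply: eq_bigr => x _; apply: rmorphM.
have [c cA pc] := splitting_ker_beta pI.
have -> : act cm p - p = act cm (p - (Fc c \mPo bt)) - (p - (Fc c \mPo bt))
    + (act cm (Fc c \mPo bt) - (Fc c \mPo bt)).
  by rewrite raddfB /=; ring.
apply: (ideal_mulD (psi := ucomp)).
  by apply: (ideal_mulB (psi := ucomp)) => //; apply: actAI.
have wF : Fc c = act (invmx w) (Fc c).
  rewrite /Fc act_sum; apply: eq_bigr => a _.
  by rewrite actZ (F_invariant F_gen (enum_val a) (groupVM WG wW)).
rewrite {1}wF act_comp_act; apply: (comp_perturb (psi := ucomp)).
- by rewrite linear_part_Fc cA trmx0.
- exact: bt0.
- by move=> i; rewrite tnth_mktuple ev_act mul0mx ev_comp pt_bt ev_act mul0mx mevalXU mxE.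
move=> i; rewrite tnth_mktuple /ucomp /= act_u beta_u -piE // -/w -(act_comp char0) mulmxV // act1 //.
Qed.

(** Transported to k[V] by [st], the hypothesis equates a constant combination of the F_j with one
    whose coefficients vanish at 0. Summing over W turns these coefficients into polynomials in F;
    by algebraic independence the linear terms in F can be compared, and |W| c = 0. *)
Lemma constant_syzygy_eq0 c : c *m A2 = 0 -> AI (Fc c \mPo bt) -> c = 0.
Proof.
move=> cA [s sP sE].
pose AIphi := ideal_mul (@mplus k m) (fun f => phi f = 0).
have [s' s'P s'E] : AIphi (Fc c).
  have -> : Fc c = ((Fc c \mPo bt) \mPo st) - ((Fc c \mPo [tuple tnth bt i \mPo st | i < m])
        - (Fc c \mPo [tuple 'X_i | i < m])).
    by rewrite comp_mpoly_id comp_mpolyA opprB addrC subrK.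
  apply: (ideal_mulB (psi := phi)).
    rewrite sE (raddf_sum (comp_mpoly st)); apply: (ideal_mul_sum (psi := phi)) => x xs _ /=.
    have [x1 x2] := sP x xs; rewrite rmorphM; apply: (ideal_mul_gen (psi := phi)).
      by rewrite ev_comp pt_st -mcoeff0_ev.
    exact: etrans (phi_alpha _) x2.
  apply: (comp_perturb (psi := phi)).
  - by rewrite linear_part_Fc cA trmx0.
  - by move=> i; rewrite tnth_mktuple mevalXU mxE.
  - by move=> i; rewrite tnth_mktuple ev_comp pt_st bt0.
  by move=> i; rewrite !tnth_mktuple; exact: etrans (phi_alpha _) (btu i).
have [R RE] : exists R : 'I_r -> {mpoly k[m]},
    (forall j, ev 0 (R j) = 0) /\ Fc c = \sum_(j in J) R j * tnth F j.
  rewrite s'E; elim: s' s'P {s'E} => [|x s' IH] s'P.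
    exists (fun=> 0); split=> [j|]; first by rewrite meval0.
    by rewrite big_nil big1 // => j _; rewrite mul0r.
  have [|R [R0 RE]] := IH; first by move=> y ys; apply: s'P; rewrite inE ys orbT.
  have [x1 x2] := s'P x (mem_head _ _).
  have [a aE] := proj1 (phi_kerP phi_iso _) x2.
  exists (fun j => x.1 * a j + R j); split=> [j|].
    by rewrite mevalD mevalM R0 -mcoeff0_ev x1 mul0r addr0.
  rewrite big_cons RE aE big_distrr -big_split; apply: eq_bigr => j _ /=.
  by rewrite mulrDl mulrA.
have H j : exists p : {mpoly k[r]}, transfer W (R j) = p \mPo F.
  by apply/(F_invariantP F_gen); apply: transfer_invariant.
have [p pE] := boolp.choice H.
have pt_F : pt F 0 = 0.
  by apply/rowP => j; rewrite !mxE (F0 char0 d_gt0 F_gen).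
have p0 j : ev 0 (p j) = 0.
  rewrite -pt_F -ev_comp -pE /transfer ev_sum big1 // => w _.
  by rewrite ev_act mul0mx (proj1 RE).
have relE : \sum_(a < q) ((size W)%:R * c 0 a) *: 'X_(enum_val a) = \sum_(j in J) p j * 'X_j.
  apply/eqP; rewrite -subr_eq0; apply/eqP/(F_free F_gen).
  rewrite comp_mpolyB !(raddf_sum (comp_mpoly F)); apply/eqP; rewrite subr_eq0; apply/eqP.
  have FcI : invariant W (Fc c).
    by apply: invariant_sum => a _; apply: invariantZ; apply: (F_invariant F_gen).
  transitivity (transfer W (Fc c)).
    rewrite (transfer_id FcI) /Fc scaler_sumr; apply: eq_bigr => a _.
    by rewrite /= comp_mpolyZ comp_mpolyU scalerA.
  rewrite (proj2 RE) /transfer.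
  rewrite (eq_bigr (fun w => \sum_(j in J) act w (R j * tnth F j))) => [|w _]; last exact: act_sum.
  rewrite exchange_big; apply: eq_bigr => j _ /=.
  transitivity (transfer W (tnth F j * R j)).
    by apply: eq_bigr => w _; rewrite mulrC.
  rewrite transferM; last exact: (F_invariant F_gen).
  by rewrite pE mulrC [RHS]rmorphM /= comp_mpolyU.
apply/rowP => a; rewrite [RHS]mxE.
have := congr1 (fun f => linear_part f (enum_val a) 0) relE.
rewrite /= !linear_part_sum !summxE (bigD1 a) //= big1 ?addr0 => [|b ba].
  rewrite mxE mderivZ mevalZ mderivXU eqxx meval1 mulr1.
  rewrite big1 => [/eqP|j jJ]; last first.
    by rewrite linear_partM p0 mevalXU !mxE !(scale0r, mul0r) addr0.
  by rewrite mulf_eq0 (negPf (group_order_neq0 char0 WG)) => /eqP.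
by rewrite mxE mderivZ mevalZ mderivXU (inj_eq enum_val_inj) eq_sym (negPf ba) meval0 mulr0.
Qed.

Let KB := row_base (kermx A2).
Let t := \rank (kermx A2).

Let KB_ker b : row b KB *m A2 = 0.
Proof.
by apply/eqP; rewrite -sub_kermx (submx_trans (row_sub _ _)) // eq_row_base.
Qed.

Let gens : seq {mpoly k[e]} := [seq Fc (row b KB) \mPo bt | b <- enum 'I_t].

Let gensP f : ideal_span gens f <->
  exists a : 'I_t -> {mpoly k[e]}, f = \sum_b a b * (Fc (row b KB) \mPo bt).
Proof.
rewrite ideal_spanP ?enum_uniq //.
by split=> -[a ->]; exists a; rewrite big_enum.
Qed.

Let gens_beta c : c *m A2 = 0 -> ideal_span gens (Fc c \mPo bt).
Proof.
move=> cA; have : (c <= KB)%MS by rewrite eq_row_base sub_kermx cA.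
case/submxP => x ->; apply/gensP; exists (fun b => (x 0 b)%:MP).
rewrite mulmx_sum_row Fc_lin (raddf_sum (comp_mpoly bt)); apply: eq_bigr => b _.
by rewrite /= comp_mpolyZ mul_mpolyC.
Qed.

Let gensD f g : ideal_span gens f -> ideal_span gens g -> ideal_span gens (f + g).
Proof.
move=> /gensP[a ->] /gensP[b ->]; apply/gensP; exists (fun i => a i + b i).
by rewrite -big_split; apply: eq_bigr => i _; rewrite /= mulrDl.
Qed.

Let gens0 : ideal_span gens 0.
Proof. by apply/gensP; exists (fun=> 0); rewrite big1 // => i _; rewrite mul0r. Qed.

Let gensMl h f : ideal_span gens f -> ideal_span gens (h * f).
Proof.
move=> /gensP[a ->]; apply/gensP; exists (fun i => h * a i).
by rewrite big_distrr; apply: eq_bigr => i _ /=; rewrite mulrA.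
Qed.

Let gens_sum (I : eqType) (s : seq I) f :
  (forall i, i \in s -> ideal_span gens (f i)) -> ideal_span gens (\sum_(i <- s) f i).
Proof.
move=> H; rewrite big_seq; apply: (big_ind (ideal_span gens)) => // a b; exact: gensD.
Qed.

Let pihomog_Fc D c : c *m A2 = 0 ->
  exists2 c', c' *m A2 = 0 & pihomog (weight d) D (Fc c) = Fc c'.
Proof.
move=> cA; have [w wP] := F_weights char0 d_gt0 F_gen.
pose c' := \row_a (if w (enum_val a) == D then c 0 a else 0).
have E : pihomog (weight d) D (Fc c) = Fc c'.
  rewrite /Fc raddf_sum; apply: eq_bigr => a _; rewrite /= linearZ mxE /=.
  have Fh : Fj a \is (w (enum_val a)).-homog for (weight d).
    by apply/weight_homogP; case: (wP (enum_val a)).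
  case: eqP => [<-|/eqP wD]; first by rewrite pihomog_dE.
  by rewrite (pihomog_ne0 wD) // scaler0 scale0r.
exists c' => //; apply: (can_inj (@trmxK _ _ _)).
rewrite -linear_part_Fc -E trmx0; apply/colP => i.
rewrite linear_part_coeff mcoeff_pihomog -linear_part_coeff linear_part_Fc cA.
by rewrite !mxE; case: ifP.
Qed.

(** Graded Nakayama: what remains modulo A_+ I is, in each degree, a sum of multiples of elements of
    I of smaller degree. *)
Lemma splitting_ker_generated p : splitting_ker u p -> ideal_span gens p.
Proof.
have homog_case : forall B D p, (D < B)%N -> splitting_ker u p ->
    p \is D.-homog for (weight eps) -> ideal_span gens p.
  elim=> // B IH D {}p DB pI pD.
  have [c cA [s sP sE]] := splitting_ker_beta pI.
  rewrite -(pihomog_dE pD) -[p](subrK (Fc c \mPo bt)) sE raddfD raddf_sum /=.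
  apply: gensD.
    apply: gens_sum => x xs; rewrite pihomogM; apply: gens_sum => a _.
    have [x1 x2] := sP x xs.
    have pi2 b : splitting_ker u (pihomog (weight eps) b x.2).
      by rewrite /splitting_ker -(pihomog_comp (mf' := mdeg) b x.2 u_weight) x2 raddf0.
    case: (posnP a) => [->|a0].
      suff -> : pihomog (weight eps) 0 x.1 = 0 by rewrite mul0r.
      apply/mpolyP => y; rewrite mcoeff_pihomog mcoeff0; case: eqP => // /(weight_eq0 eps_gt0) ->.
      exact: x1.
    case: (ltnP a D) => [aD|Da].
      apply: gensMl; apply: (IH (D - a)%N); rewrite ?pihomogP //.
      by apply: (@leq_trans D) => //; rewrite ltn_subrL a0 (leq_ltn_trans _ aD).
    have -> : (D - a = 0)%N by apply/eqP.
    have -> : pihomog (weight eps) 0 x.2 = 0; last by rewrite mulr0.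
    apply/mpolyP => y; rewrite mcoeff_pihomog mcoeff0; case: eqP => // /(weight_eq0 eps_gt0) ->.
    by rewrite mcoeff0_ev (proj1 (ker_linear x2)).
  have bt_weight i : tnth bt i \is (weight d U_(i)%MM).-homog for (weight eps).
    by rewrite weightU.
  rewrite (pihomog_comp D (Fc c) bt_weight).
  by have [c' c'A ->] := pihomog_Fc D cA; apply: gens_beta.
move=> pI; have [K _ ->] := pihomog_partition_geq (weight eps) 0 p.
apply: gens_sum => a _; apply: (homog_case a.+1 a) => //; last exact: pihomogP.
by rewrite /splitting_ker -(pihomog_comp (mf' := mdeg) a p u_weight) pI raddf0.
Qed.

(** The t generators have independent classes in I / A_+ I, which s spans; the constant terms of
    their expressions in s thus form a matrix with independent rows. *)
Lemma splitting_ker_lower_bound s : generates_ideal s (splitting_ker u) -> (t <= size s)%N.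
Proof.
move=> sgen.
have H (b : 'I_t) : exists x : 'I_(size s) -> {mpoly k[e]},
    Fc (row b KB) \mPo bt = \sum_i x i * s`_i.
  by have [x ->] := proj1 (sgen (Fc (row b KB) \mPo bt)) (etrans (beta_u _) (phi_Fc _)); exists x.
have [x xE] := boolp.choice H.
pose N : 'M[k]_(t, size s) := \matrix_(b, i) ev 0 (x b i).
suff Nf : row_free N by rewrite -(eqP Nf) rank_leq_col.
rewrite -kermx_eq0; apply/rowV0P => v /sub_kermxP vN.
have vKA : v *m KB *m A2 = 0.
  rewrite -mulmxA (_ : KB *m A2 = 0) ?mulmx0 //.
  by apply/row_matrixP => b; rewrite row_mul KB_ker row0.
have : v *m KB = 0.
  apply: (constant_syzygy_eq0 vKA).
  have -> : Fc (v *m KB) \mPo bt = \sum_i (\sum_b (v 0 b)%:MP * x b i) * s`_i.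
    rewrite mulmx_sum_row Fc_lin (raddf_sum (comp_mpoly bt)).
    rewrite (eq_bigr (fun b => \sum_i (v 0 b)%:MP * x b i * s`_i)) => [|b _].
      by rewrite exchange_big; apply: eq_bigr => i _; rewrite mulr_suml.
    by rewrite /= comp_mpolyZ xE -mul_mpolyC mulr_sumr; apply: eq_bigr => i _; rewrite mulrA.
  apply: (ideal_mul_sum (psi := ucomp)) => i _ _; apply: (ideal_mul_gen (psi := ucomp)).
    have := congr1 (fun M : 'rV_(size s) => M 0 i) vN; rewrite mxE [RHS]mxE => <-.
    by rewrite ev_sum; apply: eq_bigr => b _; rewrite mevalM mevalC mxE.
  apply/(sgen s`_i); exists (fun l => (l == i)%:R).
  by rewrite (bigD1 i) //= eqxx mul1r big1 ?addr0 // => l /negPf ->; rewrite mul0r.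
move/eqP; rewrite -[X in _ == X](mul0mx _ KB) => /eqP /(row_free_inj (row_base_free _)).
by [].
Qed.

(** [Mx] is the map induced by phi from linear forms on V to those on E. It is onto, with section
    [A1], and its kernel is spanned by the linear parts of the F_j, the rows of [A2]. So A2 has rank
    m - e, while q = m - n, whence t = q - (m - e) = e - n. *)
Lemma rank_kernel_linear_parts : (t + n = e)%N.
Proof.
have Xsp i : exists c : 'I_e -> k, D2 (phi 'X_i - \sum_(l < e) c l *: tnth u l).
  case: spl => _ H _ _; apply: H; apply/inv_plusE.
  by rewrite ev0_phi mevalXU mxE; split=> //; apply: phi_invariant phi_iso _.
have [c cP] := boolp.choice Xsp; pose Mx : 'M[k]_(m, e) := \matrix_(i, l) c i l.
have MxP (v : 'rV_m) :
    D2 (\sum_i v 0 i *: phi 'X_i - \sum_(l < e) (v *m Mx) 0 l *: tnth u l).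
  have -> : \sum_i v 0 i *: phi 'X_i - \sum_(l < e) (v *m Mx) 0 l *: tnth u l =
      \sum_i v 0 i *: (phi 'X_i - \sum_(l < e) c i l *: tnth u l).
    rewrite [RHS](eq_bigr (fun i => v 0 i *: phi 'X_i - \sum_(l < e) (v 0 i * c i l) *: tnth u l)) => [|i _].
      rewrite sumrB [in RHS]exchange_big; congr (_ - _); apply: eq_bigr => l _ /=.
      rewrite -scaler_suml mxE; congr (_ *: _); apply: eq_bigr => i _.
      by rewrite [X in _ * X]mxE.
    by rewrite scalerBr scaler_sumr; congr (_ - _); apply: eq_bigr => l _; rewrite scalerA.
  by apply: decomposable_sum => i _ _; apply/decomposableZ/cP.
pose A1 : 'M[k]_(e, m) := \matrix_(l, i) linear_part (tnth st l) i 0.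
have A1Mx : A1 *m Mx = 1%:M.
  apply/row_matrixP => l; apply/rowP => l'; rewrite row_mul; apply/eqP.
  rewrite eq_sym -subr_eq0; apply/eqP.
  pose z := row l 1%:M - row l A1 *m Mx.
  have -> : row l 1%:M 0 l' - (row l A1 *m Mx) 0 l' = z 0 l' by rewrite !mxE.
  apply: (u_indep (c := fun i => z 0 i)).
  have -> : \sum_(i < e) z 0 i *: tnth u i =
      (phi (tnth st l) - \sum_i linear_part (tnth st l) i 0 *: phi 'X_i)
      + (\sum_i row l A1 0 i *: phi 'X_i - \sum_(i < e) (row l A1 *m Mx) 0 i *: tnth u i).
    rewrite [X in _ = _ - X + _](eq_bigr (fun i => row l A1 0 i *: phi 'X_i)) => [|i _].
      rewrite addrA subrK phi_st -[X in _ = X - _](_ : \sum_(i < e) (row l (1%:M : 'M[k]_e)) 0 i *: tnth u i = _).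
        by rewrite -sumrB; apply: eq_bigr => i _; rewrite -scalerBl; congr (_ *: _); rewrite !mxE.
      rewrite (bigD1 l) //= big1 ?addr0 => [|i il]; first by rewrite !mxE eqxx scale1r.
      by rewrite !mxE eq_sym (negPf il) scale0r.
    by congr (_ *: _); rewrite [RHS]mxE [RHS]mxE.
  by apply: decomposableD; [apply: decomposable_linear | apply: MxP].
have kE : (kermx Mx :=: A2)%MS.
  apply/eqmxP/andP; split.
    apply/row_subP => i; set v := row i _.
    have vM : v *m Mx = 0 by rewrite /v -row_mul mulmx_ker row0.
    have : D2 (phi (\sum_i v 0 i *: 'X_i)).
      have := MxP v; rewrite vM [X in _ - X]big1 ?subr0 => [|l _]; last by rewrite mxE scale0r.
      by rewrite (raddf_sum phi) (eq_bigr (fun i => phi (v 0 i *: 'X_i))) // => l _; rewrite linearZ.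
    case=> s sP sE.
    have [f fP] : exists2 f, ev 0 f = 0 /\ linear_part f = 0 & phi f = \sum_(x <- s) x.1 * x.2.
      elim: s sP {sE} => [|x s IH] sP.
        by exists 0; [split; [exact: meval0|exact: linear_part0]|rewrite big_nil raddf0].
      have [y ys|f [f0 lf] fE] := IH; first by apply: sP; rewrite inE ys orbT.
      have [/inv_plusE[i1 z1] /inv_plusE[i2 z2]] := sP x (mem_head _ _).
      have [a aE] := phi_surj phi_iso i1; have [b bE] := phi_surj phi_iso i2.
      exists (a * b + f); last first.
        rewrite big_cons [LHS]raddfD [X in X + _]rmorphM.
        exact: (f_equal2 +%R (f_equal2 *%R aE bE) fE).
      have a0 : ev 0 a = 0 by rewrite -ev0_phi aE.
      have b0 : ev 0 b = 0 by rewrite -ev0_phi bE.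
      by rewrite mevalD mevalM linear_partD linear_partM a0 b0 f0 lf !scale0r !mul0r !addr0.
    case: fP => f0 lf fE.
    have [|a aE] := proj1 (phi_kerP phi_iso (\sum_i v 0 i *: 'X_i - f)).
      by rewrite raddfB /= fE sE subrr.
    have := congr1 (@linear_part k m) aE.
    rewrite linear_partB lf subr0 linear_part_linear (linear_part_ideal char0 d_gt0 F_gen) => vE.
    apply/submxP; exists (\row_b ev 0 (a (enum_val b))).
    apply/rowP => l; have := congr1 (fun M : 'cV_m => M l 0) vE; rewrite mxE => ->.
    rewrite big_enum_val summxE mxE; apply: eq_bigr => b _.
    by rewrite !mxE.
  apply/row_subP => b; rewrite sub_kermx; apply/eqP/rowP => l; rewrite [RHS]mxE.
  have Db : D2 (\sum_i row b A2 0 i *: phi 'X_i).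
    have := decomposable_linear (F0 char0 d_gt0 F_gen (enum_val b)).
    rewrite -/(Fj b) phi_Fj sub0r => /decomposableN; rewrite opprK.
    rewrite [X in _ -> D2 X](eq_bigr (fun i => linear_part (Fj b) i 0 *: phi 'X_i)) // => i _.
    by rewrite !mxE.
  apply: (u_indep (c := fun l => (row b A2 *m Mx) 0 l)).
  by have /decomposableN := MxP (row b A2); rewrite opprB => /decomposableD /(_ Db); rewrite subrK.
have rMx : \rank Mx = e.
  apply/eqP; rewrite eqn_leq rank_leq_col /=.
  by have := mxrankM_maxr A1 Mx; rewrite A1Mx mxrank1.
have em : (e <= m)%N by rewrite -rMx rank_leq_row.
have A2q : (\rank A2 <= q)%N by apply: rank_leq_row.
have qm := card_J char0 GG WG F_gen phi_iso; move: A2q.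
rewrite /t mxrank_ker -kE mxrank_ker rMx => A2q.
by rewrite addnC addnBA // qm subKn.
Qed.

Lemma min_generators_splitting_ker :
  exists2 t, min_number_of_generators (splitting_ker u) t & (t + n = e)%N.
Proof.
exists t; last exact: rank_kernel_linear_parts.
split; last exact: splitting_ker_lower_bound.
exists gens; first by rewrite size_map size_enum_ord.
move=> f; split; first exact: splitting_ker_generated.
move=> /gensP[a ->]; rewrite /splitting_ker (raddf_sum (comp_mpoly u)) big1 // => b _.
by rewrite /= rmorphM /= beta_u phi_Fc mulr0.
Qed.

End Lifts.

Lemma good_for_degrees (Wt : {fset 'M[k]_n}) : quotient_is G Wt W phi -> good_for G Wt u.
Proof.
move=> Wt_quo; have [bt btP] := beta_exists; have [st stP] := alpha_exists.
have bth i := proj1 (btP i); have btu i := proj2 (btP i).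
split; first exact: (min_generators_splitting_ker bth btu stP).
by move=> g c gW gc p; apply: (trivial_action btu stP Wt_quo gW gc).
Qed.

End Degrees.

Lemma good_for_splitting (Wt : {fset 'M[k]_n}) : quotient_is G Wt W phi -> good_for G Wt u.
Proof.
have [uhom _ indep _] := spl.
have H l : exists a : nat, (0 < a)%N /\ tnth u l \is (a).-homog.
  have [[_ ul0] [a aP]] := uhom l; exists a.
  have ua : tnth u l \is (a).-homog.
    apply/dhomogP => x xu; rewrite /= -weight_std; move: x xu.
    exact: (proj1 (weighted_homogP char0 _ _ _)).
  (* A generator of degree 0 without constant term would be 0, against independence modulo
     decomposables. *)
  split=> //; case: (posnP a) => // a0.
  have u0 : tnth u l = 0.
    by move: ua; rewrite a0 => /dhomog0_const ->; rewrite -mcoeff0_ev ul0 mpolyC0.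
  suff /(_ l) : forall i, (i == l)%:R = 0 :> k by rewrite eqxx => /eqP; rewrite oner_eq0.
  apply: indep; exists [::] => //; rewrite big_nil big1 // => i _.
  by case: eqP => [->|_]; rewrite ?u0 ?scaler0 ?scale0r.
have [eps epsP] := boolp.choice H.
apply: (good_for_degrees (eps := eps)) => l; by case: (epsP l).
Qed.

End Good.

(** * The equivariant splitting *)

Section SumOfProjections.
Import Num.Theory Order.TTheory.
Variables (I H : finType) (T : eqType) (s : seq T) (a : T -> H -> I -> I).
Variables (mul : H -> H -> H) (inv : H -> H).
Hypothesis aM : forall t h h' j, a t h' (a t h j) = a t (mul h h') j.
Hypothesis mulI : forall h, injective (mul h).
Hypothesis invI : injective inv.
Hypothesis aK : forall t h, cancel (a t h) (a t (inv h)).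

Let N := #|I|.

(** Up to the factor #|H|, the orthogonal projection onto the functions invariant under [a t]. *)
Definition orbit_mx (R : pzRingType) (t : T) : 'M[R]_N :=
  \matrix_(i, j) \sum_(h : H) (a t h (enum_val i) == enum_val j)%:R.

Lemma orbit_mx_map (R S : pzRingType) (f : {rmorphism R -> S}) t :
  map_mx f (orbit_mx R t) = orbit_mx S t.
Proof.
by apply/matrixP => i j; rewrite !mxE rmorph_sum; apply: eq_bigr => h _; rewrite rmorph_nat.
Qed.

Lemma orbit_mx_sym (R : pzRingType) t : (orbit_mx R t)^T = orbit_mx R t.
Proof.
apply/matrixP => i j; rewrite !mxE (reindex_inj invI); apply: eq_bigr => h _.
have aK' : cancel (a t (inv h)) (a t h) by apply: canF_sym (aK t h).
by congr ((nat_of_bool _)%:R); apply/eqP/eqP => <-; rewrite ?aK ?aK'.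
Qed.

Let sum_indicator (R : pzRingType) (x : I) : \sum_(l < N) (x == enum_val l)%:R = 1 :> R.
Proof.
rewrite (bigD1 (enum_rank x)) //= enum_rankK eqxx big1 ?addr0 // => l lN.
by case: eqP => // xl; rewrite xl enum_valK eqxx in lN.
Qed.

Lemma orbit_mx_idem (R : pzRingType) t :
  orbit_mx R t *m orbit_mx R t = #|H|%:R *: orbit_mx R t.
Proof.
apply/matrixP => i j; rewrite !mxE.
have E (l : 'I_N) : orbit_mx R t i l * orbit_mx R t l j =
    \sum_(h : H) (a t h (enum_val i) == enum_val l)%:R *
      \sum_(h' : H) (a t h' (a t h (enum_val i)) == enum_val j)%:R.
  rewrite !mxE big_distrl; apply: eq_bigr => h _ /=.
  by case: eqP => [->|_]; rewrite ?mul0r.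
rewrite (eq_bigr _ (fun l _ => E l)) exchange_big /=.
rewrite (eq_bigr (fun=> \sum_(h' : H) (a t h' (enum_val i) == enum_val j)%:R)) => [|h _].
  by rewrite sumr_const mulr_natl.
rewrite -big_distrl /= sum_indicator mul1r [RHS](reindex_inj (@mulI h)).
by apply: eq_bigr => h' _; rewrite aM.
Qed.

Let total (R : pzRingType) : 'M[R]_N := \sum_(t <- s) orbit_mx R t.

Let norm_eq0 (x : 'cV[rat]_N) : x^T *m x = 0 -> x = 0.
Proof.
move=> /matrixP /(_ 0 0); rewrite !mxE => /eqP; rewrite psumr_eq0 => [/allP x0|i _]; last first.
  by rewrite mxE -expr2 sqr_ge0.
apply/colP => i; have := x0 i (mem_index_enum _).
by rewrite !mxE mulf_eq0 orbb => /eqP.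
Qed.

Let norm_ge0 (x : 'cV[rat]_N) : 0 <= (x^T *m x) 0 0.
Proof. by rewrite mxE; apply: sumr_ge0 => i _; rewrite mxE -expr2 sqr_ge0. Qed.

Let norm_eq00 (x : 'cV[rat]_N) : (x^T *m x) 0 0 = 0 -> x = 0.
Proof. by move=> x0; apply: norm_eq0; apply/matrixP => i j; rewrite !ord1 x0 mxE. Qed.

Let total_sym : (total rat)^T = total rat.
Proof.
by rewrite /total raddf_sum; apply: eq_bigr => t _; exact: orbit_mx_sym.
Qed.

(** Writing P_t for the orbit matrices, P_t^T P_t = #|H| P_t: pairing the hypothesis with x gives a
    sum of squares of the P_t x equal to 0. *)
Let ker_total (x : 'cV[rat]_N) t : t \in s -> total rat *m x = 0 -> orbit_mx rat t *m x = 0.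
Proof.
move=> ts Tx.
have E : \sum_(t <- s) ((orbit_mx rat t *m x)^T *m (orbit_mx rat t *m x)) 0 0 = 0.
  rewrite (eq_bigr (fun t => #|H|%:R * (x^T *m (orbit_mx rat t *m x)) 0 0)) => [|t' _].
    rewrite -big_distrr /= -summxE -mulmx_sumr -mulmx_suml -/(total rat) Tx mulmx0 mxE.
    by rewrite mulr0.
  rewrite trmx_mul orbit_mx_sym mulmxA -[x^T *m _ *m _]mulmxA orbit_mx_idem.
  by rewrite -scalemxAr -scalemxAl -mulmxA mxE.
move/eqP: E; rewrite psumr_eq0 => [/allP/(_ t ts)/= /eqP|t' _]; first exact: norm_eq00.
exact: norm_ge0.
Qed.

Let orbit_sub_total t : t \in s -> (orbit_mx rat t <= total rat)%MS.
Proof.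
move=> ts; rewrite submxE; apply/eqP/(can_inj (@trmxK _ _ _))/row_matrixP => i.
rewrite trmx0 row0 -tr_col colE -mulmxA -colE (ker_total ts) ?trmx0 //.
by rewrite colE mulmxA mulmx_coker mul0mx.
Qed.

Let total_sub_square : (total rat <= total rat *m total rat)%MS.
Proof.
rewrite submxE; apply/eqP/(can_inj (@trmxK _ _ _))/row_matrixP => i.
rewrite trmx0 row0 -tr_col colE -mulmxA -colE.
set y := col i _; rewrite (_ : total rat *m y = 0) ?trmx0 //; apply: norm_eq0.
rewrite trmx_mul total_sym -mulmxA [total rat *m (_ *m _)]mulmxA.
have -> : total rat *m total rat *m y = 0; last by rewrite mulmx0.
by rewrite /y colE mulmxA mulmx_coker mul0mx.
Qed.

(** Integral matrices carry identities from the rationals to k. *)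
Let clear_denominators (A : 'M[rat]_N) :
  exists2 D : int, D != 0 & exists B : 'M[int]_N, D%:~R *: A = map_mx intr B.
Proof.
pose D : int := \prod_(x : 'I_N * 'I_N) denq (A x.1 x.2).
exists D; first by apply/prodf_neq0 => x _; apply: denq_neq0.
exists (\matrix_(i, j) (numq (A i j) * \prod_(x : 'I_N * 'I_N | x != (i, j)) denq (A x.1 x.2))).
apply/matrixP => i j; rewrite !mxE /D (bigD1 (i, j)) //= !rmorphM /= numqE mulrAC.
by congr (_ * _); rewrite mulrC.
Qed.

(* The orbit matrices are rational and positive semidefinite, so over the
   rationals the image of their sum contains all their images and meets the
   kernel trivially; these are matrix identities, hence hold over [k]. *)
Lemma sum_orbit_operators_inj (k : fieldType) (char0 : [pchar k] =i pred0)
    (f : I -> k) (F : T -> I -> k) :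
  (forall i, f i = \sum_(t <- s) F t i) ->
  (forall t h i, t \in s -> F t (a t h i) = F t i) ->
  (forall i, \sum_(t <- s) \sum_(h : H) f (a t h i) = 0) ->
  (0 < #|H|)%N -> forall i, f i = 0.
Proof.
move=> fE Finv f0 H0.
have intr_neq0 (D : int) : D != 0 -> D%:~R != 0 :> k.
  case: D => [[|l]|l] // _; first exact: (natr_neq0 char0 l).
  by rewrite NegzE rmorphN oppr_eq0; apply: (natr_neq0 char0 l).
pose rv (g : I -> k) : 'rV[k]_N := \row_i g (enum_val i).
have rv_orbit g t : rv g *m orbit_mx k t = rv (fun i => \sum_(h : H) g (a t h i)).
  apply/rowP => j; rewrite -[orbit_mx k t]orbit_mx_sym !mxE.
  rewrite (eq_bigr (fun i => \sum_(h : H) g (enum_val i) * (a t h (enum_val j) == enum_val i)%:R)) => [|i _].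
    rewrite exchange_big; apply: eq_bigr => h _ /=.
    rewrite (bigD1 (enum_rank (a t h (enum_val j)))) //= enum_rankK eqxx mulr1 big1 ?addr0 // => l lN.
    by case: eqP => [E'|_]; rewrite ?mulr0 //; rewrite E' enum_valK eqxx in lN.
  by rewrite !mxE big_distrr.
have fT : rv f *m total k = 0.
  rewrite mulmx_sumr; apply/rowP => i; rewrite summxE [RHS]mxE -[RHS](f0 (enum_val i)).
  by apply: eq_bigr => t _; rewrite rv_orbit mxE.
have cardH : (#|H|%:R : k) != 0 by case: #|H| H0 => // l _; apply: (natr_neq0 char0).
have totalE : map_mx intr (total int) = total k.
  by rewrite /total raddf_sum; apply: eq_bigr => t _; exact: orbit_mx_map.
have totalQ : map_mx intr (total int) = total rat.
  by rewrite /total raddf_sum; apply: eq_bigr => t _; exact: orbit_mx_map.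
have intr_mx_inj p q : injective (map_mx intr : 'M[int]_(p, q) -> 'M[rat]_(p, q)).
  move=> A B /matrixP AB; apply/matrixP => i j; have := AB i j.
  by rewrite !mxE => /intr_inj.
(* f lies in the image of the total: F t is #|H|^-1 times its own orbit sum, and every orbit matrix
   factors through the total. *)
have [z zE] : exists z, rv f = z *m total k.
  have H1 t : exists Z : 'M[k]_N, t \in s -> orbit_mx k t = Z *m total k.
    case: (boolP (t \in s)) => [ts|_]; last by exists 0.
    have [Z ZE] := submxP (orbit_sub_total ts).
    have [D D0 [B BE]] := clear_denominators Z.
    exists (D%:~R^-1 *: map_mx intr B) => _.
    have E : D *: orbit_mx int t = B *m total int.
      apply: intr_mx_inj; rewrite map_mxM -BE totalQ -scalemxAl -ZE.
      by rewrite map_mxZ orbit_mx_map.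
    rewrite -totalE -scalemxAl -map_mxM -E map_mxZ orbit_mx_map scalerK //.
    exact: intr_neq0.
  have [Z ZE] := boolp.choice H1.
  exists (\sum_(t <- s) #|H|%:R^-1 *: (rv (F t) *m Z t)).
  rewrite mulmx_suml; apply/rowP => i; rewrite summxE mxE fE big_seq [RHS]big_seq.
  apply: eq_bigr => t ts; rewrite -scalemxAl -mulmxA -ZE // rv_orbit !mxE.
  rewrite (eq_bigr (fun=> F t (enum_val i))) => [|h _]; last exact: Finv.
  by rewrite sumr_const -[in RHS](mulr_natl (F t _)) mulKf.
(* Rationally the symmetric total has the same row space as its square; transposing puts the factor
   on the right. *)
have [Y YE] : exists Y : 'M[k]_N, total k = total k *m total k *m Y.
  have [Z ZE] := submxP total_sub_square.
  have [D D0 [B BE]] := clear_denominators Z.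
  exists (D%:~R^-1 *: map_mx intr B)^T.
  have E : D *: total int = B *m (total int *m total int).
    apply: intr_mx_inj; rewrite !map_mxM -BE totalQ -scalemxAl -ZE -totalQ.
    by rewrite map_mxZ.
  have tk_sym : (total k)^T = total k.
    by rewrite /total raddf_sum; apply: eq_bigr => t _; exact: orbit_mx_sym.
  apply: (can_inj (@trmxK _ _ _)); rewrite !trmx_mul trmxK tk_sym.
  rewrite -scalemxAl -totalE -!map_mxM -E map_mxZ scalerK //; exact: intr_neq0.
have : rv f = 0 by rewrite zE YE !mulmxA -zE fT mul0mx.
by move=> /rowP rv0 i; have := rv0 (enum_rank i); rewrite !mxE enum_rankK.
Qed.

End SumOfProjections.

(** * Directional derivatives and polarization *)

Section DirectionalDerivatives.
Variables (k : fieldType) (n : nat).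
Implicit Types (w : 'rV[k]_n) (s : seq 'rV[k]_n) (f : {mpoly k[n]}) (g : 'M[k]_n).

Definition dir w f : {mpoly k[n]} := \sum_l w 0 l *: f^`M(l).
Definition dirs s f := foldr dir f s.

Lemma dir_addl w w' f : dir (w + w') f = dir w f + dir w' f.
Proof. by rewrite /dir -big_split; apply: eq_bigr => l _; rewrite mxE scalerDl. Qed.

Lemma dir_sum w (I : Type) (r : seq I) (P : pred I) F :
  dir w (\sum_(i <- r | P i) F i) = \sum_(i <- r | P i) dir w (F i).
Proof.
rewrite /dir exchange_big; apply: eq_bigr => l _ /=.
by rewrite mderiv_sum scaler_sumr.
Qed.

Lemma dirB w f f' : dir w (f - f') = dir w f - dir w f'.
Proof. by rewrite /dir -sumrB; apply: eq_bigr => l _; rewrite mderivB scalerBr. Qed.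

Lemma dirM w f f' : dir w (f * f') = dir w f * f' + f * dir w f'.
Proof.
rewrite /dir big_distrl big_distrr -big_split; apply: eq_bigr => l _ /=.
by rewrite mderivM scalerDr scalerAl scalerAr.
Qed.

Lemma dir_act w g f : dir w (act g f) = act g (dir (w *m g) f).
Proof.
rewrite /dir act_sum.
rewrite (eq_bigr (fun l => \sum_j (w 0 l * g l j) *: act g f^`M(j))) => [|l _].
  rewrite exchange_big; apply: eq_bigr => j _ /=.
  by rewrite actZ -scaler_suml mxE.
by rewrite mderiv_act scaler_sumr; apply: eq_bigr => j _; rewrite scalerA.
Qed.

Lemma dirs_sum s (I : Type) (r : seq I) (P : pred I) F :
  dirs s (\sum_(i <- r | P i) F i) = \sum_(i <- r | P i) dirs s (F i).
Proof. by elim: s => //= w s ->; rewrite dir_sum. Qed.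

Lemma dirsB s f f' : dirs s (f - f') = dirs s f - dirs s f'.
Proof. by elim: s => //= w s ->; rewrite dirB. Qed.

Lemma dirs0 s : dirs s 0 = 0.
Proof. by have := dirsB s 0 0; rewrite !subrr. Qed.

Lemma dirs_act s g f : dirs s (act g f) = act g (dirs [seq w *m g | w <- s] f).
Proof. by elim: s => //= w s ->; rewrite dir_act. Qed.

Lemma ev0_act g f : ev 0 (act g f) = ev 0 f.
Proof. by rewrite ev_act mul0mx. Qed.

Lemma ev0_dirs_act s g f : ev 0 (dirs s (act g f)) = ev 0 (dirs [seq w *m g | w <- s] f).
Proof. by rewrite dirs_act ev0_act. Qed.

(** Subsets of j positions, as boolean lists so that [mask] extracts the corresponding sublists. *)
Fixpoint masks j : seq (seq bool) :=
  if j is j'.+1 then [seq true :: b | b <- masks j'] ++ [seq false :: b | b <- masks j']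
  else [:: [::]].

Lemma size_masks j b : b \in masks j -> size b = j.
Proof.
elim: j b => [|j IH] b /=; first by rewrite inE => /eqP ->.
by rewrite mem_cat => /orP[] /mapP[c /IH <- ->].
Qed.

Lemma big_masks (V : nmodType) j (F : seq bool -> V) :
  \sum_(b <- masks j.+1) F b = \sum_(b <- masks j) F (true :: b) + \sum_(b <- masks j) F (false :: b).
Proof. by rewrite /= big_cat !big_map. Qed.

(** The terms of the expansion of a multilinear form at vectors w + w g. *)
Definition twist g (b : seq bool) s := [seq (if z.1 then z.2 *m g else z.2) | z <- zip b s].

Lemma dirs_twist s g f :
  dirs [seq w *m (1%:M + g) | w <- s] f = \sum_(b <- masks (size s)) dirs (twist g b s) f.
Proof.
elim: s => [|w s IH]; first by rewrite big_seq1.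
rewrite big_masks /= IH mulmxDr mulmx1 addrC dir_addl !dir_sum.
by congr (_ + _); apply: eq_bigr.
Qed.

Lemma dirs_prod s f f' :
  dirs s (f * f') = \sum_(b <- masks (size s)) dirs (mask b s) f * dirs (mask (map negb b) s) f'.
Proof.
elim: s => [|w s IH]; first by rewrite big_seq1.
rewrite big_masks /= IH dir_sum -big_split; apply: eq_bigr => b _ /=.
exact: dirM.
Qed.

Lemma big_masks_true (V : nmodType) j (F : seq bool -> V) :
  \sum_(b <- masks j | ~~ has negb b) F b = F (nseq j true).
Proof.
elim: j F => [|j IH] F; first by rewrite big_mkcond big_seq1.
rewrite big_mkcond big_masks /= -big_mkcond IH big1 ?addr0 // => b _.
Qed.

Lemma big_masks_false (V : nmodType) j (F : seq bool -> V) :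
  \sum_(b <- masks j | ~~ has id b) F b = F (nseq j false).
Proof.
elim: j F => [|j IH] F; first by rewrite big_mkcond big_seq1.
by rewrite big_mkcond big_masks /= big1 ?add0r // -big_mkcond IH.
Qed.

(** The empty and the full subset are left out: they give the two terms subtracted in
    [comult_mult]. *)
Definition proper_masks j := [seq b <- masks j | has id b && has negb b].

Lemma big_proper_masks (V : zmodType) j (F : seq bool -> V) : (0 < j)%N ->
  \sum_(b <- masks j) F b = \sum_(b <- proper_masks j) F b + F (nseq j true) + F (nseq j false).
Proof.
move=> j0; rewrite (bigID (fun b => has id b)) /= big_masks_false; congr (_ + _).
rewrite (bigID (fun b => has negb b)) /= big_filter; congr (_ + _).
rewrite -big_masks_true big_seq_cond [RHS]big_seq_cond; apply: eq_bigl => b.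
case: (boolP (b \in masks j)) => //= /size_masks bj.
case: b bj => [|[] b] //= bj; last by rewrite andbF.
by rewrite -bj in j0.
Qed.

Lemma twist_true g s : twist g (nseq (size s) true) s = [seq w *m g | w <- s].
Proof. by rewrite /twist; elim: s => //= w s ->. Qed.

Lemma twist_false g s : twist g (nseq (size s) false) s = s.
Proof. by rewrite /twist; elim: s => //= w s ->. Qed.

Lemma mask_twist g b s : mask b (twist g b s) = [seq w *m g | w <- mask b s].
Proof. by rewrite /twist; elim: b s => [|[] b IH] [|w s] //=; rewrite IH. Qed.

Lemma mask_twistN g b s : mask (map negb b) (twist g b s) = mask (map negb b) s.
Proof. by rewrite /twist; elim: b s => [|[] b IH] [|w s] //=; rewrite IH. Qed.

(** By induction all first derivatives vanish, and Euler's identity returns to f. *)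
Lemma dirs_eq0 (char0 : [pchar k] =i pred0) D f : f \is (D).-homog ->
  (forall s, size s = D -> ev 0 (dirs s f) = 0) -> f = 0.
Proof.
elim: D f => [|D IH] f fD f0.
  by rewrite (dhomog0_const fD) (f0 [::]) // mpolyC0.
have d0 l : f^`M(l) = 0.
  apply: IH => [|s sD].
    apply/dhomogP => x; rewrite mcoeff_msupp mcoeff_deriv => xf.
    have : (x + U_(l))%MM \in msupp f.
      by rewrite mcoeff_msupp; apply: contra xf => /eqP ->; rewrite mul0rn.
    by move/(dhomogP _ _ _ fD); rewrite /= mdegD mdeg1 addn1 => -[].
  have <- : dir (delta_mx 0 l) f = f^`M(l).
    rewrite /dir (bigD1 l) //= big1 ?addr0 => [|j jl]; first by rewrite mxE !eqxx scale1r.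
    by rewrite mxE (negPf jl) scale0r.
  have -> : dirs s (dir (delta_mx 0 l) f) = dirs (rcons s (delta_mx 0 l)) f.
    by rewrite /dirs foldr_rcons.
  by apply: f0; rewrite size_rcons sD.
have := euler fD; rewrite big1 => [/esym/eqP|l _]; last by rewrite d0 mulr0.
by rewrite scaler_eq0 (negPf (natr_neq0 char0 D)) => /eqP.
Qed.

End DirectionalDerivatives.

(** * An operator commuting with the normalizer *)

Section Laplacian.
Variables (k : fieldType) (char0 : [pchar k] =i pred0) (n : nat).
Variables (G : {fset 'M[k]_n}) (GG : finite_linear_group G).
Implicit Types (f : {mpoly k[n]}).

(* The composite of the reduced comultiplication [f |-> f(x + y) - f(x) - f(y)],
   the projection onto the invariants of [G x G], and the multiplication. *)
Definition comult_mult f := \sum_(g <- G) (act (1%:M + g) f - f - act g f).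
Local Notation tau := comult_mult.

Let D2 := ideal_mul (inv_plus G) (inv_plus G).
Let mulG (g h : G) : G := [` groupMM GG (valP g) (valP h)]%fset.
Let invG (g : G) : G := [` groupVM GG (valP g)]%fset.

Section Kappa.
Variables (D : nat) (D0 : (0 < D)%N) (v : 'I_D -> 'rV[k]_n).
Let I : finType := {ffun 'I_D -> G}.

Let frame (y : I) := [seq v i *m val (y i) | i <- enum 'I_D].
Let shift (b : seq bool) (h : G) (y : I) : I :=
  [ffun i : 'I_D => if nth false b i then mulG (y i) h else y i].

Let size_frame y : size (frame y) = D.
Proof. by rewrite size_map size_enum_ord. Qed.

Let nth_frame y (i : 'I_D) : nth 0 (frame y) i = v i *m val (y i).
Proof. by rewrite (nth_map i) ?size_enum_ord // nth_ord_enum. Qed.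

Let frame_shift b h y : size b = D -> frame (shift b h y) = twist (val h) b (frame y).
Proof.
move=> bD; apply: (@eq_from_nth _ 0).
  by rewrite size_frame size_map size_zip size_frame bD minnn.
move=> i; rewrite size_frame => iD; rewrite (nth_frame _ (Ordinal iD)).
rewrite (nth_map (false, 0)); last by rewrite size_zip size_frame bD minnn.
rewrite nth_zip ?size_frame // (nth_frame _ (Ordinal iD)) /shift ffunE /=.
by case: ifP => _ //=; rewrite mulmxA.
Qed.

(** The polarization of f at vectors v_i moved by elements of G: a function on the finite set G^D,
    on which the operator acts by matrices with integral entries. *)
Let kappa f y := ev 0 (dirs (frame y) f).

Let twist_frame_true g y : twist g (nseq D true) (frame y) = [seq w *m g | w <- frame y].
Proof. by rewrite -{1}(size_frame y) twist_true. Qed.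

Let twist_frame_false g y : twist g (nseq D false) (frame y) = frame y.
Proof. by rewrite -{1}(size_frame y) twist_false. Qed.

Let kappa_tau f y : kappa (tau f) y =
  \sum_(b <- proper_masks D) \sum_(h : G) kappa f (shift b h y).
Proof.
rewrite /kappa /comult_mult dirs_sum ev_sum big_seq_fsetE /= exchange_big.
apply: eq_bigr => h _; rewrite !dirsB !mevalB !ev0_dirs_act dirs_twist ev_sum size_frame.
rewrite big_proper_masks // twist_frame_true twist_frame_false !addrK.
rewrite big_seq [RHS]big_seq; apply: eq_bigr => b.
by rewrite mem_filter => /andP[_ /size_masks bD]; rewrite frame_shift.
Qed.

Let ev0_dirs_invariant f s h : invariant G f -> h \in G ->
  ev 0 (dirs [seq w *m h | w <- s] f) = ev 0 (dirs s f).
Proof. by move=> fi hG; rewrite -ev0_dirs_act fi. Qed.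

(** By Leibniz, a product of two invariants without constant term contributes, for each proper
    subset b, derivatives of one factor along b times derivatives of the other along the complement.
    As the first factor is invariant, this is unchanged when h is applied at the positions in b. So
    kappa f is a sum of functions invariant under the respective actions, and the sum of the orbit
    operators kills it. *)
Let kappa_eq0 f : D2 f -> tau f = 0 -> forall y, kappa f y = 0.
Proof.
move=> [s sP ->] t0.
pose F b y := \sum_(x <- s) ev 0 (dirs (mask b (frame y)) x.1) *
                            ev 0 (dirs (mask (map negb b) (frame y)) x.2).
apply: (sum_orbit_operators_inj (s := proper_masks D) (a := shift) (mul := mulG)
          (inv := invG) _ _ _ _ char0 (F := F)).
- move=> b h h' y; apply/ffunP => i; rewrite !ffunE; case: (nth false b i) => //.
  by apply/val_inj; rewrite /= mulmxA.
- move=> h h1 h2 /(congr1 val) /= E; apply/val_inj => /=.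
  by rewrite -[val h1](mulKmx (group_unit GG (valP h))) E mulKmx // (group_unit GG (valP h)).
- move=> h1 h2 /(congr1 val) /= /(congr1 invmx); rewrite !invmxK => E; exact/val_inj.
- move=> b h y; apply/ffunP => i; rewrite !ffunE; case: (nth false b i) => //.
  by apply/val_inj; rewrite /= mulmxK // (group_unit GG (valP h)).
- move=> y; rewrite /kappa dirs_sum ev_sum /F exchange_big; apply: eq_big_seq => x xs.
  have [[x1i x10] [x2i x20]] := sP x xs.
  rewrite dirs_prod ev_sum size_frame big_proper_masks //.
  have maskT : mask (nseq D true) (frame y) = frame y.
    by rewrite mask_true ?size_frame.
  have maskF : mask (nseq D false) (frame y) = [::] by rewrite mask_false.
  have z (p : {mpoly k[n]}) : mplus p -> ev 0 (dirs [::] p) = 0 by rewrite /mplus mcoeff0_ev.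
  rewrite !map_nseq maskT maskF [X in _ + X + _]mevalM [X in _ + X]mevalM.
  rewrite (z _ x10) (z _ x20) mul0r mulr0 !addr0.
  by apply: eq_bigr => b _; rewrite mevalM.
- move=> b h y; rewrite mem_filter => /andP[_ /size_masks bD].
  rewrite /F; apply: eq_big_seq => x xs; have [[x1i _] [x2i _]] := sP x xs.
  by rewrite frame_shift // mask_twist mask_twistN ev0_dirs_invariant // (valP h).
- by move=> y; rewrite -kappa_tau t0 /kappa dirs0 meval0.
by apply/card_gt0P; exists [` group1M GG]%fset.
Qed.

Lemma decomposable_dirs_eq0 f : D2 f -> tau f = 0 ->
  ev 0 (dirs [seq v i | i <- enum 'I_D] f) = 0.
Proof.
move=> fD2 t0; rewrite -[RHS](kappa_eq0 fD2 t0 [ffun=> [` group1M GG]%fset]).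
rewrite /kappa; congr (ev 0 (dirs _ f)); apply: eq_map => i.
by rewrite ffunE /= mulmx1.
Qed.

End Kappa.

Lemma decomposable_ker_comult_mult D f : (0 < D)%N -> f \is (D).-homog ->
  D2 f -> tau f = 0 -> f = 0.
Proof.
move=> D0 fD fD2 t0; apply: (dirs_eq0 char0 fD) => s sD.
have := decomposable_dirs_eq0 D0 (fun i : 'I_D => nth 0 s i) fD2 t0.
congr (ev 0 (dirs _ f) = 0); rewrite -[RHS](mkseq_nth 0) sD /mkseq -val_enum_ord -map_comp.
by apply: eq_map.
Qed.

Lemma comult_multB f f' : tau (f - f') = tau f - tau f'.
Proof.
have subACA (a b c e : {mpoly k[n]}) : a - b - (c - e) = a - c - (b - e).
  by rewrite !opprB addrACA [RHS]addrACA [- b - c]addrC.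
rewrite /comult_mult -sumrB; apply: eq_bigr => g _.
rewrite [X in X - _ - _]raddfB [X in _ - X]raddfB /=.
by rewrite [RHS]subACA [X in _ = X - _]subACA.
Qed.

Lemma comult_multZ c f : tau (c *: f) = c *: tau f.
Proof.
rewrite /comult_mult scaler_sumr; apply: eq_bigr => g _.
by rewrite !actZ !scalerBr.
Qed.

Lemma comult_mult_sum (I : Type) (r : seq I) (P : pred I) F :
  tau (\sum_(i <- r | P i) F i) = \sum_(i <- r | P i) tau (F i).
Proof.
rewrite /comult_mult exchange_big; apply: eq_bigr => g _ /=.
by rewrite !act_sum -!sumrB.
Qed.

(** Conjugation by h permutes G and fixes the identity matrix, hence permutes the summands. *)
Lemma comult_mult_act h f : normalizes G h -> tau (act h f) = act h (tau f).
Proof.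
move=> [hu hG]; rewrite /comult_mult act_sum.
have conj_perm : perm_eq [seq h *m g *m invmx h | g <- G] G.
  have inj : injective (fun g : 'M[k]_n => h *m g *m invmx h).
    by move=> x y /(congr1 (fun z => invmx h *m z *m h)); rewrite /= !mulmxA mulVmx // !mul1mx !mulmxKV.
  apply: uniq_perm; rewrite ?map_inj_uniq ?fset_uniq // => x.
  apply/mapP/idP => [[g gG ->]|xG].
    by rewrite -hG !mulmxA mulVmx // mul1mx mulmxKV.
  exists (invmx h *m x *m h); first by rewrite hG.
  by rewrite !mulmxA mulmxV // mul1mx mulmxK.
rewrite -(perm_big _ conj_perm) big_map; apply: eq_bigr => g _ /=.
have E1 : act (1%:M + h *m g *m invmx h) (act h f) = act h (act (1%:M + g) f).
  by rewrite -!(act_comp char0) mulmxDl mul1mx mulmxKV // mulmxDr mulmx1.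
have E2 : act (h *m g *m invmx h) (act h f) = act h (act g f).
  by rewrite -!(act_comp char0) mulmxKV.
by rewrite E1 E2 [RHS]raddfB [X in _ = X - _]raddfB.
Qed.

Lemma normalizes_mem h : h \in G -> normalizes G h.
Proof.
move=> hG; have hu := group_unit GG hG; split=> // g; apply/idP/idP => [gG|gG].
  have -> : g = h *m (invmx h *m g *m h) *m invmx h.
    by rewrite !mulmxA mulmxV // mul1mx mulmxK.
  exact: (groupMM GG (groupMM GG hG gG) (groupVM GG hG)).
exact: (groupMM GG (groupMM GG (groupVM GG hG) gG) hG).
Qed.

Lemma comult_mult_invariant f : invariant G f -> invariant G (tau f).
Proof. by move=> fi h hG; rewrite -comult_mult_act ?fi //; apply: normalizes_mem. Qed.

Lemma act0 f : act 0 f = (ev 0 f)%:MP.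
Proof. by apply: (ev_inj char0) => w; rewrite ev_act mulmx0 mevalC. Qed.

(** The expansion of f(x + y) with separated variables, taken at x = v g and y = v h. *)
Lemma comultiplication f : exists s : seq ({mpoly k[n]} * {mpoly k[n]}),
  forall g h, act (g + h) f = \sum_(x <- s) act g x.1 * act h x.2.
Proof.
elim/mpoly_ring_ind: f => [c|i|f f' [s sE] [s' s'E]|f f' [s sE] [s' s'E]].
- by exists [:: (c%:MP, 1)] => g h; rewrite big_seq1 /= !actC rmorph1 mulr1.
- exists [:: ('X_i, 1); (1, 'X_i)] => g h; rewrite big_cons big_seq1 /= !rmorph1 mulr1 mul1r.
  by rewrite !actX -big_split; apply: eq_bigr => j _; rewrite mxE scalerDl.
- by exists (s ++ s') => g h; rewrite big_cat /= -sE -s'E rmorphD.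
exists [seq (x.1 * y.1, x.2 * y.2) | x <- s, y <- s'] => g h.
rewrite [LHS]rmorphM /= sE s'E big_allpairs_dep big_distrl; apply: eq_bigr => x _ /=.
by rewrite big_distrr; apply: eq_bigr => y _ /=; rewrite !rmorphM /= mulrACA.
Qed.

(** Separate the variables in f(x + y), sum each factor over G and subtract its constant term: the
    products of the results add up to N tau f, where setting g or h to 0 in the expansion accounts
    for the subtracted terms. *)
Lemma comult_mult_decomposable f : invariant G f -> ev 0 f = 0 -> D2 (tau f).
Proof.
move=> fi f0; have [s sE] := comultiplication f.
pose N : k := (size G)%:R; have N0 : N != 0 := group_order_neq0 char0 GG.
pose c (p : {mpoly k[n]}) := (N * ev 0 p)%:MP : {mpoly k[n]}.
have ev0_transfer p : ev 0 (transfer G p) = N * ev 0 p.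
  rewrite /transfer ev_sum (eq_bigr (fun=> ev 0 p)) => [|g _]; last exact: ev0_act.
  by rewrite big_const_seq count_predT iter_addr addr0 mulr_natl.
(* As f is invariant, f(v g + v h) = f(v + v h g^-1), so the double sum is N times a single one. *)
have sumE : \sum_(x <- s) transfer G x.1 * transfer G x.2 = N *: \sum_(g <- G) act (1%:M + g) f.
  transitivity (\sum_(g <- G) \sum_(h <- G) act (g + h) f).
    rewrite (eq_bigr (fun x => \sum_(g <- G) \sum_(h <- G) act g x.1 * act h x.2)) => [|x _].
      rewrite exchange_big; apply: eq_bigr => g _; rewrite exchange_big; apply: eq_bigr => h _.
      by rewrite sE.
    by rewrite /transfer big_distrl; apply: eq_bigr => g _; rewrite big_distrr.
  rewrite (eq_big_seq (fun=> \sum_(g <- G) act (1%:M + g) f)) => [|g gG].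
    by rewrite big_const_seq count_predT iter_addr addr0 scaler_nat.
  rewrite -[RHS](big_groupMr GG _ _ (groupVM GG gG)); apply: eq_bigr => h _.
  by rewrite -{2}(fi g gG) -(act_comp char0) mulmxDl mul1mx mulmxKV // (group_unit GG gG).
have half p q : (forall g, act g f = \sum_(x <- s) p x *: act g (q x)) ->
    \sum_(x <- s) (N * p x) *: transfer G (q x) = N ^+ 2 *: f.
  move=> H; transitivity (N *: transfer G f).
    rewrite /transfer (eq_bigr _ (fun g _ => H g)) exchange_big scaler_sumr /=.
    by apply: eq_bigr => x _; rewrite -scaler_sumr scalerA.
  by rewrite (transfer_id fi) scalerA.
have half1 : \sum_(x <- s) c x.2 * transfer G x.1 = N ^+ 2 *: f.
  rewrite -(half (fun x => ev 0 x.2) (fun x => x.1)) => [|g].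
    by apply: eq_bigr => x _; rewrite /c mul_mpolyC.
  rewrite -{1}[g]addr0 sE; apply: eq_bigr => x _.
  by rewrite act0 mulrC mul_mpolyC.
have half2 : \sum_(x <- s) c x.1 * transfer G x.2 = N ^+ 2 *: f.
  rewrite -(half (fun x => ev 0 x.1) (fun x => x.2)) => [|g].
    by apply: eq_bigr => x _; rewrite /c mul_mpolyC.
  rewrite -{1}[g]add0r sE; apply: eq_bigr => x _.
  by rewrite act0 mul_mpolyC.
have consts : \sum_(x <- s) c x.1 * c x.2 = 0.
  transitivity ((N ^+ 2)%:MP * act (0 + 0) f).
    rewrite sE big_distrr; apply: eq_bigr => x _ /=.
    by rewrite !act0 /c -!mpolyCM expr2 mulrACA.
  by rewrite addr0 act0 f0 mpolyC0 mulr0.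
have NtE : N *: tau f = \sum_(x <- s) (transfer G x.1 - c x.1) * (transfer G x.2 - c x.2).
  rewrite (eq_bigr (fun x => transfer G x.1 * transfer G x.2 - c x.2 * transfer G x.1
     - c x.1 * transfer G x.2 + c x.1 * c x.2)) => [|x _]; last by ring.
  rewrite big_split !sumrB /= sumE half1 half2 consts addr0 /comult_mult !sumrB.
  rewrite -/(transfer G f) (transfer_id fi) big_const_seq count_predT iter_addr addr0.
  by rewrite !scalerBr -scaler_nat !scalerA.
have inv_part p : inv_plus G (transfer G p - c p).
  split; first by apply: invariantB; [apply: transfer_invariant | apply: invariantC].
  by rewrite /mplus mcoeff0_ev mevalB mevalC ev0_transfer subrr.
exists [seq (N^-1 *: (transfer G x.1 - c x.1), transfer G x.2 - c x.2) | x <- s].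
  move=> _ /mapP[x _ ->] /=; split; last exact: inv_part.
  have [xi x0] := inv_part x.1; split; first exact: invariantZ.
  by rewrite /mplus mcoeffZ x0 mulr0.
rewrite big_map /=; apply: (scalerI N0); rewrite NtE scaler_sumr.
by apply: eq_bigr => x _; rewrite -scalerAl scalerA mulfV // scale1r.
Qed.

End Laplacian.

Lemma decomposable_pihomog (k : closedFieldType) (char0 : [pchar k] =i pred0) (n : nat)
    (G : {fset 'M[k]_n}) D f :
  ideal_mul (inv_plus G) (inv_plus G) f ->
  ideal_mul (inv_plus G) (inv_plus G) (pihomog mdeg D f).
Proof.
have inv_pi a p : inv_plus G p -> inv_plus G (pihomog mdeg a p).
  move=> [pI p0]; split; first by move=> h hG; rewrite -pihomog_act // pI.
  by move: p0; rewrite /mplus mcoeff_pihomog => ->; case: ifP.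
move=> [s sP ->]; rewrite raddf_sum; apply: decomposable_sum => x xs _ /=.
have [x1 x2] := sP x xs; rewrite pihomogM; apply: decomposable_sum => a _ _.
by apply: decomposableM; apply: inv_pi.
Qed.

(** * Complements of the decomposables in each degree *)

Section Decomposition.
Variables (k : closedFieldType) (char0 : [pchar k] =i pred0) (n : nat).
Variables (G : {fset 'M[k]_n}) (GG : finite_linear_group G).

Let D2 := ideal_mul (inv_plus G) (inv_plus G).
Local Notation tau := (comult_mult G).

Let comult_mult_dhomog D f : f \is (D).-homog -> tau f \is (D).-homog.
Proof.
move=> fD; apply: rpred_sum => g _.
by rewrite !rpredB // dhomog_act.
Qed.

Section Degree.
Variables (D : nat) (D0 : (0 < D)%N).

Let good_elt f := invariant G f /\ f \is (D).-homog.

Let good_tau f : good_elt f -> good_elt (tau f).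
Proof. by move=> [fi fD]; split; [apply: comult_mult_invariant | apply: comult_mult_dhomog]. Qed.

Let D2_tau f : good_elt f -> D2 (tau f).
Proof. by move=> [fi fD]; apply: comult_mult_decomposable => //; apply: dhomog_ev0 fD. Qed.

Let good_iter a f : good_elt f -> good_elt (iter a tau f).
Proof. by move=> fg; elim: a => //= a; apply: good_tau. Qed.

(** The image of the operator is decomposable and the operator is injective there, so iterating does
    not enlarge its kernel. *)
Let ker_iter a f : good_elt f -> iter a tau f = 0 -> tau f = 0.
Proof.
move=> fg; elim: a => [/= ->|a IH].
  by have := comult_multZ G 0 0; rewrite !scale0r.
case: a IH => [_ //|a IH] H; apply: IH.
apply: (decomposable_ker_comult_mult char0 GG D0) => //.
  by have [] := good_tau (good_iter a fg).
exact/D2_tau/good_iter.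
Qed.

(** All iterates have degree D, so the number of monomials of degree at most D bounds the dimension
    of their span. *)
Lemma iterates_dependent f : good_elt f ->
  exists v : 'I_(#|{: 'X_{1..n < D.+1}}|.+1) -> k,
    (exists i, v i != 0) /\ \sum_i v i *: iter i tau f = 0.
Proof.
move=> fg; set N := #|_|.
pose A : 'M[k]_(N.+1, N) := \matrix_(i, j) (iter i tau f)@_(bmnm (enum_val j)).
have : kermx A != 0.
  by rewrite -mxrank_eq0 mxrank_ker subn_eq0 -ltnNge ltnS rank_leq_col.
case/rowV0Pn => v /sub_kermxP vA /rV0Pn[i vi]; exists (v 0); split; first by exists i.
apply/mpolyP => x; rewrite mcoeff0 raddf_sum /=.
case: (eqVneq (mdeg x) D) => [xD|xD]; last first.
  rewrite big1 // => j _; rewrite mcoeffZ; have [_ jD] := good_iter j fg.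
  by rewrite (dhomog_nemf_coeff jD) ?mulr0.
have xD' : (mdeg x < D.+1)%N by rewrite xD.
have := congr1 (fun M : 'rV_N => M 0 (enum_rank (BMultinom xD'))) vA.
rewrite mxE [RHS]mxE => E; rewrite -[RHS]E; apply: eq_bigr => j _.
by rewrite mcoeffZ mxE enum_rankK.
Qed.

Let tau_poly (cs : seq k) f := foldr (fun c y => c *: f + tau y) 0 cs.

Let tau0 : tau 0 = 0.
Proof. by have := comult_multZ G 0 0; rewrite !scale0r. Qed.

Let tau_polyE cs f : tau_poly cs f = \sum_(i < size cs) cs`_i *: iter i tau f.
Proof.
elim: cs => [|c cs IH]; first by rewrite big_ord0.
rewrite big_ord_recl /= IH comult_mult_sum; congr (_ + _); apply: eq_bigr => i _.
by rewrite comult_multZ.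
Qed.

Let good_tau_poly cs f : good_elt f -> good_elt (tau_poly cs f).
Proof.
move=> fg; elim: cs => [|c cs IH] /=.
  by split; [move=> h _; apply: raddf0 | apply: rpred0].
have [ti tD] := good_tau IH; have [fi fD] := fg.
by split; [apply/invariantD/ti/invariantZ | apply/rpredD/tD/rpredZ].
Qed.

(** The power of the operator in front of the first nonzero coefficient c is removed by [ker_iter].
    Divided by c, what is left is an element of the kernel that differs from f by an element of the
    image. *)
Let decomposition_of_relation a cs f : good_elt f -> has (fun c => c != 0) cs ->
  iter a tau (tau_poly cs f) = 0 ->
  exists c, [/\ good_elt c, tau c = 0 & D2 (f - c)].
Proof.
move=> fg; elim: cs a => //= c cs IH a; case: (eqVneq c 0) => [->|c0] /=.
  by rewrite scale0r add0r -iterSr => csN0; apply: IH.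
move=> _ H; exists (c^-1 *: (c *: f + tau (tau_poly cs f))).
have yg : good_elt (tau_poly (c :: cs) f) by apply: good_tau_poly.
split.
- by have [yi yD] := yg; split; [apply: invariantZ | apply: rpredZ].
- by rewrite comult_multZ (ker_iter yg H) scaler0.
rewrite scalerDr scalerA mulVf // scale1r opprD addrA subrr add0r.
by apply/decomposableN/decomposableZ/D2_tau/good_tau_poly.
Qed.

Lemma invariant_decomposition f : good_elt f ->
  exists c, [/\ good_elt c, tau c = 0 & D2 (f - c)].
Proof.
move=> fg; have [v [[i vi] vE]] := iterates_dependent fg.
apply: (@decomposition_of_relation 0 [seq v i | i <- enum 'I__]) => //.
  by apply/hasP; exists (v i) => //; apply: map_f; rewrite mem_enum.
transitivity (\sum_i v i *: iter i tau f) => //.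
rewrite [LHS]tau_polyE size_map size_enum_ord; apply: eq_bigr => j _.
by rewrite (nth_map j) ?size_enum_ord // nth_ord_enum.
Qed.

End Degree.
End Decomposition.

Section Splitting.
Variables (k : closedFieldType) (char0 : [pchar k] =i pred0) (n : nat).
Variables (G : {fset 'M[k]_n}) (GG : finite_linear_group G).
Variables (m : nat) (d : 'I_m -> nat).
Hypothesis d_gt0 : forall i, (0 < d i)%N.
Variables (r : nat) (F : r.-tuple {mpoly k[m]}).
Variables (J : {set 'I_r}) (phi : {lrmorphism {mpoly k[m]} -> {mpoly k[n]}}).
Hypothesis phi_iso : fibre_product_iso G d F J phi.

Let D2 := ideal_mul (inv_plus G) (inv_plus G).
Local Notation tau := (comult_mult G).

Let primitive_generators : exists c : 'I_m -> {mpoly k[n]}, forall i,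
  [/\ invariant G (c i), c i \is (d i).-homog, tau (c i) = 0 & D2 (phi 'X_i - c i)].
Proof.
have H i : exists c : {mpoly k[n]},
    [/\ invariant G c, c \is (d i).-homog, tau c = 0 & D2 (phi 'X_i - c)].
  have [|c [[ci cD] ct cd]] := invariant_decomposition char0 GG (d_gt0 i) (f := phi 'X_i).
    by split; [apply: (phi_invariant phi_iso) | apply: (phi_weight char0 phi_iso)].
  by exists c.
by have [c cP] := boolp.choice H; exists c.
Qed.

(** The components of the phi X_i in the kernel of the operator span E^* modulo decomposables, and
    contain in their span every homogeneous invariant of positive degree in that kernel; hence the
    span is stable under the normalizer. *)
Lemma equivariant_splitting_exists :
  exists e (u : e.-tuple {mpoly k[n]}), equivariant_splitting G u.
Proof.
have [c cP] := primitive_generators.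
have ci i : invariant G (c i) by case: (cP i).
have cD i : c i \is (d i).-homog by case: (cP i).
have ct i : tau (c i) = 0 by case: (cP i).
have cd i : D2 (phi 'X_i - c i) by case: (cP i).
have c0 i : ev 0 (c i) = 0 by apply: dhomog_ev0 (cD i).
have span f : inv_plus G f -> exists v : 'I_m -> k, D2 (f - \sum_i v i *: c i).
  move=> /inv_plusE[fi f0]; have [s sE] := phi_surj phi_iso fi.
  have s0 : ev 0 s = 0 by rewrite -(ev0_phi char0 d_gt0 phi_iso) sE.
  exists (fun i => linear_part s i 0).
  rewrite -(subrKA (\sum_i linear_part s i 0 *: phi 'X_i)); apply: decomposableD.
    by rewrite -sE; apply: (decomposable_linear char0 d_gt0 phi_iso).
  rewrite -sumrB; apply: decomposable_sum => i _ _.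
  by rewrite -scalerBr; apply/decomposableZ/cd.
have pihomog_comb D (P : pred 'I_m) (v : 'I_m -> k) :
    pihomog mdeg D (\sum_(i | P i) v i *: c i) =
    \sum_(i | P i) (if d i == D then v i else 0) *: c i.
  rewrite raddf_sum; apply: eq_bigr => i _; rewrite /= linearZ /=.
  case: (eqVneq (d i) D) => [<-|dD]; first by rewrite pihomog_dE.
  by rewrite (pihomog_ne0 dD) // scaler0 scale0r.
have tau_comb (P : pred 'I_m) (v : 'I_m -> k) : tau (\sum_(i | P i) v i *: c i) = 0.
  by rewrite comult_mult_sum big1 // => i _; rewrite comult_multZ ct scaler0.
have primitive_span D f : (0 < D)%N -> invariant G f -> f \is (D).-homog -> tau f = 0 ->
    exists v : 'I_m -> k, f = \sum_i v i *: c i.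
  move=> D0 fi fD ft; have [|v vE] := span f.
    by apply/inv_plusE; split=> //; apply: dhomog_ev0 fD.
  exists (fun i => if d i == D then v i else 0).
  have E : f - \sum_i (if d i == D then v i else 0) *: c i = pihomog mdeg D (f - \sum_i v i *: c i).
    by rewrite raddfB /= pihomog_comb pihomog_dE.
  apply/eqP; rewrite -subr_eq0; apply/eqP.
  apply: (decomposable_ker_comult_mult char0 GG D0).
  - by rewrite E; apply: pihomogP.
  - by rewrite E; apply: decomposable_pihomog.
  by rewrite comult_multB ft tau_comb subrr.
have comb_eq0 (P : pred 'I_m) (v : 'I_m -> k) :
    D2 (\sum_(i | P i) v i *: c i) -> \sum_(i | P i) v i *: c i = 0.
  move=> fd; set f := \sum_(i | P i) _ in fd *.
  have [K _ ->] := pihomog_partition_geq mdeg 0 f; apply: big1 => a _.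
  case: (posnP a) => [->|a0].
    rewrite pihomog_comb big1 // => i _.
    by rewrite -(inj_eq (@addnI 1%N)) eq_sym ltn_eqF ?scale0r // ltnS d_gt0.
  apply: (decomposable_ker_comult_mult char0 GG a0); first exact: pihomogP.
    exact: decomposable_pihomog.
  by rewrite pihomog_comb tau_comb.
(* A basis is extracted as a spanning subset of minimal size, so that its members remain
   homogeneous. *)
pose spanning (A : {set 'I_m}) := forall j, exists a : 'I_m -> k, c j = \sum_(i in A) a i *: c i.
have spT : boolp.asbool (spanning setT).
  apply/boolp.asboolP => j; exists (fun i => (i == j)%:R).
  by rewrite (bigD1 j) ?inE //= eqxx scale1r big1 ?addr0 // => i /andP[_ /negPf ->]; rewrite scale0r.
have [A /boolp.asboolP spA minA] :=
  arg_minnP (P := fun A => boolp.asbool (spanning A)) (fun A : {set 'I_m} => #|A|) spT.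
have indepA (v : 'I_m -> k) : \sum_(i in A) v i *: c i = 0 -> forall i, i \in A -> v i = 0.
  move=> v0 i iA; apply/eqP; apply: contraT => vi.
  suff spi : boolp.asbool (spanning (A :\ i)).
    by have := minA _ spi; rewrite [#|A|](cardsD1 i) iA ltnn.
  apply/boolp.asboolP => j; have [a ->] := spA j.
  exists (fun l => a l - a i / v i * v l).
  have -> : \sum_(l in A :\ i) (a l - a i / v i * v l) *: c l =
      \sum_(l in A) (a l - a i / v i * v l) *: c l.
    rewrite [RHS](bigD1 i) //= divfK // subrr scale0r add0r; apply: eq_bigl => l.
    by rewrite !inE andbC.
  transitivity (\sum_(l in A) a l *: c l - a i / v i *: \sum_(l in A) v l *: c l).
    by rewrite v0 scaler0 subr0.
  rewrite scaler_sumr -sumrB; apply: eq_bigr => l _.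
  by rewrite scalerBl scalerA.
pose u := [tuple c (enum_val l) | l < #|A|].
have toA (v : 'I_m -> k) : exists a : 'I_(#|A|) -> k,
    \sum_i v i *: c i = \sum_(l < #|A|) a l *: tnth u l.
  have [a aE] := boolp.choice spA.
  exists (fun l => \sum_i v i * a i (enum_val l)).
  transitivity (\sum_i \sum_(l in A) (v i * a i l) *: c l).
    by apply: eq_bigr => i _; rewrite {1}aE scaler_sumr; apply: eq_bigr => l _; rewrite scalerA.
  rewrite exchange_big /= big_enum_val; apply: eq_bigr => l _.
  by rewrite tnth_mktuple scaler_suml.
exists #|A|, u; split.
- move=> l; rewrite tnth_mktuple; split; first by apply/inv_plusE.
  exists (d (enum_val l)); apply/(weighted_homogP char0) => x xc; rewrite weight_std.
  by move/dhomogP: (cD (enum_val l)); apply.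
- move=> f /span[v vE]; have [a aE] := toA v; exists a; by rewrite -aE.
- move=> a aD l.
  pose v i := if [pick l | enum_val l == i] is Some l then a l else 0 : k.
  have vE l' : v (enum_val l') = a l'.
    rewrite /v; case: pickP => [l'' /eqP/enum_val_inj -> //|/(_ l')].
    by rewrite eqxx.
  rewrite -vE; apply: indepA (enum_valP l); apply: comb_eq0; move: aD.
  rewrite [in X in _ -> X]big_enum_val /=.
  by congr (D2 _); apply: eq_bigr => l' _; rewrite vE tnth_mktuple.
move=> g gN; have [gu gG] := gN.
have H j : exists a : 'I_(#|A|) -> k, act g (tnth u j) = \sum_(l < #|A|) a l *: tnth u l.
  rewrite tnth_mktuple; set i := enum_val j.
  have gci : invariant G (act g (c i)).
    move=> h hG; have -> : act h (act g (c i)) = act g (act (invmx g *m h *m g) (c i)).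
      by rewrite -!(act_comp char0) !mulmxA mulmxV // mul1mx.
    by rewrite (ci i) // gG.
  have gct : tau (act g (c i)) = 0 by rewrite comult_mult_act // ct raddf0.
  have [v ->] := primitive_span (d i) _ (d_gt0 i) gci (dhomog_act char0 g (cD i)) gct.
  exact: toA.
have [a aE] := boolp.choice H; exists (\matrix_(i, j) a j i) => j.
by rewrite aE; apply: eq_bigr => i _; rewrite mxE.
Qed.

End Splitting.

Theorem mainTheorem9 (k : closedFieldType) (char0 : [pchar k] =i pred0)
    (n : nat) (G : {fset 'M[k]_n})
    (G_group : finite_linear_group G)
    (G_norefl : forall g, g \in G -> ~ reflection g)
    (m : nat) (d : 'I_m -> nat) (d_gt0 : forall i, (0 < d i)%N)
    (W : {fset 'M[k]_m}) (W_refl : reflection_group W)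
    (W_graded : forall w (t : k), w \in W -> t != 0 ->
       w *m grading_mx d t = grading_mx d t *m w)
    (r : nat) (F : r.-tuple {mpoly k[m]})
    (F_gen : homogeneous_generators d W F) (J : {set 'I_r})
    (phi : {lrmorphism {mpoly k[m]} -> {mpoly k[n]}})
    (phi_iso : fibre_product_iso G d F J phi) :
  (exists! Wt : {fset 'M[k]_n},
     [/\ reflection_group Wt, normal_in G Wt & quotient_is G Wt W phi]) /\
  (forall Wt : {fset 'M[k]_n},
     [/\ reflection_group Wt, normal_in G Wt & quotient_is G Wt W phi] ->
     good G Wt) /\
  (forall w (v : 'rV[k]_m), w \in W ->
     tangent0 (fun f => phi f = 0) (v *m w - v)).
Proof.
have WG := proj1 W_refl.
have [Wt WtP] := extension_exists char0 G_group G_norefl d_gt0 WG W_graded F_gen phi_iso.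
split.
  exists Wt; split=> // Wt' [[Wt'G _] Wt'n Wt'q]; case: WtP => -[WtG _] Wtn Wtq.
  exact: (extension_unique char0 G_group WG phi_iso WtG Wtn Wtq Wt'G Wt'n Wt'q).
split=> [Wt' [_ _ Wt'q]|w v].
  split; first exact: (equivariant_splitting_exists char0 G_group d_gt0 phi_iso).
  move=> e u spl.
  exact: (good_for_splitting char0 G_group d_gt0 WG F_gen phi_iso spl Wt'q).
exact: (tangent_claim char0 d_gt0 F_gen phi_iso).
Qed.
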